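(* Let $1<p<\infty$, $k,\ell\in\mathbb{N}^*$, and let $\Omega\subset\mathbb{R}^n$ be an open $n$-set with $W_p^k(\Omega)=C_p^k(\Omega)$ (as sets, with equivalent norms). Then the following compact embeddings hold: 1. $W_p^{k+\ell}(\Omega)\subset\subset W_q^\ell(\Omega)$, 2. $W_p^k(\Omega)\subset\subset L_q^{loc}(\Omega)$, or $W_p^k(\Omega)\subset\subset L_q(\Omega)$ if $\Omega$ is bounded, with $q\in[1,+\infty[$ if $kp=n$, $q\in[1,+\infty]$ if $kp>n$, and $q\in[1,\frac{pn}{n-kp}[$ if $kp<n$.
   Context: $\mathbb{N}^*=\{1,2,\dots\}$. $\Omega$ is an $n$-set if there are $c_1,c_2>0$ with $c_1r^n\le m_n(\Omega\cap B_r(x))\le c_2r^n$ for all $x\in\Omega$, $0<r\le1$, where $m_n$ is $n$-dimensional Hausdorff measure and $B_r(x)$ the Euclidean ball. $C_p^k(\Omega)$ is the space of $f\in L_p(\Omega)$ such that $f^\sharp_{k,\Omega}(x)=\sup_{r>0}r^{-k}\inf_{P}\frac1{\mu(B_r(x))}\int_{B_r(x)\cap\Omega}|f-P|\,dy\in L_p(\Omega)$ (infimum over polynomials of degree $\le k-1$, $\mu$ Lebesgue measure), with norm $\|f\|_{L_p(\Omega)}+\|f^\sharp_{k,\Omega}\|_{L_p(\Omega)}$. $X\subset\subset Y$ means that $X$ is compactly embedded in $Y$; $W_p^k(\Omega)\subset\subset L_q^{loc}(\Omega)$ means that for every measurable compact $K\subset\Omega$ the restriction map $W_p^k(\Omega)\to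 L_q(K)$ is compact.
   Formalization: Item 1 fails for every unbounded Ω (translates of a bump, e.g. Ω = R^n); it is proved for bounded Ω, and for general Ω in local form: restriction W_p^{k+l}(Ω) → W_q^l(Ω') is compact for open Ω' with compact closure in Ω. *)

(* Defs.v *)
From HB Require Import structures.
From mathcomp Require Import all_boot all_order all_algebra.
From mathcomp Require Import all_classical all_reals all_analysis.
From mathcomp Require Import measurable_realfun.
From mathcomp Require mpoly.

Set Implicit Arguments.
Unset Strict Implicit.
Unset Printing Implicit Defensive.

Import Order.TTheory GRing.Theory Num.Theory.
Import numFieldNormedType.Exports.

Local Open Scope classical_set_scope.
Local Open Scope ring_scope.

(* 'rV[R]_n carries its Borel sigma-algebra. *)
HB.instance Definition _ (R : realType) (n : nat) :=
  Measurable.copy 'rV[R]_n (g_sigma_algebraType (@open 'rV[R]_n)).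

Section lebesgue_measure_on_rows.
Context {R : realType}.

Definition row_cons (n : nat) (z : R * 'rV[R]_n) : 'rV[R]_n.+1 :=
  \row_i oapp (fun j => z.2 ord0 j) z.1 (unlift ord0 i).

Definition row_uncons (n : nat) (x : 'rV[R]_n.+1) : R * 'rV[R]_n :=
  (x ord0 ord0, \row_j x ord0 (lift ord0 j)).

Lemma row_consK n : cancel (@row_cons n) (@row_uncons n).
Proof.
move=> [a v]; rewrite /row_uncons /row_cons mxE unlift_none /=; congr pair.
by apply/rowP => j; rewrite !mxE liftK.
Qed.

Lemma row_unconsK n : cancel (@row_uncons n) (@row_cons n).
Proof.
move=> x; apply/rowP => j; rewrite /row_cons /row_uncons mxE.
by case: unliftP => [i|] -> /=; rewrite ?mxE.
Qed.

Lemma open_measurable_row n (A : set 'rV[R]_n) : open A -> measurable A.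
Proof. exact: sub_sigma_algebra. Qed.

Lemma ball_row_cons n (z w : R * 'rV[R]_n) (e : R) :
  ball (row_cons z) e (row_cons w) <-> ball z.1 e w.1 /\ ball z.2 e w.2.
Proof.
split=> [[e0 H]|[H1 [e0 H2]]].
  split; first by have := H ord0 ord0; rewrite !mxE unlift_none.
  split=> // i j; have := H ord0 (lift ord0 j).
  by rewrite !mxE liftK /= (ord1 i).
by split=> // i j; rewrite !mxE; case: unliftP => [k|] _ //=.
Qed.

Lemma dense_ratr (x e : R) : 0 < e -> exists q : rat, ball (ratr q : R) e x.
Proof.
move=> e0; have /rat_in_itvoo[q] : x < x + e by rewrite ltrDl.
rewrite in_itv /= => /andP[q1 q2].
by exists q; rewrite /ball /= gtr0_norm ?subr_gt0// ltrBlDl.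
Qed.

Lemma dense_ratr_row n (v : 'rV[R]_n) (e : R) : 0 < e ->
  exists q : 'rV[rat]_n, ball (map_mx ratr q : 'rV[R]_n) e v.
Proof.
move=> e0; have [f Hf] := choice (fun j => dense_ratr (v ord0 j) e0).
by exists (\row_j f j); split=> // i j; rewrite !mxE (ord1 i); exact: Hf.
Qed.

Lemma measurable_row_cons n : measurable_fun [set: R * 'rV[R]_n] (@row_cons n).
Proof.
apply: (@measurability _ _ _ _ _ _ (@open 'rV[R]_n.+1)) => // _ [U oU <-].
rewrite setTI.
pose B (t : (rat * 'rV[rat]_n) * rat) : set (R * 'rV[R]_n) :=
  ball (ratr t.1.1 : R) (ratr t.2) `*`
  ball (map_mx ratr t.1.2 : 'rV[R]_n) (ratr t.2).
pose C t := [set z | B t z /\ B t `<=` @row_cons n @^-1` U].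
have -> : @row_cons n @^-1` U = \bigcup_t C t.
  apply/seteqP; split=> [z Uz|z [t _ [Bz /(_ _ Bz)]]//].
  have : nbhs (row_cons z) U by apply: open_nbhs_nbhs.
  rewrite -nbhs_ballE => -[e /= e0 eU].
  have /rat_in_itvoo[r] : 0 < e / 2 by rewrite divr_gt0.
  rewrite in_itv /= => /andP[r0 re].
  have [a Ha] := dense_ratr z.1 r0.
  have [q Hq] := dense_ratr_row z.2 r0.
  have rre : ratr r + ratr r <= e by rewrite [leRHS]splitr lerD// ltW.
  exists ((a, q), r) => //; split=> // w [/= w1 w2]; apply: eU.
  apply/ball_row_cons; split; apply: (le_ball rre).
  - by apply: ball_triangle w1; exact: ball_sym.
  - by apply: ball_triangle w2; exact: ball_sym.
apply: countable_bigcupT_measurable => // t.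
have [BU|BU] := pselect (B t `<=` @row_cons n @^-1` U).
  have -> : C t = B t by apply/seteqP; split=> [z []|z].
  apply: measurableX; first by apply: open_measurable; exact: ball_open.
  by apply: open_measurable_row; exact: ball_open.
by have -> : C t = set0 by apply/seteqP; split=> [z []|z].
Qed.

Lemma measurable_row_uncons n :
  measurable_fun [set: 'rV[R]_n.+1] (@row_uncons n).
Proof.
apply/measurable_fun_pairP; split.
  apply: (measurability _ (RGenOpens.measurableE R)) => _ [_ [a [b ->]] <-].
  rewrite setTI; apply: open_measurable_row.
  apply: (@open_comp _ _ (fun x : 'rV[R]_n.+1 => x ord0 ord0)).
    by move=> x _; exact: coord_continuous.
  exact: interval_open.
apply: (@measurability _ _ _ _ _ _ (@open 'rV[R]_n)) => // _ [U oU <-].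
rewrite setTI; apply: open_measurable_row.
apply: (@open_comp _ _
  (fun x : 'rV[R]_n.+1 => \row_j x ord0 (lift ord0 j))) => //.
move=> x _; apply/(@cvg_ballP _ _ _ (nbhs x)) => e e0.
apply: filterS (nbhsx_ballx x e e0) => y [_ xy].
by split=> // i j; rewrite !mxE.
Qed.

Definition lebesgue_cons (n : nat)
    (m : {sigma_finite_measure set 'rV[R]_n -> \bar R}) :
    set 'rV[R]_n.+1 -> \bar R :=
  pushforward (lebesgue_measure \x m)%E (@row_cons n).

Section lebesgue_cons_measure.
Variables (n : nat) (m : {sigma_finite_measure set 'rV[R]_n -> \bar R}).
Local Open Scope ereal_scope.

Let lebesgue_cons0 : lebesgue_cons m set0 = 0.
Proof. by rewrite /lebesgue_cons /pushforward preimage_set0 measure0. Qed.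

Let lebesgue_cons_ge0 A : 0 <= lebesgue_cons m A.
Proof. by rewrite /lebesgue_cons /pushforward; exact: measure_ge0. Qed.

Let mrow_cons A : measurable A -> measurable (@row_cons n @^-1` A).
Proof.
by move=> mA; rewrite -[X in measurable X]setTI; exact: measurable_row_cons.
Qed.

Let lebesgue_cons_sigma_additive : semi_sigma_additive (lebesgue_cons m).
Proof.
move=> F mF tF mUF; rewrite /lebesgue_cons /pushforward preimage_bigcup.
apply: measure_semi_sigma_additive.
- by move=> k; exact: mrow_cons.
- apply/trivIsetP => /= i j _ _ ij; rewrite -preimage_setI.
  by move/trivIsetP : tF => /(_ _ _ _ _ ij) ->//; rewrite preimage_set0.
- by rewrite -preimage_bigcup; exact: mrow_cons.
Qed.

HB.instance Definition _ := isMeasure.Build _ _ _ (lebesgue_cons m)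
  lebesgue_cons0 lebesgue_cons_ge0 lebesgue_cons_sigma_additive.

Let lebesgue_cons_sigma_finite :
  sigma_finite [set: 'rV[R]_n.+1] (lebesgue_cons m).
Proof.
have /sigma_finiteP[F [TF ndF Foo]] := sigma_finiteT (@lebesgue_measure R).
have /sigma_finiteP[G [TG ndG Goo]] := sigma_finiteT m.
exists (fun k => @row_uncons n @^-1` (F k `*` G k)).
  apply/seteqP; split=> // x _.
  have [i _ Fx] : (\bigcup_k F k) (row_uncons x).1 by rewrite -TF.
  have [j _ Gx] : (\bigcup_k G k) (row_uncons x).2 by rewrite -TG.
  exists (maxn i j) => //; split.
    by move: Fx; exact/subsetPset/ndF/leq_maxl.
  by move: Gx; exact/subsetPset/ndG/leq_maxr.
move=> k; have [mF Fk] := Foo k; have [mG Gk] := Goo k; split.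
  rewrite -[X in measurable X]setTI; apply: measurable_row_uncons => //.
  exact: measurableX.
rewrite /lebesgue_cons /pushforward -comp_preimage.
have -> : @row_uncons n \o @row_cons n = id.
  by apply/funext => z /=; rewrite row_consK.
by rewrite preimage_id product_measure1E// lte_mul_pinfty// ge0_fin_numE.
Qed.

HB.instance Definition _ := Measure_isSigmaFinite.Build _ _ _ (lebesgue_cons m)
  lebesgue_cons_sigma_finite.

End lebesgue_cons_measure.

(* Lebesgue measure on R^n: the point mass on R^0, and the image of
   lambda_1 x lambda_n under (a, v) |-> (a, v_1, ..., v_n) on R^(n+1). *)
Fixpoint leb (n : nat) : {sigma_finite_measure set 'rV[R]_n -> \bar R} :=
  if n is k.+1 then lebesgue_cons (leb k) else \d_(0 : 'rV[R]_0).

Lemma leb_box n (a b : 'I_n -> R) : (forall i, a i <= b i)%R ->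
  leb n [set x : 'rV[R]_n | forall i, (a i <= x ord0 i <= b i)%R] =
  (\prod_i (b i - a i))%:E.
Proof.
elim: n a b => [|n IH] a b ab /=.
  by rewrite big_ord0 diracE mem_set//= => -[].
rewrite /lebesgue_cons /pushforward.
pose B := [set x : 'rV[R]_n | forall i,
  (a (lift ord0 i) <= x ord0 i <= b (lift ord0 i))%R].
have -> : @row_cons n @^-1` [set x | forall i, (a i <= x ord0 i <= b i)%R] =
    `[a ord0, b ord0] `*` B.
  apply/seteqP; split=> [[c v] /= H|[c v] /= [H1 H2] i].
    split; first by have := H ord0; rewrite mxE unlift_none in_itv.
    by move=> i; have := H (lift ord0 i); rewrite mxE liftK.
  by rewrite mxE; case: unliftP => [j|] ->; rewrite //= in H1 *.
have mB : measurable B.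
  pose S (i : 'I_n) := [set x : 'rV[R]_n |
    x ord0 i \in `[a (lift ord0 i), b (lift ord0 i)]].
  have -> : B = ~` \bigcup_i ~` S i.
    rewrite setC_bigcup; apply/seteqP; split=> [x H i _|x H i].
      by rewrite setCK /S /= in_itv; exact: H.
    by have := H i I; rewrite setCK /S /= in_itv.
  apply: measurableC; apply: countable_bigcupT_measurable => // i.
  apply: open_measurable_row.
  apply: (@open_comp _ _ (fun x : 'rV[R]_n => x ord0 i)
    (~` `[a (lift ord0 i), b (lift ord0 i)])).
    by move=> x _; exact: coord_continuous.
  by rewrite openC; exact: interval_closed.
rewrite product_measure1E//= lebesgue_measure_itv /= IH//.
rewrite big_ord_recl EFinM lte_fin EFinB; case: ltP => // ba.
have -> : a ord0 = b ord0 by apply/eqP; rewrite eq_le ab ba.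
by rewrite subee// !mul0e.
Qed.

End lebesgue_measure_on_rows.

Section euclidean.
Context {R : realType} {n : nat}.
Implicit Types (x y : 'rV[R]_n) (A : set 'rV[R]_n).

(* `|x| is the sup norm on 'rV[R]_n; it has the same open, compact and bounded
   sets as the Euclidean norm, which is needed only for balls and diameters. *)
Definition enorm x : R := Num.sqrt (\sum_i x ord0 i ^+ 2).

Definition eball x (r : R) : set 'rV[R]_n := [set y | enorm (y - x) < r].

Local Open Scope ereal_scope.

(* 0 is added so that the empty set has diameter 0 rather than -oo. *)
Definition ediam A : \bar R :=
  ereal_sup (0 |` [set (enorm (z.1 - z.2))%:E | z in A `*` A]).

Definition hausdorff_content (s : nat) (delta : R) A : \bar R :=
  ereal_inf [set \sum_(0 <= i <oo) ediam (U i) ^+ s | U in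
    [set U : nat -> set 'rV[R]_n |
      A `<=` \bigcup_i U i /\ forall i, ediam (U i) <= delta%:E]].

(* s-dimensional Hausdorff measure, s >= 1, without the normalising constant
   that makes it agree with Lebesgue measure when s = n. *)
Definition hausdorff_measure (s : nat) A : \bar R :=
  ereal_sup [set hausdorff_content s delta A | delta in [set d | (0 < d)%R]].

Definition is_nset A : Prop :=
  exists c1 c2 : R, [/\ (0 < c1)%R, (0 < c2)%R &
    forall x (r : R), A x -> (0 < r <= 1)%R ->
      (c1 * r ^+ n)%:E <= hausdorff_measure n (A `&` eball x r) <=
      (c2 * r ^+ n)%:E].

End euclidean.

Section function_spaces.
Import -(notations) mpoly.
Context {R : realType} {n : nat}.
Implicit Types (Omega : set 'rV[R]_n) (f g phi : 'rV[R]_n -> R) (p : \bar R).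
Local Open Scope ereal_scope.

(* Functions on Omega are represented by functions on R^n, whose values outside
   Omega are irrelevant; restriction to a subset is then the identity. *)
Definition Lp_norm Omega p (F : 'rV[R]_n -> \bar R) : \bar R :=
  'N[leb n]_p[F \_ Omega].

Definition in_Lp Omega p (F : 'rV[R]_n -> \bar R) : Prop :=
  measurable_fun Omega F /\ Lp_norm Omega p F < +oo.

Definition Lp_space Omega p : set ('rV[R]_n -> R) :=
  [set f | in_Lp Omega p (EFin \o f)].

Definition partial (i : 'I_n) f : 'rV[R]_n -> R :=
  fun x => 'D_(delta_mx ord0 i) f x.

Definition partials (s : seq 'I_n) f : 'rV[R]_n -> R := foldr partial f s.

Definition smooth f : Prop :=
  forall s : seq 'I_n, continuous (partials s f) /\
    forall i x, derivable (partials s f) x (delta_mx ord0 i).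

Definition test_function Omega : set ('rV[R]_n -> R) :=
  [set phi | [/\ smooth phi,
    compact (closure [set x | phi x != 0%R]) &
    closure [set x | phi x != 0%R] `<=` Omega]].

(* 'X_{1..n}, the type of multi-indices *)
Local Notation multi_index := (multinom n).

Definition mderiv (alpha : multi_index) f : 'rV[R]_n -> R :=
  foldr (fun i => iter (alpha i) (partial i)) f (enum 'I_n).

Definition loc_integrable Omega f : Prop :=
  measurable_fun Omega f /\
  forall K : set 'rV[R]_n, compact K -> K `<=` Omega ->
    \int[leb n]_(x in K) `|(f x)%:E| < +oo.

Definition is_weak_deriv Omega (alpha : multi_index) f g : Prop :=
  [/\ loc_integrable Omega f, loc_integrable Omega g &
    forall phi, test_function Omega phi ->
      \int[leb n]_(x in Omega) (f x * mderiv alpha phi x)%:E =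
      ((-1) ^+ mdeg alpha)%:E *
      \int[leb n]_(x in Omega) (g x * phi x)%:E].

(* A chosen representative: weak derivatives are unique up to a null set. *)
Definition weak_deriv Omega (alpha : multi_index) f : 'rV[R]_n -> R :=
  xget (fun=> 0%R) [set g | is_weak_deriv Omega alpha f g].

Definition sobolev (k : nat) Omega p : set ('rV[R]_n -> R) :=
  [set f | Lp_space Omega p f /\
    forall alpha : multi_index, (mdeg alpha <= k)%N ->
      exists2 g, Lp_space Omega p g & is_weak_deriv Omega alpha f g].

(* The sum over |alpha| <= k of the L_p norms of the derivatives, for p = +oo
   too: equivalent to the l_p-sum. *)
Definition sobolev_norm (k : nat) Omega p f : \bar R :=
  \sum_(alpha : bmultinom n k.+1)
    Lp_norm Omega p (EFin \o weak_deriv Omega alpha f).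

Definition poly_eval (P : mpoly n R) (y : 'rV[R]_n) : R :=
  meval (fun i => y ord0 i) P.

(* msize P <= k says that P has degree at most k - 1. *)
Definition sharp (k : nat) Omega f (x : 'rV[R]_n) : \bar R :=
  ereal_sup [set (r ^- k)%:E *
      ereal_inf [set (fine (leb n (eball x r)))^-1%:E *
          \int[leb n]_(y in eball x r `&` Omega) `|(f y - poly_eval P y)%:E|
        | P in [set P : mpoly n R | (msize P <= k)%N]]
    | r in [set r : R | (0 < r)%R]].

Definition calderon (k : nat) Omega p : set ('rV[R]_n -> R) :=
  [set f | Lp_space Omega p f /\ in_Lp Omega p (sharp k Omega f)].

Definition calderon_norm (k : nat) Omega p f : \bar R :=
  Lp_norm Omega p (EFin \o f) + Lp_norm Omega p (sharp k Omega f).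

Definition sobolev_eq_calderon (k : nat) Omega p : Prop :=
  sobolev k Omega p = calderon k Omega p /\
  exists c1 c2 : R, [/\ (0 < c1)%R, (0 < c2)%R &
    forall f, sobolev k Omega p f ->
      c1%:E * sobolev_norm k Omega p f <= calderon_norm k Omega p f <=
      c2%:E * sobolev_norm k Omega p f].

(* NX and NY are the (semi)norms of X and Y; compactness of the inclusion (or
   restriction) X -> Y is stated sequentially. *)
Definition compactly_embedded (X : set ('rV[R]_n -> R))
    (NX : ('rV[R]_n -> R) -> \bar R) (Y : set ('rV[R]_n -> R))
    (NY : ('rV[R]_n -> R) -> \bar R) : Prop :=
  [/\ X `<=` Y,
    exists C : R, forall u, X u -> NY u <= C%:E * NX u &
    forall u : nat -> 'rV[R]_n -> R, (forall j, X (u j)) ->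
      (exists M : R, forall j, NX (u j) <= M%:E) ->
      exists sigma : nat -> nat, {homo sigma : i j / (i < j)%N} /\
        exists2 v, Y v & NY (u (sigma j) \- v)%R @[j --> \oo] --> 0].

Definition sobolev_in_sobolev (k : nat) Omega p (l : nat) Omega' q : Prop :=
  compactly_embedded (sobolev k Omega p) (sobolev_norm k Omega p)
    (sobolev l Omega' q) (sobolev_norm l Omega' q).

Definition sobolev_in_Lp (k : nat) Omega p (K : set 'rV[R]_n) q : Prop :=
  compactly_embedded (sobolev k Omega p) (sobolev_norm k Omega p)
    (Lp_space K q) (fun f => Lp_norm K q (EFin \o f)).

End function_spaces.

(* When k p > n, the value q = +oo is allowed. *)
Definition admissible_exponent {R : realType} (n k : nat) (p : R)
    (q : \bar R) : Prop :=
  [/\ (1 <= q)%E,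
    k%:R * p = n%:R -> (q < +oo)%E &
    k%:R * p < n%:R -> (q < (p * n%:R / (n%:R - k%:R * p))%:E)%E].

(* Main.v *)
(** Since W_p^k = C_p^k, it suffices to embed the Calderon space compactly into
    L_q over bounded sets. Let g be the maximal function of f. On each dyadic
    cell of side s = 2^-j choose a polynomial of degree < k close to f near
    that cell, and let T_j be the resulting piecewise polynomial. Since Omega
    is an n-set, Remez' inequality turns the L_1 bounds in the definition of g
    into the pointwise bounds |T_(j+1) - T_j| <= C s^k g(x) and (by Chebyshev)
    |T_(j+1) - T_j| <= C s^k s^(-n/p) |g|_p on Omega. Interpolating between
    them gives |T_(j+1) - T_j| <= C s^(k - theta n/p) g^(1 - theta) |g|_p^theta
    with theta = max(0, 1 - p/q); the exponent of s is positive exactly in the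
    admissible range of q. Hence T_j converges to f geometrically in L_q,
    uniformly on bounded sets of functions, while on a bounded set each T_j is
    determined, up to a small error, by finitely many rounded numbers: the
    embedding is bounded and totally bounded, so the completeness of L_q gives
    compactness. For W_p^(k+l) this is applied to all derivatives of order at
    most l. *)

Require Import Defs.
From mathcomp Require Import all_boot all_order all_algebra.
From mathcomp Require Import all_classical all_reals all_analysis.
From mathcomp Require Import measurable_realfun ess_sup_inf.
From mathcomp Require Import lra zify.

Set Implicit Arguments.
Unset Strict Implicit.
Unset Printing Implicit Defensive.

Import Order.TTheory GRing.Theory Num.Theory.
Import numFieldNormedType.Exports.

Local Open Scope classical_set_scope.
Local Open Scope ring_scope.

(** * Polynomials bounded on large sets *)

(** Several obstacles shape the details. The choice of polynomials is not linear in f, so T_j is no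
    finite rank operator; compactness comes from total boundedness, phrased as a finite colouring
    whose classes have small diameter, which needs bounds only. The maximal function may vanish or
    be infinite, so all estimates are normalised by a number N > 0 that bounds the norms of f. The
    power g^(1 - theta) has to be integrable to the power q, which asks for (1 - theta) q <= p,
    while decay asks for theta n/p < k; for q > p the least possible theta, 1 - p/q, turns the
    latter into n/p - n/q < k. The density of Omega is given for Hausdorff measure but used for
    Lebesgue measure; comparing the two on open sets bridges this. Finally [weak_deriv] is a choice
    of representative, so differences, restrictions and compositions of derivatives agree with it
    only almost everywhere: hence the bump functions, the fundamental lemma of the calculus of
    variations and the symmetry of mixed partials. *)

Section one_variable_polynomials.
Context {R : realType}.
Implicit Types (p : {poly R}) (a L d M : R) (ts : seq R).

(** Bounds a polynomial of degree below k on an interval of length L by its values at k nodes with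
    gaps at least d L. The recursion comes from p = p(t) + q (X - t): at the other nodes |q| <= 2 M
    / (d L), and |x - t| <= L. *)
Fixpoint interp_const (k : nat) d : R :=
  if k is m.+1 then 1 + 2 * interp_const m d / d else 0.

Lemma interp_const_ge0 k d : 0 < d -> 0 <= interp_const k d.
Proof.
move=> d0; elim: k => //= k IH.
by rewrite addr_ge0// divr_ge0 ?(ltW d0)// mulr_ge0.
Qed.

Lemma poly_le_of_separated_points k p a L d M ts :
  0 < d -> 0 < L -> (size p <= k)%N -> size ts = k ->
  pairwise (fun t u => d * L <= `|t - u|) ts ->
  {in ts, forall t, a <= t <= a + L} -> {in ts, forall t, `|p.[t]| <= M} ->
  forall x, a <= x <= a + L -> `|p.[x]| <= interp_const k d * M.
Proof.
move=> d0 L0; elim: k p M ts => [|k IH] p M ts.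
  by rewrite leqn0 size_poly_eq0 => /eqP -> _ _ _ _ x _; rewrite horner0 normr0 mul0r.
case: ts => [//|t ts] sp /= [sts] /andP[tts pw] ain pM x xab.
have tab : a <= t <= a + L by apply: ain; rewrite mem_head.
have M0 : 0 <= M by apply: le_trans (pM t _); rewrite ?normr_ge0 ?mem_head.
have /factor_theorem[q pq] : root (p - p.[t]%:P) t.
  by rewrite /root !hornerE subrr.
have {}pq : p = p.[t]%:P + q * ('X - t%:P) by rewrite -pq addrC subrK.
have sq : (size q <= k)%N.
  have [->|q0] := eqVneq q 0; first by rewrite size_poly0.
  have : (size (q * ('X - t%:P))%R <= k.+1)%N.
    have -> : q * ('X - t%:P) = p - p.[t]%:P by rewrite {1}pq addrAC subrr add0r.
    rewrite (leq_trans (size_polyD _ _))// geq_max sp size_polyN.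
    by rewrite (leq_trans (size_polyC_leq1 _)).
  by rewrite size_Mmonic ?monicXsubC// size_XsubC addn2.
have pxE y : p.[y] = p.[t] + q.[y] * (y - t) by rewrite {1}pq !hornerE.
have dL0 : 0 < d * L by rewrite mulr_gt0.
have qM u : u \in ts -> `|q.[u]| <= 2 * M / (d * L).
  move=> uts; rewrite ler_pdivlMr//.
  have := allP tts _ uts; rewrite distrC => /(ler_wpM2l (normr_ge0 q.[u])) /le_trans; apply.
  rewrite -normrM; have -> : q.[u] * (u - t) = p.[u] - p.[t] by rewrite pxE; lra.
  apply: le_trans (ler_normB _ _) _; rewrite mulr2n mulrDl mul1r.
  by rewrite lerD// pM// ?mem_head// in_cons uts orbT.
have ain' : {in ts, forall t0, a <= t0 <= a + L}.
  by move=> u uts; apply: ain; rewrite in_cons uts orbT.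
have := IH q _ ts sq sts pw ain' qM x xab.
have -> : interp_const k d * (2 * M / (d * L)) =
   2 * interp_const k d / d * M / L.
  by rewrite invfM; lra.
rewrite ler_pdivlMr// => qx.
rewrite pxE (le_trans (ler_normD _ _))// mulrDl mul1r lerD ?pM ?mem_head//.
rewrite normrM (le_trans _ qx)// ler_wpM2l//.
by rewrite ler_norml; move: tab xab; lra.
Qed.

(** Greedy choice: the intervals of radius e = c L / (2 k) about fewer than k points have total
    measure below 2 k e = c L, so A has a point outside all of them. *)
Lemma exists_separated_points (A : set R) (a L c : R) k m :
  measurable A -> 0 < c -> 0 < L -> A `<=` [set x | a <= x <= a + L] ->
  ((c * L)%:E <= lebesgue_measure A)%E -> (m <= k)%N ->
  exists ts, [/\ size ts = m, {in ts, forall t, A t} &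
    pairwise (fun t u => c / (2 * k%:R) * L <= `|t - u|) ts].
Proof.
move=> mA c0 L0 AaL cA; set e := c / _ * L.
elim: m => [|m IH] mk; first by exists [::].
have [ts [sts tsA pw]] := IH (ltnW mk).
have k0 : 0 < k%:R :> R by rewrite ltr0n (leq_ltn_trans _ mk).
have e0 : 0 < e by rewrite mulr_gt0// divr_gt0// mulr_gt0.
pose U s := [set x : R | has (fun t => `|x - t| < e) s].
have UE s : measurable (U s) /\ (lebesgue_measure (U s) <= (e *+ 2 *+ size s)%:E)%E.
  elim: s => [|t s [mU leU]].
    have -> : U [::] = set0 by apply/seteqP; split.
    by rewrite measure0 mulr0n; split; first exact: measurable0.
  have -> : U (t :: s) = `]t - e, t + e[ `|` U s.
    apply/seteqP; split=> [x /= /orP[|]|x [|] /=].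
    - by rewrite in_itv/= ltr_distl; left.
    - by right.
    - by rewrite in_itv/= /U/= ltr_distl => ->.
    - by rewrite /U/= => ->; rewrite orbT.
  have mt : measurable (`]t - e, t + e[%classic : set R) by exact: measurable_itv.
  split; first exact: measurableU.
  apply: le_trans (measureU2 _ _ _) _ => //.
  rewrite /= mulrS EFinD leeD//.
  rewrite lebesgue_measure_itv/= lte_fin.
  case: ifPn => _; first by rewrite -EFinD lee_fin; lra.
  by apply: (le_trans (_ : _ <= 0%:E)%E) => //; rewrite lee_fin mulrn_wge0// ltW.
have [t At nU] : exists2 t, A t & ~ U ts t.
  apply: contrapT => /forall2NP AU.
  have {}AU : A `<=` U ts by move=> t At; case: (AU t) => // /contrapT.
  have [mU leU] := UE ts.
  have AU' : (lebesgue_measure A <= lebesgue_measure (U ts))%E.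
    by apply: le_measure; rewrite ?inE.
  have := le_trans cA (le_trans AU' leU); rewrite lee_fin sts leNgt => /negP; apply.
  have -> : c * L = e *+ 2 *+ k.
    rewrite /e -mulrnA -[RHS]mulr_natr natrM mulrAC; congr (_ * _).
    by rewrite divfK// mulf_neq0// gt_eqF.
  by rewrite ltr_pMn2l// pmulrn_lgt0.
exists (t :: ts); split=> /=; first by rewrite sts.
  by move=> u; rewrite in_cons => /orP[/eqP -> //|/tsA].
rewrite pw andbT; apply/allP => u uts; rewrite leNgt; apply/negP => tu.
by apply: nU; apply/hasP; exists u.
Qed.

End one_variable_polynomials.

Section separately_polynomial.
Context {R : realType}.

Definition row_set n (x : 'rV[R]_n) (i : 'I_n) (t : R) : 'rV[R]_n :=
  \row_j if j == i then t else x ord0 j.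

(* Slicing out a coordinate preserves this property, unlike a bound on the
   total degree given by an explicit polynomial in n variables. *)
Definition sep_poly n (k : nat) (F : 'rV[R]_n -> R) : Prop :=
  forall x i, exists2 p : {poly R}, (size p <= k)%N &
    forall t, F (row_set x i t) = p.[t].

Definition cube n (a : 'rV[R]_n) (L : R) : set 'rV[R]_n :=
  [set x | forall i, a ord0 i <= x ord0 i <= a ord0 i + L].

Lemma row_set_cons0 n t u (v : 'rV[R]_n) :
  row_set (row_cons (t, v)) ord0 u = row_cons (u, v).
Proof.
apply/rowP => j; rewrite !mxE; case: unliftP => [i|] -> /=; last by rewrite ?eqxx ?unlift_none.
by rewrite ?eq_liftF ?mxE ?liftK.
Qed.

Lemma row_set_cons_lift n t (v : 'rV[R]_n) i u :
  row_set (row_cons (t, v)) (lift ord0 i) u = row_cons (t, row_set v i u).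
Proof.
apply/rowP => j; rewrite !mxE; case: unliftP => [k|] -> /=.
  by rewrite (inj_eq lift_inj) !mxE.
by [].
Qed.

Lemma sep_poly_slice n k (F : 'rV[R]_n.+1 -> R) t :
  sep_poly k F -> sep_poly k (fun v => F (row_cons (t, v))).
Proof.
move=> Fk x i; have [p pk Fp] := Fk (row_cons (t, x)) (lift ord0 i).
by exists p => // u; rewrite -Fp row_set_cons_lift.
Qed.

Lemma sep_polyB n k (F G : 'rV[R]_n -> R) :
  sep_poly k F -> sep_poly k G -> sep_poly k (F \- G).
Proof.
move=> Fk Gk x i; have [p pk Fp] := Fk x i; have [q qk Gq] := Gk x i.
exists (p - q) => [|t]; last by rewrite /= Fp Gq !hornerE.
by rewrite (leq_trans (size_polyD _ _))// size_polyN geq_max pk.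
Qed.

Lemma cube_cons n (a x : 'rV[R]_n.+1) L : cube a L x <->
  (a ord0 ord0 <= (row_uncons x).1 <= a ord0 ord0 + L) /\
  cube (row_uncons a).2 L (row_uncons x).2.
Proof.
split=> [H|[H1 H2] i].
  by split; [exact: H|move=> i; rewrite !mxE; exact: H].
by case: (unliftP ord0 i) => [j|] ->; [have := H2 j; rewrite !mxE|].
Qed.

Lemma measurable_preimage_row_cons n (A : set 'rV[R]_n.+1) :
  measurable A -> measurable (@row_cons R n @^-1` A).
Proof.
by move=> mA; rewrite -[X in measurable X]setTI; exact: measurable_row_cons.
Qed.

Lemma measurable_coord n (i : 'I_n) :
  measurable_fun [set: 'rV[R]_n] (fun x => x ord0 i).
Proof.
apply: (measurability _ (RGenOpens.measurableE R)) => _ [_ [a [b ->]] <-].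
rewrite setTI; apply: open_measurable_row.
apply: (@open_comp _ _ (fun x : 'rV[R]_n => x ord0 i)).
  by move=> x _; exact: coord_continuous.
exact: interval_open.
Qed.

Lemma measurable_row_forall n (P : 'I_n -> set R) :
  (forall i, measurable (P i)) ->
  measurable [set x : 'rV[R]_n | forall i, P i (x ord0 i)].
Proof.
move=> mP.
have -> : [set x : 'rV[R]_n | forall i, P i (x ord0 i)] =
    ~` \bigcup_i ((fun x : 'rV[R]_n => x ord0 i) @^-1` (~` P i)).
  rewrite setC_bigcup; apply/seteqP; split=> [x H i _ /=|x H i].
    by apply; exact: H.
  by have := H i I; rewrite /= notK.
apply: measurableC; apply: countable_bigcupT_measurable => // i.
rewrite -[X in measurable X]setTI; apply: measurable_coord => //.
exact: measurableC.
Qed.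

Lemma measurable_cube n (a : 'rV[R]_n) L : measurable (cube a L).
Proof.
rewrite (_ : cube a L = [set x : 'rV[R]_n |
    forall i, `[a ord0 i, a ord0 i + L]%classic (x ord0 i)]).
  by apply: (measurable_row_forall (P := fun i => `[a ord0 i, a ord0 i + L]%classic)) => i; exact: measurable_itv.
by apply/seteqP; split=> x H i; have := H i; rewrite /= in_itv.
Qed.

Lemma leb_cube n (a : 'rV[R]_n) L : 0 <= L -> leb n (cube a L) = (L ^+ n)%:E.
Proof.
move=> L0; rewrite (leb_box (a := fun i => a ord0 i)); last first.
  by move=> i; rewrite lerDl.
rewrite (eq_bigr (fun=> L)); last by move=> i _; rewrite addrC addKr.
by rewrite prodr_const card_ord.
Qed.

(* Remez' inequality in several variables, by slicing along the first
   coordinate: by Fubini, many slices of A are large. *)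
Lemma sep_poly_le_of_measure n k (c : R) : 0 < c -> exists2 C : R, 0 <= C &
  forall a (L : R) (F : 'rV[R]_n -> R) A (M : R), 0 < L -> sep_poly k F ->
    measurable A -> A `<=` cube a L -> ((c * L ^+ n)%:E <= leb n A)%E ->
    (forall x, A x -> `|F x| <= M) -> forall x, cube a L x -> `|F x| <= C * M.
Proof.
elim: n c => [|n IH] c c0.
  exists 1 => // a L F A M L0 _ mA _ cA FM x _; rewrite mul1r.
  apply: FM; move: cA; rewrite expr0 mulr1 /= diracE.
  case: (boolP (0 \in A)) => [|_]; last by rewrite lee_fin leNgt c0.
  by rewrite inE; have -> : x = 0 by apply/rowP => -[].
have c20 : 0 < c / 2 by rewrite divr_gt0.
have [C C0 HC] := IH _ c20.
(* Using k + 1 nodes instead of k keeps the gap constant positive when k = 0. *)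
have d0 : 0 < c / 2 / (2 * k.+1%:R) by rewrite divr_gt0// mulr_gt0.
exists (interp_const k.+1 (c / 2 / (2 * k.+1%:R)) * C).
  by rewrite mulr_ge0// interp_const_ge0.
move=> a L F A M L0 Fk mA AaL cA FM x /cube_cons[x1 x2].
have mB := measurable_preimage_row_cons mA.
set B := _ @^-1` _ in mB.
have Bsec t v : xsection B t v <-> A (row_cons (t, v)).
  by rewrite /xsection/= inE.
have msec t : measurable (xsection B t) by exact: measurable_xsection.
(* The first coordinates whose slices are large enough for the induction hypothesis with c / 2. *)
pose T := [set t | a ord0 ord0 <= t <= a ord0 ord0 + L /\
  ((c / 2 * L ^+ n)%:E <= leb n (xsection B t))%E].
have Tslice t : T t -> forall v, cube (row_uncons a).2 L v ->
    `|F (row_cons (t, v))| <= C * M.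
  move=> [tab Tt]; apply: (HC _ _ _ (xsection B t)) => //.
  - exact: sep_poly_slice.
  - by move=> v /Bsec /AaL /cube_cons; rewrite row_consK => -[].
  - by move=> v /Bsec; exact: FM.
have mI : measurable (`[a ord0 ord0, a ord0 ord0 + L]%classic : set R).
  exact: measurable_itv.
have mT : measurable T.
  have -> : T = `[a ord0 ord0, a ord0 ord0 + L] `&`
      (fun t => leb n (xsection B t)) @^-1` `[(c / 2 * L ^+ n)%:E, +oo[.
    by apply/seteqP; split=> t /=; rewrite !in_itv/= andbT.
  have : measurable_fun `[a ord0 ord0, a ord0 ord0 + L] (leb n \o xsection B).
    by apply: measurable_funTS; exact: measurable_fun_xsection.
  by apply => //; exact: emeasurable_itv.
(* Slices over T have measure at most L^n and the others at most (c/2) L^n, so c L^(n+1) <= L^n |T|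
   + (c/2) L^(n+1). *)
have LT : ((c / 2 * L)%:E <= lebesgue_measure T)%E.
  have Ln0 : 0 < L ^+ n by rewrite exprn_gt0.
  have : (leb n.+1 A <= \int[lebesgue_measure]_(t in `[a ord0 ord0, (a ord0 ord0 + L)%R])
      ((L ^+ n)%:E * (\1_T t)%:E + (c / 2 * L ^+ n)%:E))%E.
    rewrite /= /lebesgue_cons /pushforward -/B /product_measure1.
    rewrite [leRHS]integral_mkcond.
    apply: ge0_le_integral => //.
    - exact: measurable_fun_xsection.
    - apply/(measurable_restrictT _ _).1 => //.
      apply: emeasurable_funD => //; apply: measurable_funeM.
      by apply/measurable_EFinP; apply: measurable_indic.
    - move=> t _; rewrite patchE; case: ifPn => [|/negP tab]; last first.
        rewrite le_eqVlt; apply/orP; left; apply/eqP.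
        rewrite /= (_ : xsection B t = set0) ?measure0//.
        apply/seteqP; split=> // v /Bsec /AaL /cube_cons; rewrite row_consK/= => -[tab' _].
        by case: tab; rewrite inE/= in_itv.
      rewrite inE/= in_itv/= => tab; rewrite indicE.
      case: (boolP (t \in T)) => [_|nT].
        rewrite mule1; apply: le_trans (_ : (L ^+ n)%:E <= _)%E; last first.
          by rewrite leeDl// lee_fin ltW// mulr_gt0.
        rewrite -(leb_cube (row_uncons a).2 (ltW L0)).
        apply: le_measure; rewrite ?inE//.
          exact: measurable_cube.
        by move=> v /Bsec /AaL /cube_cons; rewrite row_consK => -[].
      rewrite mule0 add0e leNgt; apply/negP => /ltW lt.
      by move/negP: nT; apply; rewrite inE.
  move=> /(le_trans cA); rewrite ge0_integralD//; last 3 first.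
  - by move=> t _; rewrite -EFinM lee_fin mulr_ge0// ltW.
  - by apply: measurable_funeM; apply/measurable_EFinP; apply: measurable_indic.
  - by move=> t _; rewrite lee_fin mulr_ge0// ltW.
  have m1T : measurable_fun `[a ord0 ord0, a ord0 ord0 + L] (fun t => (\1_T t)%:E : \bar R).
    by apply/measurable_EFinP; apply: measurable_indic.
  have Ln0' : (0 <= (L ^+ n)%:E)%E by rewrite lee_fin ltW.
  rewrite ge0_integralZl//.
  rewrite integral_indic// integral_cst//= lebesgue_measure_itv/= lte_fin ltrDl L0.
  rewrite -EFinD addrAC subrr add0r.
  have -> : T `&` `[a ord0 ord0, (a ord0 ord0 + L)%R] = T.
    by apply/seteqP; split=> t [] //= tab Tt; split=> //; rewrite /= in_itv.
  have Tfin : lebesgue_measure T \is a fin_num.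
    rewrite ge0_fin_numE//; apply: le_lt_trans (_ : L%:E < _)%E; last exact: ltry.
    rewrite (_ : L%:E = lebesgue_measure `[a ord0 ord0, a ord0 ord0 + L]); last first.
      by rewrite lebesgue_measure_itv/= lte_fin ltrDl L0 -EFinD addrAC subrr add0r.
    by apply: le_measure; rewrite ?inE// => t [] /=; rewrite in_itv.
  rewrite -(fineK Tfin) -!EFinM -EFinD !lee_fin => H.
  rewrite -(ler_pM2l Ln0); move: H; rewrite exprS; lra.
have [ts [sts tsT pw]] := exists_separated_points mT c20 L0 (fun t Tt => Tt.1) LT (leqnn k.+1).
have [p pk Fp] := Fk x ord0.
have FpE t : F (row_cons (t, (row_uncons x).2)) = p.[t].
  by rewrite -Fp -{2}(row_unconsK x) row_set_cons0.
rewrite -(row_unconsK x) [row_uncons x]surjective_pairing FpE.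
rewrite -mulrA.
apply: (poly_le_of_separated_points d0 L0 _ sts pw _ _ x1).
- exact: leqW.
- by move=> t /tsT[].
- by move=> t /tsT Tt; rewrite -FpE; exact: Tslice.
Qed.

(** The indices stop at k - 1, so the points avoid the upper faces and lie in the half-open cell
    whose closure is the cube. *)
Definition grid_point n k (a : 'rV[R]_n) (L : R) (e : {ffun 'I_n -> 'I_k}) :
  'rV[R]_n := \row_i (a ord0 i + L * ((e i : nat)%:R / k%:R)).

(** The slicing induction again, now with the explicit nodes i / k. It lets finitely many rounded
    values determine a polynomial on a cube up to a small error. *)
Lemma sep_poly_le_of_grid n k : (0 < k)%N -> exists2 C : R, 0 <= C &
  forall a (L : R) (F : 'rV[R]_n -> R) (M : R), 0 < L -> sep_poly k F ->
    (forall e : {ffun 'I_n -> 'I_k}, `|F (grid_point a L e)| <= M) ->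
    forall x, cube a L x -> `|F x| <= C * M.
Proof.
move=> k0; elim: n => [|n [C C0 IH]].
  exists 1 => // a L F M _ _ FM x _; rewrite mul1r.
  have := FM [ffun i => Ordinal k0]; congr (`|F _| <= M).
  by apply/rowP => -[].
have kR0 : 0 < k%:R :> R by rewrite ltr0n.
have d0 : 0 < k%:R^-1 :> R by rewrite invr_gt0.
exists (interp_const k k%:R^-1 * C); first by rewrite mulr_ge0// interp_const_ge0.
move=> a L F M L0 Fk FM x /cube_cons[x1 x2].
have [p pk Fp] := Fk x ord0.
have FpE t : F (row_cons (t, (row_uncons x).2)) = p.[t].
  by rewrite -Fp -{2}(row_unconsK x) row_set_cons0.
rewrite -(row_unconsK x) [row_uncons x]surjective_pairing FpE -mulrA.
pose ts : seq R := [seq a ord0 ord0 + L * ((i : nat)%:R / k%:R) | i : 'I_k].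
have sts : size ts = k by rewrite size_map size_enum_ord.
apply: (poly_le_of_separated_points d0 L0 pk sts _ _ _ x1).
- rewrite pairwise_map; apply: (sub_in_pairwise (P := predT) (r := fun i j : 'I_k => i != j)).
  + move=> i j _ _ ij /=.
    rewrite opprD addrACA subrr add0r -mulrBr -mulrBl !normrM.
    rewrite (gtr0_norm L0) (gtr0_norm d0) mulrC ler_pM2l// ler_peMl ?(ltW d0)//.
    rewrite !pmulrn -rmorphB/= -intr_norm ler1z -gtz0_ge1 normr_gt0 subr_eq0.
    by rewrite eqz_nat (inj_eq val_inj).
  + exact/all_predT.
  + by rewrite -uniq_pairwise enum_uniq.
- move=> _ /mapP[i _ ->]; rewrite lerDl lerD2l mulr_ge0 ?divr_ge0 ?(ltW L0)//=.
  by rewrite ler_piMr ?(ltW L0)// ler_pdivrMr// mul1r ler_nat ltnW.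
- move=> _ /mapP[i _ ->]; rewrite -FpE.
  apply: (IH (row_uncons a).2 L (fun v => F (row_cons (_, v)))) x2 => //.
    exact: sep_poly_slice.
  move=> e; pose e' : {ffun 'I_n.+1 -> 'I_k} :=
    [ffun j => oapp (fun j' => e j') i (unlift ord0 j)].
  have := FM e'; congr (`|F _| <= M); apply/rowP => j; rewrite !mxE !ffunE.
  by case: unliftP => [j'|] -> //=; rewrite !mxE.
Qed.

End separately_polynomial.

(** * Dyadic cells and Hausdorff measure *)

Section dyadic_cells.
Context {R : realType}.

Definition cell_of n (s : R) (x : 'rV[R]_n) : {ffun 'I_n -> int} :=
  [ffun i => Num.floor (x ord0 i / s)].

Definition cell n (s : R) (z : {ffun 'I_n -> int}) : set 'rV[R]_n :=
  [set x | cell_of s x = z].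

Lemma leb_row_forall n (P : 'I_n -> set R) : (forall i, measurable (P i)) ->
  (leb n [set x : 'rV[R]_n | forall i, P i (x ord0 i)] =
   \prod_(i < n) lebesgue_measure (P i))%E.
Proof.
elim: n P => [|n IH] P mP.
  by rewrite big_ord0 /= diracE mem_set//= => -[].
rewrite /= /lebesgue_cons /pushforward.
pose B := [set x : 'rV[R]_n | forall i, P (lift ord0 i) (x ord0 i)].
have -> : @row_cons R n @^-1` [set x | forall i, P i (x ord0 i)] = P ord0 `*` B.
  apply/seteqP; split=> [[c v] /= H|[c v] /= [H1 H2] i].
    split; first by have := H ord0; rewrite mxE unlift_none.
    by move=> i; have := H (lift ord0 i); rewrite mxE liftK.
  by rewrite mxE; case: unliftP => [j|] ->; rewrite //= in H1 *.
have mB : measurable B by apply: (measurable_row_forall (P := fun i => P (lift ord0 i))).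
have mP0 := mP ord0.
rewrite big_ord_recl product_measure1E//=; congr (_ * _)%E.
exact: (IH (fun i => P (lift ord0 i))).
Qed.

Lemma cellE n (s : R) z (x : 'rV[R]_n) : 0 < s ->
  cell s z x <-> forall i, (z i)%:~R * s <= x ord0 i < (z i + 1)%:~R * s.
Proof.
move=> s0; split=> [<- i|H].
  rewrite ffunE -ler_pdivlMr// -ltr_pdivrMr//.
  by rewrite floor_le_tmp floorD1_gt.
apply/ffunP => i; rewrite ffunE; apply: floor_def.
by rewrite ler_pdivlMr// ltr_pdivrMr.
Qed.

Lemma cell_itv n (s : R) (z : {ffun 'I_n -> int}) : 0 < s -> cell s z =
  [set x | forall i, `[(z i)%:~R * s, (z i + 1)%:~R * s[%classic (x ord0 i)].
Proof.
move=> s0; apply/seteqP; split=> x.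
  by move=> /cellE - /(_ s0) H i; rewrite /= in_itv/=; exact: H.
by move=> H; apply/cellE => // i; have := H i; rewrite /= in_itv.
Qed.

Lemma measurable_cell n (s : R) (z : {ffun 'I_n -> int}) : 0 < s -> measurable (cell s z).
Proof.
by move=> s0; rewrite cell_itv//; apply: (measurable_row_forall (P := fun i =>
  `[(z i)%:~R * s, (z i + 1)%:~R * s[%classic)) => i; exact: measurable_itv.
Qed.

Lemma leb_cell n (s : R) (z : {ffun 'I_n -> int}) : 0 < s -> leb n (cell s z) = (s ^+ n)%:E.
Proof.
move=> s0; rewrite cell_itv// (leb_row_forall (P := fun i =>
  `[(z i)%:~R * s, (z i + 1)%:~R * s[%classic)); last by move=> i; exact: measurable_itv.
rewrite (eq_bigr (fun=> s%:E)) ?prode_const ?card_ord//.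
  by elim: n {z} => [|n IH]; rewrite ?big_ord0 ?expr0// big_ord_recl IH exprS EFinM.
move=> i _; rewrite lebesgue_measure_itv/= lte_fin ltr_pM2r// ltr_int ltzD1 lexx.
by rewrite -EFinB -mulrBl rmorphD/= addrAC subrr add0r mul1r.
Qed.

(** Dyadic cells are nested: an integer b satisfies b <= w exactly when 2 b is at most the floor of
    2 w, so that floor determines the floor of w. *)
Lemma cell_of_dyadic_coarser n i j (x y : 'rV[R]_n) : (i <= j)%N ->
  cell_of (2^-1 ^+ j) x = cell_of (2^-1 ^+ j) y ->
  cell_of (2^-1 ^+ i) x = cell_of (2^-1 ^+ i) y.
Proof.
move=> /subnK <-; elim: (j - i)%N => // m IH xy; apply: IH.
have scale (w : R) : w / (2^-1 ^+ (m.+1 + i)) = 2 * (w / 2^-1 ^+ (m + i)).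
  by rewrite addSn exprS invfM invrK mulrCA.
apply/ffunP => k; have /ffunP/(_ k) := xy; rewrite !ffunE !scale.
set u := _ / _; set v := _ / _ => uv; apply: floor_def.
have half (b : int) (w : R) : (b%:~R <= w) = (2 * b <= Num.floor (2 * w)).
  by rewrite floor_ge_int rmorphM/= ler_pM2l.
by rewrite ltNge !half uv -!half -ltNge floor_itv.
Qed.

Lemma enorm_le n (x : 'rV[R]_n) (s : R) : 0 <= s -> (forall i, `|x ord0 i| <= s) ->
  enorm x <= n%:R * s.
Proof.
move=> s0 xs; rewrite -(ger0_norm (_ : 0 <= n%:R * s)) ?mulr_ge0// -sqrtr_sqr.
apply: ler_wsqrtr; apply: le_trans (_ : \sum_(i < n) s ^+ 2 <= _).
  by apply: ler_sum => i _; rewrite -real_normK ?num_real// ler_pXn2r ?nnegrE.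
rewrite sumr_const card_ord -[leLHS]mulr_natl exprMn ler_wpM2r ?sqr_ge0//.
by rewrite -natrX ler_nat; case: n {x xs} => // n; rewrite expnS expn1 leq_pmulr.
Qed.

Lemma coord_le_enorm n (x : 'rV[R]_n) i : `|x ord0 i| <= enorm x.
Proof.
rewrite -sqrtr_sqr; apply: ler_wsqrtr; rewrite (bigD1 i)//= lerDl sumr_ge0// => j _.
exact: sqr_ge0.
Qed.

Lemma ediam_le n (A : set 'rV[R]_n) (d : R) : 0 <= d ->
  (forall x y, A x -> A y -> enorm (x - y) <= d) -> (ediam A <= d%:E)%E.
Proof.
move=> d0 H; apply: ge_ereal_sup => _ [->|[[x y] [/= Ax Ay]] <-]; rewrite ?lee_fin//.
exact: H.
Qed.

Lemma ediam_ge0 n (A : set 'rV[R]_n) : (0 <= ediam A)%E.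
Proof. by apply: ereal_sup_ubound; left. Qed.

Lemma le_expe_EFin (x : \bar R) (y : R) m : (0 <= x)%E -> (x <= y%:E)%E ->
  (x ^+ m <= (y ^+ m)%:E)%E.
Proof.
case: x => [x| |] //; rewrite !lee_fin => x0 xy.
by rewrite -EFin_expe lee_fin lerXn2r ?nnegrE// (le_trans x0).
Qed.

(* The maximal dyadic cells of side at most 2^-j contained in A partition A, and
   a cell of side s has diameter at most n s. *)
Lemma hausdorff_le_leb n (A : set 'rV[R]_n) : (0 < n)%N -> open A ->
  (hausdorff_measure n A <= (n%:R ^+ n)%:E * leb n A)%E.
Proof.
move=> n0 oA; apply: ge_ereal_sup => _ [d /= d0 <-].
have [j0 Hj0] : exists j0 : nat, n%:R * 2^-1 ^+ j0 <= d.
  have n0' : 0 < n%:R :> R by rewrite ltr0n.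
  have /cvgrPdist_lt/(_ _ (divr_gt0 d0 n0')) : (fun j => 2^-1 ^+ j : R) @ \oo --> 0.
    by apply: cvg_expr; rewrite ger0_norm// invf_lt1// ltr1n.
  move=> [j _ /(_ j (leqnn j))]; rewrite /= sub0r normrN => /ltW H; exists j.
  by rewrite mulrC -ler_pdivlMr// (le_trans (ler_norm _)).
pose good j (x : 'rV[R]_n) := (j0 <= j)%N /\ cell (2^-1 ^+ j) (cell_of (2^-1 ^+ j) x) `<=` A.
pose first j x := good j x /\ forall i, good i x -> (j <= i)%N.
pose V (t : nat * {ffun 'I_n -> int}) :=
  [set x | A x /\ cell (2^-1 ^+ t.1) t.2 x /\ first t.1 x].
(* Countability of the pairs (level, cell) turns the selected cells into one sequence; codes of no
   pair give the empty set. *)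
pose U i := if @pickle_inv (nat * {ffun 'I_n -> int})%type i is Some t then V t else set0.
have s0 j : 0 < 2^-1 ^+ j :> R by rewrite exprn_gt0// invr_gt0.
(* By nestedness, whether a level up to [t.1] is good depends only on the cell at level [t.1]; so
   all points of a cell have the same first good level as soon as one of them has it there. *)
have VE t : V t = set0 \/ V t = cell (2^-1 ^+ t.1) t.2.
  case: (pselect (exists x, V t x)) => [[x [Ax [xt [gx mx]]]]|/forallNP nV]; last first.
    by left; apply/seteqP; split=> // x /nV.
  right; apply/seteqP; split=> [y [_ []]//|y yt].
  have Ay : A y by apply: gx.2; rewrite xt.
  have good_eq i : (i <= t.1)%N -> good i y <-> good i x.
    by move=> it; rewrite /good (cell_of_dyadic_coarser it (etrans yt (esym xt))).
  split=> //; split=> //; split; first by apply/good_eq.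
  move=> i gi; rewrite leqNgt; apply/negP => it.
  by have := mx i ((good_eq _ (ltnW it)).1 gi); rewrite leqNgt it.
have mV t : measurable (V t).
  by case: (VE t) => ->; [exact: measurable0|exact: measurable_cell].
have VjE t : V t !=set0 -> (j0 <= t.1)%N by move=> [x [_ [_ [[]]]]].
have diamV t : (ediam (V t) <= (n%:R * 2^-1 ^+ t.1)%:E)%E.
  apply: ediam_le; first by rewrite mulr_ge0// ltW.
  move=> x y [_ [xt _]] [_ [yt _]]; apply: enorm_le; first exact: ltW.
  move=> i; move/cellE : xt => /(_ (s0 _) i); move/cellE : yt => /(_ (s0 _) i).
  by rewrite !mxE rmorphD/= mulrDl mul1r ler_norml; lra.
have dV t : (ediam (V t) <= d%:E)%E.
  case: (pselect (V t !=set0)) => [/VjE j0t|V0]; last first.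
    by apply: ediam_le => [|x y Vx]; [exact: ltW|case: V0; exists x].
  apply: le_trans (diamV t) _; rewrite lee_fin; apply: le_trans Hj0.
  by rewrite ler_wpM2l// ler_wiXn2l// ?invr_ge0// invf_le1// ler1n.
have diamVn t : (ediam (V t) ^+ n <= (n%:R ^+ n)%:E * leb n (V t))%E.
  case: (VE t) => [V0|Vc].
    have -> : ediam (V t) = 0%E.
      apply/eqP; rewrite eq_le ediam_ge0 andbT; apply: ediam_le => // x y.
      by rewrite V0.
    by rewrite (_ : (0 ^+ n = 0)%E) ?mule_ge0// -EFin_expe expr0n gtn_eqF.
  by rewrite Vc leb_cell// -EFinM -exprMn -Vc le_expe_EFin// ediam_ge0.
have mU i : measurable (U i) by rewrite /U; case: pickle_inv.
have dU i : (ediam (U i) <= d%:E)%E.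
  by rewrite /U; case: pickle_inv => [t|]//; apply: ediam_le => //; exact: ltW.
have tU : trivIset setT U.
  apply/trivIsetP => i i' _ _; apply: contra_neqP => /eqP/set0P[x []].
  rewrite /U; case ei : (pickle_inv i) => [t|//]; case ei' : (pickle_inv i') => [t'|//].
  move=> [_ [xt [gt ft]]] [_ [xt' [gt' ft']]].
  have jE : t.1 = t'.1 by apply/eqP; rewrite eqn_leq ft//= ft'.
  have tE : t = t'.
    rewrite [t]surjective_pairing [t']surjective_pairing; congr pair => //.
    by rewrite -xt -xt' jE.
  have pE k u : @pickle_inv (nat * {ffun 'I_n -> int})%type k = Some u -> k = pickle u.
    by move=> ku; have := @pickle_invK (nat * {ffun 'I_n -> int})%type k; rewrite ku.
  by rewrite (pE _ _ ei) (pE _ _ ei') tE.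
have UA : \bigcup_i U i = A.
  apply/seteqP; split=> [x [i _]|x Ax].
    by rewrite /U; case: pickle_inv => [t []|].
  (* A contains a sup-norm ball about x, hence the cell of x once its side is below the radius. *)
  have [j gj] : exists j, good j x.
    have : nbhs x A by apply: open_nbhs_nbhs.
    rewrite -nbhs_ballE => -[e /= e0 eA].
    have /cvgrPdist_lt/(_ _ e0) : (fun j => 2^-1 ^+ j : R) @ \oo --> 0.
      by apply: cvg_expr; rewrite ger0_norm// invf_lt1// ltr1n.
    move=> [j _ /(_ (maxn j j0) (leq_maxl _ _))].
    rewrite /= sub0r normrN (ger0_norm (ltW (s0 _))) => je; exists (maxn j j0).
    split=> [|y /= yx]; first exact: leq_maxr.
    apply: eA; split=> // i i'; rewrite (ord1 i); apply: le_lt_trans je.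
    have /cellE : cell (2^-1 ^+ maxn j j0) (cell_of (2^-1 ^+ maxn j j0) x) x by [].
    move=> /(_ (s0 _) i'); move/cellE : yx => /(_ (s0 _) i').
    by rewrite rmorphD/= mulrDl mul1r ler_norml; lra.
  have ex : exists j, `[< good j x >] by exists j; apply/asboolP.
  pose j1 := ex_minn ex.
  exists (pickle (j1, cell_of (2^-1 ^+ j1) x)) => //.
  rewrite /U pickleK_inv; split=> //; split=> //.
  rewrite /j1 /=; case: ex_minnP => m /asboolP gm mm; split=> // i gi.
  by apply: mm; apply/asboolP.
apply: (@le_trans _ _ (\sum_(0 <= i <oo) ediam (U i) ^+ n)%E).
  by apply: ereal_inf_lbound; exists U => //; split=> //; rewrite UA.
apply: (@le_trans _ _ (\sum_(0 <= i <oo) (n%:R ^+ n)%:E * leb n (U i))%E).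
  apply: lee_nneseries => [i _ _|i _].
    by rewrite expe_ge0// ediam_ge0.
  rewrite /U; case: pickle_inv => [t|]; first exact: diamVn.
  have -> : ediam (set0 : set 'rV[R]_n) = 0%E.
    by apply/eqP; rewrite eq_le ediam_ge0 andbT; exact: ediam_le.
  by rewrite (_ : (0 ^+ n = 0)%E) ?mule_ge0// -EFin_expe expr0n gtn_eqF.
rewrite nneseriesZl; last by move=> i _; exact: measure_ge0.
rewrite -UA.
have /cvg_lim <- // : (fun m => \sum_(0 <= i < m) leb n (U i))%E @ \oo --> leb n (\bigcup_i U i).
by apply: measure_semi_sigma_additive => //; rewrite UA; exact: open_measurable_row.
Qed.

Lemma continuous_sumr (T : topologicalType) (I : finType) (F : I -> T -> R) :
  (forall i, continuous (F i)) -> continuous (fun x => \sum_i F i x).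
Proof.
move=> cF; apply: (@continuous_big _ _ _ _ xpredT _ _ _ F) => //.
exact: add_continuous.
Qed.

Lemma open_eball n (x : 'rV[R]_n) r : open (eball x r).
Proof.
have cf : continuous (fun y : 'rV[R]_n => enorm (y - x)).
  move=> y; apply: (@continuous_comp _ _ _ (fun y : 'rV[R]_n => \sum_i (y - x) ord0 i ^+ 2) Num.sqrt);
    last exact: sqrt_continuous.
  apply: (continuous_sumr (F := fun i (z : 'rV[R]_n) => (z - x) ord0 i ^+ 2)) => i {}y.
  have ci : continuous (fun z : 'rV[R]_n => (z - x) ord0 i).
    have -> : (fun z : 'rV[R]_n => (z - x) ord0 i) = (fun z => z ord0 i - x ord0 i).
      by apply/funext => z; rewrite !mxE.
    move=> z; apply: (@continuousB _ _ _ (fun z : 'rV[R]_n => z ord0 i)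
      (fun=> x ord0 i)); [exact: coord_continuous|exact: cst_continuous].
  apply: (@continuous_comp _ _ _ (fun z : 'rV[R]_n => (z - x) ord0 i) (fun t => t ^+ 2)).
    exact: ci.
  exact: exprn_continuous.
exact: (@open_comp _ _ (fun y : 'rV[R]_n => enorm (y - x)) [set t | t < r]) => // y _; exact: cf.
Qed.

Definition sup_ball n (x : 'rV[R]_n) (r : R) : set 'rV[R]_n :=
  cube (x - const_mx r) (2 * r).

Lemma sup_ballE n (x y : 'rV[R]_n) r :
  sup_ball x r y <-> forall i, `|y ord0 i - x ord0 i| <= r.
Proof.
by split=> H i; have := H i; rewrite !mxE ler_norml; lra.
Qed.

(** The intersection of A with a Euclidean ball is open, so its Hausdorff measure is at most n^n
    times its Lebesgue measure, whence c = c1 / n^n; the ball lies in the sup-norm ball of the same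
    radius. *)
Lemma nset_density n (A : set 'rV[R]_n) : (0 < n)%N -> open A -> is_nset A ->
  exists2 c : R, 0 < c & forall x r, A x -> 0 < r <= 1 ->
    ((c * r ^+ n)%:E <= leb n (A `&` sup_ball x r))%E.
Proof.
move=> n0 oA [c1 [c2 [c10 _ Ac]]].
have nn0 : 0 < n%:R ^+ n :> R by rewrite exprn_gt0// ltr0n.
exists (c1 / n%:R ^+ n); first by rewrite divr_gt0.
move=> x r Ax /[dup] r01 /andP[r0 _].
have oB : open (A `&` eball x r) by apply: openI => //; exact: open_eball.
have /andP[le1 _] := Ac _ _ Ax r01.
have := le_trans le1 (hausdorff_le_leb n0 oB).
have sub : A `&` eball x r `<=` A `&` sup_ball x r.
  move=> y [Ay /= yr]; split=> //; apply/sup_ballE => i.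
  by have := coord_le_enorm (y - x) i; rewrite !mxE => /le_trans -> //; exact: ltW.
have mA : measurable A by exact: open_measurable_row.
have le2 : (leb n (A `&` eball x r) <= leb n (A `&` sup_ball x r))%E.
  apply: le_measure; rewrite ?inE//; first exact: open_measurable_row.
  by apply: measurableI => //; exact: measurable_cube.
move=> /le_trans/(_ (lee_wpmul2l _ le2)); rewrite lee_fin => /(_ (ltW nn0)).
by rewrite muleC -lee_pdivrMr// mulrAC.
Qed.

End dyadic_cells.

(** * L_p norms *)

Section Lp_norm_theory.
Context {R : realType} {n : nat}.
Variable E : set 'rV[R]_n.
Hypothesis mE : measurable E.
Implicit Types (F G : 'rV[R]_n -> \bar R) (f g : 'rV[R]_n -> R) (q : \bar R) (r a : R).
Local Open Scope ereal_scope.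

Lemma poweR_le (x y : \bar R) (r : R) : (0 <= r)%R -> 0 <= x -> x <= y -> x `^ r <= y `^ r.
Proof.
move=> r0 x0 xy; apply: gt0_ler_poweR; rewrite ?in_itv/= ?leey ?andbT//.
exact: le_trans xy.
Qed.

Lemma Lp_norm_leP F r a : (1 <= r)%R -> (0 <= a)%R ->
  Lp_norm E r%:E F <= a%:E <-> \int[leb n]_(x in E) `|F x| `^ r <= (a `^ r)%:E.
Proof.
move=> r1 a0; have r0 : (0 < r)%R by rewrite (lt_le_trans _ r1).
have <- : Lp_norm E r%:E F `^ r = \int[leb n]_(x in E) `|F x| `^ r.
  rewrite /Lp_norm poweR_Lnorm ?gt_eqF// [RHS]integral_mkcond.
  apply: eq_integral => x _; rewrite !patchE; case: ifP => // _.
  by rewrite abse0 poweR0r// gt_eqF.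
rewrite -poweR_EFin; split=> H; first by apply: poweR_le; rewrite ?(ltW r0)// Lnorm_ge0.
have : (Lp_norm E r%:E F `^ r) `^ r^-1 <= (a%:E `^ r) `^ r^-1.
  by apply: poweR_le => //; rewrite ?invr_ge0 ?(ltW r0)// poweR_ge0.
by rewrite -!poweRrM mulfV ?gt_eqF// !poweRe1// Lnorm_ge0.
Qed.

Lemma Lp_norm_leyP F a : (0 <= a)%R ->
  Lp_norm E +oo F <= a%:E <-> {ae leb n, forall x, E x -> `|F x| <= a%:E}.
Proof.
move=> a0; have -> : {ae leb n, forall x, E x -> `|F x| <= a%:E} <->
    (\forall x \ae leb n, (abse \o (F \_ E)) x <= a%:E).
  split; apply: filterS => x /=; rewrite patchE.
    by case: ifPn => [|_ _]; [rewrite inE => Ex; exact|rewrite abse0 lee_fin].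
  by move=> + Ex; rewrite mem_set.
rewrite /Lp_norm unlock; case: ifPn => [_|]; first by split=> /ess_supP.
(* The norm for q = +oo is 0 by convention when the whole space has measure 0, and then every
   property holds almost everywhere. *)
rewrite -leNgt lee_fin a0 => mu0; split=> // _.
by exists setT; split=> //; apply/eqP; rewrite eq_le mu0 measure_ge0.
Qed.

Lemma Lp_norm_ge0 q F : 0 <= Lp_norm E q F.
Proof. exact: Lnorm_ge0. Qed.

Lemma ae_le_Lp_norm q F G : 1 <= q -> measurable_fun E F -> measurable_fun E G ->
  {ae leb n, forall x, E x -> `|F x| <= `|G x|} -> Lp_norm E q F <= Lp_norm E q G.
Proof.
move=> + mF mG FG; case: q => [r| |]; last by rewrite leNgt ltNyr.
- rewrite lee_fin => r1; have r0 : (0 <= r)%R by rewrite (le_trans _ r1).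
  have /orP[/eqP -> |] : (Lp_norm E r%:E G == +oo) || (Lp_norm E r%:E G < +oo).
  + by rewrite -leye_eq; case: leP.
  + by rewrite leey.
  have := Lp_norm_ge0 r%:E G; case GE : (Lp_norm E r%:E G) => [b| |]// b0 _.
  rewrite lee_fin in b0; apply/Lp_norm_leP => //.
  have /Lp_norm_leP : Lp_norm E r%:E G <= b%:E by rewrite GE.
  move=> /(_ r1 b0); apply: le_trans; apply: ae_ge0_le_integral => //.
  + by move=> x _; exact: poweR_ge0.
  + by apply: (measurableT_comp (measurable_poweR _)); exact: measurableT_comp.
  + by move=> x _; exact: poweR_ge0.
  + by apply: (measurableT_comp (measurable_poweR _)); exact: measurableT_comp.
  + by apply: filterS FG => x H Ex; apply: poweR_le => //; exact: H.
- move=> _; rewrite /Lp_norm unlock; case: ifPn => // _; apply: le_ess_sup.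
  apply: filterS FG => x H /=; rewrite !patchE; case: ifPn => //.
  by rewrite inE; exact: H.
Qed.

Lemma eq_ae_Lp_norm q F G : 1 <= q -> measurable_fun E F -> measurable_fun E G ->
  {ae leb n, forall x, E x -> F x = G x} -> Lp_norm E q F = Lp_norm E q G.
Proof.
move=> q1 mF mG FG; apply/eqP; rewrite eq_le !ae_le_Lp_norm//;
  by apply: filterS FG => x H /H ->.
Qed.

Lemma Lp_normD q f g : 1 <= q -> measurable_fun E f -> measurable_fun E g ->
  Lp_norm E q (EFin \o (f \+ g)%R) <= Lp_norm E q (EFin \o f) + Lp_norm E q (EFin \o g).
Proof.
move=> q1 mf mg; rewrite /Lp_norm !restrict_EFin.
rewrite (_ : (f \+ g)%R \_ E = (f \_ E \+ g \_ E)%R).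
  by apply: eminkowski => //; apply/(measurable_restrictT _ _).1.
by apply/funext => x; rewrite /= !patchE; case: ifP => //; rewrite addr0.
Qed.

Lemma Lp_normN q f : Lp_norm E q (EFin \o (\- f)%R) = Lp_norm E q (EFin \o f).
Proof.
rewrite /Lp_norm -[RHS]oppe_Lnorm; apply: eq_Lnorm => x /=.
by rewrite !patchE; case: ifP => //; rewrite oppe0.
Qed.

Hypothesis finE : leb n E < +oo.

Lemma le_one_add_powR r t : (1 <= r)%R -> (0 <= t)%R -> (t <= 1 + t `^ r)%R.
Proof.
move=> r1 t0; have [t1|t1] := leP t 1%R.
  by rewrite (le_trans t1)// lerDl powR_ge0.
by rewrite (le_trans (le1r_powR (ltW t1) r1))// lerDr.
Qed.

(** The inequality t <= 1 + t^r for t / a, multiplied by a. On sets of finite measure it takes the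
    place of Hoelder's inequality. *)
Lemma le_add_poweR (t : \bar R) (a r : R) : (0 < a)%R -> (1 <= r)%R -> 0 <= t ->
  t <= a%:E + (a `^ (1 - r))%:E * t `^ r.
Proof.
move=> a0 r1; have r0 : (0 < r)%R by rewrite (lt_le_trans _ r1).
case: t => [t| |]//; last first.
  by move=> _; rewrite poweRyr ?gt_eqF// gt0_muley ?lte_fin ?powR_gt0// addey.
rewrite lee_fin poweR_EFin => t0; rewrite -EFinM -EFinD lee_fin.
have := le_one_add_powR r1 (divr_ge0 t0 (ltW a0)).
rewrite ler_pdivrMr// mulrDl mul1r => /le_trans; apply.
rewrite lerD2l powRM ?invr_ge0 ?(ltW a0)// -powR_inv1 ?(ltW a0)//.
rewrite -powRrM mulN1r -{2}(powRr1 (ltW a0)) -mulrA -powRD; last by rewrite (gt_eqF a0) implybT.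
by rewrite mulrC addrC.
Qed.

(** Integrating [le_add_poweR] gives a |E| + a^(1 - r) a^r, hence the factor |E| + 1, the same for
    every q. *)
Lemma integral_abs_le_Lp_norm q f a : 1 <= q -> (0 < a)%R -> measurable_fun E f ->
  Lp_norm E q (EFin \o f) <= a%:E ->
  \int[leb n]_(x in E) `|(f x)%:E| <= ((fine (leb n E) + 1) * a)%:E.
Proof.
move=> + a0 mf; have mEf : measurable_fun E (EFin \o f) by apply/measurable_EFinP.
have EE : leb n E = (fine (leb n E))%:E by rewrite fineK// ge0_fin_numE.
have E0 : (0 <= fine (leb n E))%R by rewrite fine_ge0.
case: q => [r| |]; last by rewrite leNgt ltNyr.
- rewrite lee_fin => r1 /(Lp_norm_leP _ r1 (ltW a0)) H.
  have r0 : (0 < r)%R by rewrite (lt_le_trans _ r1).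
  apply: (@le_trans _ _ (\int[leb n]_(x in E) (a%:E + (a `^ (1 - r))%:E * `|(EFin \o f) x| `^ r))).
    apply: ge0_le_integral => //.
    + exact: measurableT_comp.
    + apply: emeasurable_funD => //; apply: measurable_funeM.
      by apply: (measurableT_comp (measurable_poweR _)); exact: measurableT_comp.
    + by move=> x _; exact: le_add_poweR.
  rewrite ge0_integralD//; last 3 first.
  + by move=> x _; rewrite lee_fin ltW.
  + by move=> x _; rewrite mule_ge0 ?lee_fin ?powR_ge0.
  + apply: measurable_funeM.
    by apply: (measurableT_comp (measurable_poweR _)); exact: measurableT_comp.
  rewrite ge0_integralZl//; last 3 first.
  + by apply: (measurableT_comp (measurable_poweR _)); exact: measurableT_comp.
  + by move=> x _; exact: poweR_ge0.
  + by rewrite lee_fin powR_ge0.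
  rewrite integral_cst//= mulrDl mul1r EFinD {1}EE -EFinM mulrC leeD2l//.
  apply: le_trans (lee_wpmul2l _ H) _; first by rewrite lee_fin powR_ge0.
  by rewrite -EFinM lee_fin -powRD ?(gt_eqF a0) ?implybT// subrK powRr1// ltW.
- move=> _ /(Lp_norm_leyP _ (ltW a0)) H.
  apply: (@le_trans _ _ (\int[leb n]_(x in E) a%:E)).
    apply: ae_ge0_le_integral => //; first exact: measurableT_comp.
    by move=> x _; rewrite lee_fin ltW.
  by rewrite integral_cst//= {1}EE -EFinM lee_fin mulrC ler_wpM2r ?(ltW a0)// lerDl.
Qed.

(** For finite q = r >= 1 one has |E| <= (|E| + 1)^r, so one constant again serves all q. *)
Lemma Lp_norm_le_of_bound q f a : 1 <= q -> (0 <= a)%R -> measurable_fun E f ->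
  (forall x, E x -> `|f x| <= a)%R ->
  Lp_norm E q (EFin \o f) <= ((fine (leb n E) + 1) * a)%:E.
Proof.
move=> + a0 mf fa; have mEf : measurable_fun E (EFin \o f) by apply/measurable_EFinP.
have EE : leb n E = (fine (leb n E))%:E by rewrite fineK// ge0_fin_numE.
have E0 : (0 <= fine (leb n E))%R by rewrite fine_ge0.
case: q => [r| |]; last by rewrite leNgt ltNyr.
- rewrite lee_fin => r1; have r0 : (0 < r)%R by rewrite (lt_le_trans _ r1).
  apply/Lp_norm_leP => //; first by rewrite mulr_ge0// addr_ge0.
  apply: (@le_trans _ _ (\int[leb n]_(x in E) (a `^ r)%:E)).
    apply: ge0_le_integral => //.
    + by move=> x _; exact: poweR_ge0.
    + by apply: (measurableT_comp (measurable_poweR _)); exact: measurableT_comp.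
    + move=> x Ex; rewrite -poweR_EFin; apply: poweR_le => //; first exact: ltW.
      by rewrite lee_fin fa.
  rewrite integral_cst//= {1}EE -EFinM lee_fin powRM ?addr_ge0// mulrC ler_wpM2r ?powR_ge0//.
  apply: le_trans (le1r_powR _ r1); rewrite ?lerDl// lerDr//.
- move=> _; apply/Lp_norm_leyP; first by rewrite mulr_ge0// addr_ge0.
  apply: aeW => x Ex; rewrite lee_fin (le_trans (fa _ Ex))//.
  by rewrite ler_peMl// lerDr.
Qed.

Lemma limn_einf_ge0 (w : (\bar R)^nat) : (forall m, 0 <= w m) -> 0 <= limn_einf w.
Proof.
move=> w0; rewrite limn_einf_lim; apply: lime_ge; first exact: is_cvg_einfs.
by apply: nearW => m; apply: le_ereal_inf_tmp => _ [i _ <-].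
Qed.

(** Riesz-Fischer with a rate. As E has finite measure, the steps are summable in L_1, so the
    sequence converges almost everywhere. The rate passes to the limit by Fatou's lemma for finite
    q, and through a countable union of null sets for q = +oo. *)
Lemma Lp_complete q (u : nat -> 'rV[R]_n -> R) : 1 <= q ->
  (forall m, measurable_fun E (u m)) ->
  (forall i m m', (i <= m)%N -> (i <= m')%N ->
    Lp_norm E q (EFin \o (u m \- u m')%R) <= (2^-1 ^+ i)%:E) ->
  exists2 v : 'rV[R]_n -> R, measurable_fun E v &
    forall i, Lp_norm E q (EFin \o (u i \- v)%R) <= (2^-1 ^+ i)%:E.
Proof.
move=> q1 mu uC.
have half0 i : (0 < 2^-1 ^+ i :> R)%R by rewrite exprn_gt0// invr_gt0.
have mB i j : measurable_fun E (u i \- u j)%R by exact: measurable_funB.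
have aecvg : {ae leb n, forall x, E x -> cvgn (fun m => u m x)}.
  pose S x := \sum_(0 <= m <oo) `|(u m.+1 x - u m x)%:E|.
  have mS : measurable_fun E S.
    apply: (@ge0_emeasurable_sum _ _ _ _ (fun m x => `|(u m.+1 x - u m x)%:E|) xpredT) => // m _.
    by apply/measurableT_comp => //; apply/measurable_EFinP; exact: mB.
  have intS : \int[leb n]_(x in E) S x < +oo.
    rewrite integral_nneseries//; last first.
      by move=> m; apply/measurableT_comp => //; apply/measurable_EFinP; exact: mB.
    pose K := (fine (leb n E) + 1)%R.
    have K0 : (0 <= K)%R by rewrite addr_ge0// fine_ge0.
    apply: (@le_lt_trans _ _ (\sum_(0 <= m <oo) (K * 2^-1 ^+ m)%:E)).
      apply: lee_nneseries => [m _ _|m _]; first exact: integral_ge0.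
      exact: (integral_abs_le_Lp_norm q1 (half0 m) (mB _ _) (uC m m.+1 m (leqnSn m) (leqnn m))).
    apply: (@le_lt_trans _ _ (K * 2)%:E); last exact: ltry.
    apply: lime_le; first by apply: is_cvg_nneseries => m _ _; rewrite lee_fin mulr_ge0// ltW.
    apply: nearW => N; rewrite sumEFin lee_fin -mulr_sumr ler_wpM2l//.
    have -> : (\sum_(0 <= i < N) 2^-1 ^+ i = 2 - 2 * 2^-1 ^+ N :> R)%R.
      elim: N => [|N IH]; first by rewrite big_geq// expr0 mulr1 subrr.
      by rewrite big_nat_recr//= IH exprS mulrA mulfV// mul1r; lra.
    by rewrite lerBlDr lerDl mulr_ge0// ltW.
  have iS : (leb n).-integrable E S.
    apply/integrableP; split=> //; under eq_integral do rewrite gee0_abs ?nneseries_ge0//.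
    by [].
  have := integrable_ae mE iS; apply: filterS => x H /H Sfin.
  have -> : (fun m => u m x) = (fun m => (u 0%N x + series (telescope (u ^~ x)) m)%R).
    by apply/funext => m; rewrite -eq_sum_telescope.
  apply: is_cvgD; first exact: is_cvg_cst.
  apply: normed_cvg; apply: nondecreasing_is_cvgn.
    by apply: nondecreasing_series => m _ _ /=.
  exists (fine (S x)) => _ [N _ <-] /=; rewrite -lee_fin fineK// -sumEFin.
  by apply: nneseries_lim_ge.
(* An upper limit is measurable whether or not the sequence converges; its values at points of
   divergence are immaterial. *)
pose v x := fine (limn_esup (fun m => (u m x)%:E)).
have mv : measurable_fun E v.
  apply: measurableT_comp => //; apply: measurable_fun_limn_esup => m.
  by apply/measurable_EFinP.
have vlim x : cvgn (fun m => u m x) -> u ^~ x @ \oo --> v x.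
  move=> /cvg_ex[l ul].
  suff -> : v x = l by [].
  have /cvg_limn_einf_sup[_] : (fun m => (u m x)%:E) @ \oo --> l%:E.
    by apply: cvg_EFin => //; exact: nearW.
  by rewrite /v => ->.
exists v => // i.
have mBv : measurable_fun E (u i \- v)%R by exact: measurable_funB.
case: q q1 uC => [r| |] q1 uC; last by move: q1; rewrite leNgt ltNyr.
- rewrite lee_fin in q1; apply/(Lp_norm_leP _ q1 (ltW (half0 i))).
  have r0 : (0 < r)%R by rewrite (lt_le_trans _ q1).
  pose F m x := `|(u i x - u m x)%:E| `^ r.
  have mF m : measurable_fun E (F m).
    apply: (measurableT_comp (measurable_poweR _)); apply: measurableT_comp => //.
    by apply/measurable_EFinP; exact: mB.
  apply: (@le_trans _ _ (\int[leb n]_(x in E) limn_einf (F ^~ x))).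
    apply: ae_ge0_le_integral => //.
    + by move=> x _; exact: poweR_ge0.
    + apply: (measurableT_comp (measurable_poweR _)); apply: measurableT_comp => //.
      exact/measurable_EFinP.
    + by move=> x _; apply: limn_einf_ge0 => m; exact: poweR_ge0.
    + rewrite (_ : (fun x => _) = (fun x => - limn_esup (fun m => - F m x))); last first.
        by apply/funext => x; rewrite (limn_esupN (F ^~ x)) oppeK.
      apply: measurableT_comp => //; apply: measurable_fun_limn_esup => m.
      exact: measurableT_comp.
    + apply: filterS aecvg => x H /H {H}/vlim H.
      (* Continuity of t^r is obtained from differentiability at t > 0, so t = 0 is separated: the
         integrand on the left is 0 there. *)
      have [e0|e0] := eqVneq `|(u i x - v x)%R|%R 0%R.
        rewrite -[leLHS]/(`|u i x - v x| `^ r)%R%:E e0 powR0 ?gt_eqF//.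
        by apply: limn_einf_ge0 => m; exact: poweR_ge0.
      have e1 : (0 < `|u i x - v x|)%R by rewrite lt_def e0/=.
      have cF : F ^~ x @ \oo --> (`|u i x - v x| `^ r)%:E.
        apply: cvg_EFin; first exact: nearW.
        rewrite (_ : fine \o _ = (fun m => `|u i x - u m x| `^ r)%R)//.
        apply: (@cvg_comp _ _ _ (fun m => `|u i x - u m x|)%R (fun t => t `^ r)%R _ (nbhs `|u i x - v x|%R)).
          by apply: cvg_norm; apply: cvgB => //; exact: cvg_cst.
        have cp : {for `|u i x - v x|%R, continuous (fun t : R => t `^ r)%R}.
          apply/differentiable_continuous/derivable1_diffP.
          by apply: derivable_powR; rewrite in_itv/= e1.
        exact: cp.
      by have [-> _] := cvg_limn_einf_sup cF.
  apply: le_trans (fatou _ _ _ _) _ => //; first by move=> m x _; exact: poweR_ge0.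
  rewrite limn_einf_lim; apply: lime_le; first exact: is_cvg_einfs.
  (* The tail infimum is at most the term of index max(m, i), to which the Cauchy bound at i
     applies. *)
  apply: nearW => m; apply: (@le_trans _ _ (\int[leb n]_(x in E) F (maxn m i) x)).
    by apply: ereal_inf_lbound; exists (maxn m i) => //=; exact: leq_maxl.
  have /Lp_norm_leP := uC i i (maxn m i) (leqnn _) (leq_maxr _ _).
  by move=> /(_ q1 (ltW (half0 i))).
- apply/(Lp_norm_leyP _ (ltW (half0 i))).
  have : {ae leb n, forall x m, E x -> `|(u i x - u (i + m)%N x)%:E| <= (2^-1 ^+ i)%:E}.
    apply/ae_foralln => m; have := uC i i (i + m)%N (leqnn _) (leq_addr _ _).
    by move=> /(Lp_norm_leyP _ (ltW (half0 i))).
  move: aecvg; apply: filterS2 => x H1 H2 Ex; rewrite lee_fin.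
  have H : (fun m => `|u i x - u (i + m)%N x|)%R @ \oo --> `|u i x - v x|%R.
    apply: cvg_norm; apply: cvgB; first exact: cvg_cst.
    have := vlim _ (H1 Ex); rewrite -(cvg_shiftn i).
    by under eq_fun do rewrite addnC.
  rewrite -(cvg_lim _ H)//; apply: limr_le; first by apply/cvg_ex; eexists; exact: H.
  by apply: nearW => m; rewrite -lee_fin; exact: (H2 m Ex).
Qed.

End Lp_norm_theory.

(** * Piecewise polynomial approximation in Calderon spaces *)

Section local_polynomial_approximation.
Import -(notations) mpoly.
Context {R : realType} {n : nat}.
Implicit Types (P : mpoly n R) (x y : 'rV[R]_n) (r s L : R).

(** Along the i-th axis a monomial has degree its i-th exponent, which is at most its total
    degree. *)
Lemma sep_poly_poly_eval k P : (msize P <= k)%N -> sep_poly k (poly_eval P).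
Proof.
move=> Pk x i.
exists (\sum_(m <- msupp P) (mcoeff m P * \prod_(j | j != i) x ord0 j ^+ m j) *: 'X^(m i)).
  rewrite big_seq; elim/big_rec: _ => [|m p mP pk]; first by rewrite size_poly0.
  rewrite (leq_trans (size_polyD _ _))// geq_max pk andbT.
  rewrite (leq_trans (size_scale_leq _ _))// size_polyXn (leq_trans _ Pk)//.
  by rewrite (leq_ltn_trans _ (msize_mdeg_lt mP))// mdegE (bigD1 i)//= leq_addr.
move=> t; rewrite /poly_eval mevalE horner_sum; apply: eq_bigr => m _.
rewrite hornerZ hornerXn -mulrA; congr (_ * _).
rewrite (bigD1 i)//= mulrC !mxE eqxx; congr (_ * _).
by apply: eq_bigr => j /negPf ji; rewrite !mxE ji.
Qed.

Lemma continuous_poly_eval P : continuous (poly_eval P).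
Proof.
have -> : poly_eval P = (fun y => \sum_(m <- msupp P) mcoeff m P * \prod_i y ord0 i ^+ m i).
  by apply/funext => y; rewrite /poly_eval mevalE.
apply: (@continuous_big _ _ _ _ xpredT) => [|m _]; first exact: add_continuous.
have cp : continuous (fun y : 'rV[R]_n => \prod_i y ord0 i ^+ m i).
  apply: (@continuous_big _ _ _ _ xpredT) => [|i _ y]; first exact: mul_continuous.
  apply: (@continuous_comp _ _ _ (fun z : 'rV[R]_n => z ord0 i) (fun t => t ^+ m i)).
    exact: coord_continuous.
  exact: exprn_continuous.
move=> y; apply: (@continuousM _ _ (fun=> mcoeff m P)); last exact: cp.
exact: cst_continuous.
Qed.

Lemma measurable_continuous_row (f : 'rV[R]_n -> R) : continuous f ->
  measurable_fun setT f.
Proof.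
move=> cf; apply: (measurability _ (RGenOpens.measurableE R)) => _ [_ [a [b ->]] <-].
rewrite setTI; apply: open_measurable_row; apply: open_comp; last exact: interval_open.
by move=> x _; exact: cf.
Qed.

Lemma measurable_poly_eval P : measurable_fun setT (poly_eval P).
Proof. by apply: measurable_continuous_row; exact: continuous_poly_eval. Qed.

(** Remez' inequality with an L_1 bound. By Chebyshev |F| >= M = (2/c) I / L^n on a set of measure
    at most (c/2) L^n; on the rest of A, still of measure at least (c/2) L^n, one has |F| < M. *)
Lemma sep_poly_le_of_integral k c : 0 < c -> exists2 C : R, 0 <= C &
  forall (a : 'rV[R]_n) L (F : 'rV[R]_n -> R) A (I : R), 0 < L -> 0 < I ->
    sep_poly k F -> measurable_fun setT F -> measurable A -> A `<=` cube a L ->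
    ((c * L ^+ n)%:E <= leb n A)%E ->
    (\int[leb n]_(x in A) `|(F x)%:E| <= I%:E)%E ->
    forall x, cube a L x -> `|F x| <= C * (I / L ^+ n).
Proof.
move=> c0; have c20 : 0 < c / 2 by rewrite divr_gt0.
have [C C0 HC] := @sep_poly_le_of_measure R n k _ c20.
exists (C * (2 / c)); first by rewrite mulr_ge0// divr_ge0// ltW.
move=> a L F A I L0 I0 Fk mF mA AaL cA FI x xa.
have Ln0 : 0 < L ^+ n by rewrite exprn_gt0.
pose M := 2 / c * (I / L ^+ n).
have M0 : 0 < M by rewrite mulr_gt0// divr_gt0.
rewrite -mulrA -/M.
pose B := A `&` [set y | M%:E <= `|(F y)%:E|]%E.
have mEF : measurable_fun A (EFin \o F).
  by apply/measurable_EFinP; exact: measurable_funTS.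
have mB : measurable B.
  rewrite /B; have -> : [set y | M%:E <= `|(F y)%:E|]%E = (fun y => `|F y|) @^-1` `[M, +oo[.
    by apply/seteqP; split=> y /=; rewrite in_itv/= andbT lee_fin.
  have mnF : measurable_fun A (fun y => `|F y|).
    by apply: measurableT_comp => //; exact: measurable_funTS.
  by apply: mnF => //; exact: measurable_itv.
have Aoo : (leb n A < +oo)%E.
  apply: (@le_lt_trans _ _ (leb n (cube a L))); last by rewrite leb_cube ?ltry// ltW.
  by apply: le_measure; rewrite ?inE//; exact: measurable_cube.
have BL : (leb n B <= (c / 2 * L ^+ n)%:E)%E.
  have := le_integral_abse (leb n) mA mEF M0; rewrite -/B => /le_trans/(_ FI).
  have -> : I = M * (c / 2 * L ^+ n).
    by rewrite /M mulrACA divfK ?gt_eqF// mulrA divfK ?gt_eqF// divff ?mul1r.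
  by rewrite (EFinM M) lee_pmul2l// lte_fin.
apply: (HC _ _ _ (A `\` B) M L0 Fk _ _ _ _ x xa).
- exact: measurableD.
- by move=> y [/AaL].
- rewrite measureD//; last first.
  have AB : A `&` B = B by rewrite /B setIA setIid.
  rewrite AB; apply: le_trans (leeB cA BL).
  by rewrite -EFinB lee_fin; lra.
- move=> y [Ay nB]; rewrite leNgt; apply/negP => My; apply: nB; split=> //=.
  by rewrite lee_fin ltW.
Qed.

Lemma measurable_eball x r : measurable (eball x r).
Proof. by apply: open_measurable_row; exact: open_eball. Qed.

Lemma eball_sub_sup_ball x r : eball x r `<=` sup_ball x r.
Proof.
move=> y /= yr; apply/sup_ballE => i.
by have := coord_le_enorm (y - x) i; rewrite !mxE => /le_trans -> //; exact: ltW.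
Qed.

Lemma leb_sup_ball x r : 0 <= r -> leb n (sup_ball x r) = ((2 * r) ^+ n)%:E.
Proof. by move=> r0; rewrite leb_cube// mulr_ge0. Qed.

(** Comparison with cubes makes the volume positive and finite, so the factor in [sharp] is a
    genuine inverse: [fine] would send an infinite volume to 0. *)
Lemma leb_eball x r : (0 < n)%N -> 0 < r ->
  leb n (eball x r) = (fine (leb n (eball x r)))%:E /\
  0 < fine (leb n (eball x r)) <= (2 * r) ^+ n.
Proof.
move=> n0 r0.
have le1 : (leb n (eball x r) <= ((2 * r) ^+ n)%:E)%E.
  rewrite -(leb_sup_ball x (ltW r0)); apply: le_measure; rewrite ?inE.
  - exact: measurable_eball.
  - exact: measurable_cube.
  - exact: eball_sub_sup_ball.
have n0' : 0 < n%:R :> R by rewrite ltr0n.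
pose d := r / (2 * n%:R); have d0 : 0 < d by rewrite divr_gt0// mulr_gt0.
have le2 : (((2 * d) ^+ n)%:E <= leb n (eball x r))%E.
  rewrite -(leb_sup_ball x (ltW d0)); apply: le_measure; rewrite ?inE.
  - exact: measurable_cube.
  - exact: measurable_eball.
  move=> y /sup_ballE yd /=; apply: (@le_lt_trans _ _ (n%:R * d)).
    by apply: enorm_le => [|i]; [exact: ltW|rewrite !mxE].
  have -> : n%:R * d = r / 2.
    by rewrite /d invfM mulrCA [n%:R * _]mulrCA mulfV ?mulr1 ?gt_eqF.
  by lra.
have fin : leb n (eball x r) \is a fin_num.
  by rewrite ge0_fin_numE// (le_lt_trans le1)// ltry.
split; first by rewrite fineK.
rewrite -lte_fin -!lee_fin fineK// le1 andbT (lt_le_trans _ le2)// lte_fin.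
by rewrite exprn_gt0// mulr_gt0.
Qed.

(* The union of the 3^n cells touching cell s z. *)
Definition near_cell s (z : {ffun 'I_n -> int}) : set 'rV[R]_n :=
  [set y | forall i, `|cell_of s y i - z i| <= 1].

Lemma near_cellE s z y : 0 < s -> near_cell s z y <->
  forall i, (z i - 1)%:~R * s <= y ord0 i < (z i + 2)%:~R * s.
Proof.
move=> s0; have H i : (`|cell_of s y i - z i| <= 1) =
    ((z i - 1)%:~R * s <= y ord0 i < (z i + 2)%:~R * s).
  rewrite -ler_pdivlMr// -ltr_pdivrMr// -floor_ge_int ltNge -floor_ge_int ffunE.
  rewrite ler_norml -ltNge; move: (Num.floor _) (z i) => a b.
  by apply/andP/andP => -[? ?]; split; lia.
by split=> K i; have := K i; rewrite H.
Qed.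

Lemma measurable_near_cell s z : 0 < s -> measurable (near_cell s z).
Proof.
move=> s0; rewrite (_ : near_cell s z = [set y : 'rV[R]_n | forall i,
    `[(z i - 1)%:~R * s, (z i + 2)%:~R * s[%classic (y ord0 i)]).
  apply: (measurable_row_forall (P := fun i =>
    `[(z i - 1)%:~R * s, (z i + 2)%:~R * s[%classic)) => i; exact: measurable_itv.
apply/seteqP; split=> y.
  by move/(near_cellE _ _ s0) => H i; rewrite /= in_itv/=; exact: H.
by move=> H; apply/(near_cellE _ _ s0) => i; have := H i; rewrite /= in_itv.
Qed.

Lemma sup_ball_sub_near_cell s x : 0 < s -> sup_ball x s `<=` near_cell s (cell_of s x).
Proof.
move=> s0 y /sup_ballE H; apply/near_cellE => // i; have := H i.
have /cellE-/(_ s0 i) : cell s (cell_of s x) x by [].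
by rewrite !rmorphD/= rmorphN/= ler_norml; lra.
Qed.

Lemma cell_sub_sup_ball s x : 0 < s -> cell s (cell_of s x) `<=` sup_ball x s.
Proof.
move=> s0 y /cellE-/(_ s0) yH; apply/sup_ballE => i.
have /cellE-/(_ s0 i) : cell s (cell_of s x) x by [].
by have := yH i; rewrite !rmorphD/= ler_norml; lra.
Qed.

(** A near cell has side 3 s, hence diameter at most 3 n s; the factor 4 gives strict inequality. *)
Lemma near_cell_sub_eball s z x : (0 < n)%N -> 0 < s -> near_cell s z x ->
  near_cell s z `<=` eball x (4 * n%:R * s).
Proof.
move=> n0 s0 /(near_cellE _ _ s0) xz y /(near_cellE _ _ s0) yz /=.
apply: (@le_lt_trans _ _ (n%:R * (3 * s))).
  apply: enorm_le => [|i]; first by rewrite mulr_ge0// ltW.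
  by rewrite !mxE; have := xz i; have := yz i; rewrite !rmorphD/= rmorphN/= ler_norml; lra.
by rewrite mulrA (mulrC n%:R) ltr_pM2r// ltr_pM2r ?ltr_nat// ltr0n.
Qed.

Lemma sharp_ge0 k (Omega : set 'rV[R]_n) (f : 'rV[R]_n -> R) x :
  (0 <= sharp k Omega f x)%E.
Proof.
apply: le_trans; last by apply: ereal_sup_ubound; exists 1; [exact: ltr01|reflexivity].
apply: mule_ge0; first by rewrite lee_fin invr_ge0 exprn_ge0.
apply: le_ereal_inf_tmp => _ [P _ <-]; apply: mule_ge0; last exact: integral_ge0.
by rewrite lee_fin invr_ge0 fine_ge0.
Qed.

(** One polynomial has to serve all x in the near cell at once. It is nearly optimal on the ball of
    radius 4 n s about a point x0 at which [sharp] + N is below twice its infimum e over the near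
    cell; such a point exists since e >= N > 0. *)
Lemma exists_near_best_poly k : (0 < n)%N -> exists2 C : R, 0 < C &
  forall (Omega : set 'rV[R]_n) (f : 'rV[R]_n -> R) (N s : R) z, measurable Omega -> measurable_fun Omega f ->
    0 < N -> 0 < s -> exists2 P, (msize P <= k)%N &
      forall x, near_cell s z x -> Omega x ->
      (\int[leb n]_(y in near_cell s z `&` Omega) `|(f y - poly_eval P y)%:E| <=
       (C * s ^+ (n + k))%:E * (sharp k Omega f x + N%:E))%E.
Proof.
move=> n0; pose K : R := 4 * n%:R.
have K0 : 0 < K by rewrite mulr_gt0// ltr0n.
(* With r = K s the ball has volume at most (2 r)^n, the weight r^-k is undone by r^k, and 2 pays
   for near-minimality. *)
exists ((2 * K) ^+ n * K ^+ k * 2); first by rewrite !mulr_gt0// exprn_gt0// mulr_gt0.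
move=> Omega f N s z mO mf N0 s0; set C := _ * 2.
have C0 : 0 < C by rewrite !mulr_gt0// exprn_gt0// mulr_gt0.
have Cs0 : 0 < C * s ^+ (n + k) by rewrite mulr_gt0// exprn_gt0.
pose e := ereal_inf [set (sharp k Omega f x + N%:E)%E | x in near_cell s z `&` Omega].
have eN : (N%:E <= e)%E.
  by apply: le_ereal_inf_tmp => _ [x _ <-]; rewrite leeDr// sharp_ge0.
have ee x : near_cell s z x -> Omega x -> (e <= sharp k Omega f x + N%:E)%E.
  by move=> xz Ox; apply: ereal_inf_lbound; exists x.
(* If e is infinite, in particular if the near cell misses Omega, the estimate is trivial for any
   polynomial. *)
have [eoo|eoo] := eqVneq e +oo%E.
  exists 0; first by rewrite msize0.
  move=> x xz Ox; have := ee _ xz Ox; rewrite eoo leye_eq => /eqP ->.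
  by rewrite mulry gtr0_sg// mul1e leey.
have efin : e \is a fin_num by rewrite ge0_fin_numE ?ltey// (le_trans _ eN)// lee_fin ltW.
have eE := fineK efin.
have e0 : 0 < fine e by rewrite (lt_le_trans N0)// -lee_fin eE.
have [_ [x0 [x0z Ox0] <-] x0e] : exists2 v, [set (sharp k Omega f x + N%:E)%E | x in near_cell s z `&` Omega] v &
    (v < (2 * fine e)%:E)%E.
  by apply: ereal_inf_lt; rewrite -/e -eE lte_fin ltr_pMl// ltr1n.
pose r := K * s; have r0 : 0 < r by rewrite mulr_gt0.
have [bE /andP[b0 br]] := leb_eball x0 n0 r0.
set b := fine _ in bE b0 br.
have : ((r ^- k)%:E * ereal_inf [set b^-1%:E *
    \int[leb n]_(y in eball x0 r `&` Omega) `|(f y - poly_eval P y)%:E|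
      | P in [set P : mpoly n R | (msize P <= k)%N]] < (2 * fine e)%:E)%E.
  apply: le_lt_trans x0e; apply: (@le_trans _ _ (sharp k Omega f x0)); last first.
    by rewrite leeDl// lee_fin ltW.
  by apply: ereal_sup_ubound; exists r.
have rk0 : 0 < r ^+ k by rewrite exprn_gt0.
rewrite -lte_pdivlMl ?invr_gt0// invrK -EFinM => /ereal_inf_lt[_ [P Pk <-]].
rewrite -lte_pdivlMl ?invr_gt0// invrK -EFinM => HP.
have mfP : measurable_fun Omega (fun y => `|(f y - poly_eval P y)%:E|%E).
  apply: measurableT_comp => //; apply/measurable_EFinP; apply: measurable_funB => //.
  by apply: measurable_funTS; exact: measurable_poly_eval.
exists P => // x xz Ox.
apply: (@le_trans _ _ (\int[leb n]_(y in eball x0 r `&` Omega) `|(f y - poly_eval P y)%:E|)%E).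
  apply: ge0_subset_integral => //.
  - by apply: measurableI => //; exact: measurable_near_cell.
  - by apply: measurableI => //; exact: measurable_eball.
  - by apply: measurable_funS mfP => // y [].
  - by move=> y [yz Oy]; split=> //; exact: (near_cell_sub_eball n0 s0 x0z).
apply: le_trans (ltW HP) _.
apply: (@le_trans _ _ ((C * s ^+ (n + k))%:E * e)%E); last by rewrite lee_pmul2l// ee.
rewrite -eE -EFinM lee_fin.
apply: (@le_trans _ _ ((2 * r) ^+ n * (r ^+ k * (2 * fine e)))).
  by rewrite ler_wpM2r// !mulr_ge0// ltW.
by rewrite /C /r exprD !exprMn; lra.
Qed.

End local_polynomial_approximation.

Section calderon_approximation.
Import -(notations) mpoly.
Context {R : realType} {n : nat}.
Hypothesis n0 : (0 < n)%N.
Implicit Types (x y : 'rV[R]_n) (r s : R).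

Local Notation half j := (2^-1 ^+ j : R).

Variables (k : nat) (Omega : set 'rV[R]_n) (c C : R).
Hypotheses (k0 : (0 < k)%N) (mO : measurable Omega) (c0 : 0 < c) (C0 : 0 < C).
Hypothesis density : forall x r, Omega x -> 0 < r <= 1 ->
  ((c * r ^+ n)%:E <= leb n (Omega `&` sup_ball x r))%E.

Lemma half_gt0 j : 0 < half j.
Proof. by rewrite exprn_gt0// invr_gt0. Qed.

Lemma half_le1 j : half j <= 1.
Proof. by rewrite exprn_ile1// ?invr_ge0// invf_le1// ler1n. Qed.

Lemma halfS j : 2 * half j.+1 = half j.
Proof. by rewrite exprS mulrA mulfV// mul1r. Qed.

(* The offset N > 0 keeps the right-hand side positive, so that such polynomials
   exist even where the infimum in sharp is 0 and not attained. *)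
Definition local_approx (f : 'rV[R]_n -> R) (N s : R)
    (P : {ffun 'I_n -> int} -> mpoly n R) :=
  forall z, (msize (P z) <= k)%N /\
    forall x, near_cell s z x -> Omega x ->
      (\int[leb n]_(y in near_cell s z `&` Omega) `|(f y - poly_eval (P z) y)%:E| <=
       (C * s ^+ (n + k))%:E * (sharp k Omega f x + N%:E))%E.

Definition piecewise s (P : {ffun 'I_n -> int} -> mpoly n R) x : R :=
  poly_eval (P (cell_of s x)) x.

Lemma measurable_piecewise s P : 0 < s -> measurable_fun setT (piecewise s P).
Proof.
move=> s0 _ Y mY; rewrite setTI.
have -> : piecewise s P @^-1` Y = \bigcup_z (cell s z `&` (poly_eval (P z) @^-1` Y)).
  apply/seteqP; split=> [x Yx|x [z _ [<-]]//].
  by exists (cell_of s x).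
apply: countable_bigcupT_measurable => // z; apply: measurableI.
  exact: measurable_cell.
by rewrite -[X in measurable X]setTI; exact: measurable_poly_eval.
Qed.

Lemma sup_ball_sub x r s : r <= s -> sup_ball x r `<=` sup_ball x s.
Proof.
by move=> rs y /sup_ballE H; apply/sup_ballE => i; exact: le_trans (H i) rs.
Qed.

Lemma sup_ball_center x r : 0 <= r -> sup_ball x r x.
Proof. by move=> r0; apply/sup_ballE => i; rewrite subrr normr0. Qed.

(** On the part of Omega in the sup-norm ball of radius 2^-(j+1) about x both polynomials are close
    to f in L_1, so Remez bounds their difference at x. The maximal function may be evaluated at any
    y of that ball: this freedom is what the interpolation exploits. *)
Lemma piecewise_step_le : exists2 C1 : R, 0 < C1 &
  forall f N j P P' x y (g : R), measurable_fun Omega f -> 0 < N ->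
    local_approx f N (half j) P -> local_approx f N (half j.+1) P' ->
    Omega x -> Omega y -> sup_ball x (half j.+1) y ->
    0 < g -> (sharp k Omega f y + N%:E <= g%:E)%E ->
    `|piecewise (half j.+1) P' x - piecewise (half j) P x| <= C1 * half j ^+ k * g.
Proof.
(* The sup-norm ball of radius s' = s / 2 is a cube of side s, and c s'^n = (c / 2^n) s^n. *)
have c20 : 0 < c / 2 ^+ n by rewrite divr_gt0// exprn_gt0.
have [K K0 HK] := @sep_poly_le_of_integral R n k _ c20.
exists ((K + 1) * (2 * C)); first by rewrite !mulr_gt0// ltr_wpDl.
move=> f N j P P' x y g mf N0 HP HP' Ox Oy yx g0 gy.
set s := half j; set s' := half j.+1.
have s0 : 0 < s := half_gt0 j; have s'0 : 0 < s' := half_gt0 j.+1.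
have s'E : 2 * s' = s := halfS j.
have s's : s' <= s by rewrite -s'E; lra.
have [Pk HPx] := HP (cell_of s x); have [P'k HP'x] := HP' (cell_of s' x).
set p := P _ in Pk HPx *; set p' := P' _ in P'k HP'x *.
pose A := Omega `&` sup_ball x s'.
have mA : measurable A by apply: measurableI => //; exact: measurable_cube.
have A1 : A `<=` near_cell s (cell_of s x) `&` Omega.
  by move=> u [Ou us]; split=> //; apply: sup_ball_sub_near_cell => //; exact: sup_ball_sub us.
have A2 : A `<=` near_cell s' (cell_of s' x) `&` Omega.
  by move=> u [Ou us]; split=> //; apply: sup_ball_sub_near_cell.
have mnear r z : 0 < r -> measurable (near_cell r z `&` Omega).
  by move=> r0; apply: measurableI => //; exact: measurable_near_cell.
have mfp (u : mpoly n R) B : measurable B -> B `<=` Omega ->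
    measurable_fun B (fun y => `|(f y - poly_eval u y)%:E|%E).
  move=> mB BO; apply: measurableT_comp => //; apply/measurable_EFinP; apply: measurable_funB => //.
    exact: measurable_funS mf.
  by apply: measurable_funTS; exact: measurable_poly_eval.
have I1 : (\int[leb n]_(u in A) `|(f u - poly_eval p u)%:E| <= (C * s ^+ (n + k) * g)%:E)%E.
  apply: (@le_trans _ _ (\int[leb n]_(u in near_cell s (cell_of s x) `&` Omega) `|(f u - poly_eval p u)%:E|)%E).
    apply: ge0_subset_integral => //; last by apply: mfp => [|u []]; first exact: mnear.
    exact: mnear.
  apply: le_trans (HPx y _ Oy) _; first exact: (A1 y (conj Oy yx)).1.
  by rewrite [leRHS]EFinM lee_pmul2l// lte_fin mulr_gt0// exprn_gt0.
have I2 : (\int[leb n]_(u in A) `|(f u - poly_eval p' u)%:E| <= (C * s ^+ (n + k) * g)%:E)%E.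
  apply: (@le_trans _ _ (\int[leb n]_(u in near_cell s' (cell_of s' x) `&` Omega) `|(f u - poly_eval p' u)%:E|)%E).
    apply: ge0_subset_integral => //; last by apply: mfp => [|u []]; first exact: mnear.
    exact: mnear.
  apply: le_trans (HP'x y _ Oy) _; first exact: (A2 y (conj Oy yx)).1.
  apply: (@le_trans _ _ ((C * s' ^+ (n + k))%:E * g%:E)%E).
    by rewrite lee_pmul2l// lte_fin mulr_gt0// exprn_gt0.
  rewrite -EFinM lee_fin ler_wpM2r// ?(ltW g0)// ler_wpM2l// ?(ltW C0)//.
  by rewrite lerXn2r// nnegrE ltW.
have I12 : (\int[leb n]_(u in A) `|((poly_eval p' \- poly_eval p) u)%:E| <=
    (2 * C * s ^+ (n + k) * g)%:E)%E.
  apply: (@le_trans _ _ (\int[leb n]_(u in A) (`|(f u - poly_eval p' u)%:E| + `|(f u - poly_eval p u)%:E|))%E).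
    apply: ge0_le_integral => //.
    - apply: measurableT_comp => //; apply/measurable_EFinP; apply: measurable_funTS.
      by apply: measurable_funB; exact: measurable_poly_eval.
    - by apply: emeasurable_funD; apply: mfp => // u [].
    - move=> u _; rewrite -EFinD lee_fin /=.
      have -> : poly_eval p' u - poly_eval p u = (f u - poly_eval p u) - (f u - poly_eval p' u) by lra.
      by rewrite [leRHS]addrC; exact: ler_normB.
  rewrite ge0_integralD//; last 2 first.
  - by apply: mfp => // u [].
  - by apply: mfp => // u [].
  apply: le_trans (leeD I2 I1) _; rewrite -EFinD lee_fin; lra.
have := HK (x - const_mx s') s (poly_eval p' \- poly_eval p) A (2 * C * s ^+ (n + k) * g) s0.
move=> /(_ _ _ _ mA _ _ I12 x).
have cubeE : cube (x - const_mx s') s = sup_ball x s' by rewrite /sup_ball s'E.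
rewrite cubeE => H; apply: le_trans (H _ _ _ _ _ _) _.
- by rewrite !mulr_gt0// exprn_gt0.
- by apply: sep_polyB; exact: sep_poly_poly_eval.
- by apply: measurable_funB; exact: measurable_poly_eval.
- by move=> u [].
- have := density Ox (_ : 0 < s' <= 1); rewrite s'0 half_le1 => /(_ isT).
  apply: le_trans; rewrite lee_fin -s'E exprMn.
  by rewrite mulrA divfK// gt_eqF// exprn_gt0.
- by apply: sup_ball_center; exact: ltW.
- have -> : 2 * C * s ^+ (n + k) * g / s ^+ n = 2 * C * (s ^+ k * g).
    by rewrite exprD -!mulrA; do 2 congr (_ * _); rewrite mulrC -!mulrA mulVf ?mulr1// gt_eqF// exprn_gt0.
  rewrite -!mulrA ler_wpM2r ?lerDl// !mulr_ge0// ?(ltW C0) ?(ltW g0)//.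
  by rewrite exprn_ge0// ltW.
Qed.

Variable p : R.
Hypothesis p1 : 1 < p.

(** Chebyshev: the part of Omega in the sup-norm ball has measure at least c r^n. If [sharp] were at
    least t = (2/c)^(1/p) r^(-n/p) N on all of it, its p-integral would be at least 2 N^p. *)
Lemma exists_small_sharp : exists2 K : R, 1 <= K &
  forall (f : 'rV[R]_n -> R) N x r, measurable_fun Omega (sharp k Omega f) -> 0 < N ->
    (\int[leb n]_(y in Omega) sharp k Omega f y `^ p <= (N `^ p)%:E)%E ->
    Omega x -> 0 < r <= 1 ->
    exists y, [/\ Omega y, sup_ball x r y &
      (sharp k Omega f y + N%:E <= (K * (r ^+ n) `^ (- p^-1) * N)%:E)%E].
Proof.
have p0 : 0 < p by rewrite (lt_trans _ p1).
have pV0 : 0 < p^-1 by rewrite invr_gt0.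
(* The summand 1 absorbs the offset N, because w >= 1 for r <= 1. *)
pose K := (2 / c) `^ p^-1; exists (K + 1); first by rewrite lerDr powR_ge0.
move=> f N x r mg N0 gN Ox /[dup] r01 /andP[r0 r1].
set w := _ `^ (- p^-1).
have rn0 : 0 < r ^+ n by rewrite exprn_gt0.
have w1 : 1 <= w.
  rewrite /w powRN -powR_inv1 ?powR_ge0// -powRrM mulrN1 powRN invf_ge1 ?powR_gt0//.
  apply: (@le_trans _ _ (1 `^ p^-1)); last by rewrite powR1.
  by rewrite ge0_ler_powR ?nnegrE ?(ltW rn0) ?(ltW pV0)// exprn_ile1 ?(ltW r0).
pose t := K * w * N.
have t0 : 0 < t by rewrite !mulr_gt0 ?powR_gt0 ?divr_gt0// (lt_le_trans _ w1).
apply: contrapT => /forallNP H.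
have gt y : Omega y -> sup_ball x r y -> (t%:E <= sharp k Omega f y)%E.
  move=> Oy yx; rewrite leNgt; apply/negP => gt; apply: (H y); split=> //.
  apply: le_trans (leeD (ltW gt) (lexx _)) _.
  by rewrite -EFinD lee_fin /t !mulrDl mul1r lerD2l ler_peMl// ltW.
have mA : measurable (Omega `&` sup_ball x r).
  by apply: measurableI => //; exact: measurable_cube.
have tp : t `^ p = 2 / c * N `^ p / r ^+ n.
  rewrite /t !powRM ?powR_ge0 ?(ltW N0) ?mulr_ge0 ?powR_ge0//.
  rewrite -!powRrM mulNr mulVf ?gt_eqF// powRr1 ?divr_ge0 ?(ltW c0)//.
  by rewrite powR_inv1 ?(ltW rn0)// mulrAC.
have : ((t `^ p)%:E * leb n (Omega `&` sup_ball x r) <= (N `^ p)%:E)%E.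
  rewrite -integral_cst//; apply: le_trans gN.
  apply: (@le_trans _ _ (\int[leb n]_(y in Omega `&` sup_ball x r) (sharp k Omega f y `^ p))%E).
    apply: ge0_le_integral => //.
    - by move=> y _; rewrite lee_fin powR_ge0.
    - apply: (measurableT_comp (measurable_poweR _)).
      by apply: measurable_funS mg => // y [].
    - move=> y [Oy yx]; rewrite -poweR_EFin; apply: poweR_le; rewrite ?(ltW p0) ?lee_fin ?(ltW t0)//.
      exact: gt.
  apply: ge0_subset_integral => //.
  - exact: (measurableT_comp (measurable_poweR _)).
  - by move=> y _; exact: poweR_ge0.
apply/negP; rewrite -ltNge.
apply: lt_le_trans (_ : ((t `^ p)%:E * (c * r ^+ n)%:E <= _)%E); last first.
  by rewrite lee_pmul2l ?lte_fin ?powR_gt0//; exact: density.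
rewrite -EFinM lte_fin tp.
have -> : 2 / c * N `^ p / r ^+ n * (c * r ^+ n) = 2 * N `^ p.
  by rewrite mulrACA mulVf ?gt_eqF// mulr1 mulrAC divfK ?gt_eqF.
by rewrite ltr_pMl ?ltr1n ?powR_gt0.
Qed.

Variable theta : R.
Hypotheses (theta01 : 0 <= theta <= 1).

(** The ratio of the interpolated geometric bound, below 1 exactly when theta n / p < k. *)
Let rho : R := 2^-1 `^ (k%:R - theta * n%:R / p).

(** The quotient (g + N) / N for the maximal function g. It is at least 1, so its powers grow with
    the exponent. Where g is infinite [fine] gives 0; under the p-integral bounds this concerns a
    null set only. *)
Definition density_ratio (f : 'rV[R]_n -> R) N x : R := 1 + fine (sharp k Omega f x) / N.

(* Interpolates between the two bounds of piecewise_step_le obtained for y = x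
   and for the y of exists_small_sharp. *)
Lemma piecewise_step_geometric : exists2 C2 : R, 0 < C2 &
  forall f N j P P' x, measurable_fun Omega f -> measurable_fun Omega (sharp k Omega f) -> 0 < N ->
    (\int[leb n]_(y in Omega) sharp k Omega f y `^ p <= (N `^ p)%:E)%E ->
    local_approx f N (half j) P -> local_approx f N (half j.+1) P' ->
    Omega x -> sharp k Omega f x \is a fin_num ->
    `|piecewise (half j.+1) P' x - piecewise (half j) P x| <=
    C2 * N * rho ^+ j * density_ratio f N x `^ (1 - theta).
Proof.
have p0 : 0 < p by rewrite (lt_trans _ p1).
have [C1 C10 HC1] := piecewise_step_le.
have [K K1 HK] := exists_small_sharp.
have K0 : 0 < K by rewrite (lt_le_trans _ K1).
have /andP[th0 th1] := theta01.
pose b : R := 2^-1; have b0 : 0 < b by rewrite invr_gt0.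
(* The power of b appears because the nearby point is sought at radius 2^-(j+1), while s = 2^-j. *)
exists (C1 * K * b `^ (- (theta * n%:R / p))); first by rewrite !mulr_gt0// powR_gt0.
move=> f N j P P' x mf mg N0 gN HP HP' Ox gfin.
set D := `|_|; set h := density_ratio f N x.
have h1 : 1 <= h by rewrite lerDl divr_ge0 ?(ltW N0)// fine_ge0// sharp_ge0.
have h0 : 0 < h by rewrite (lt_le_trans _ h1).
set s := half j in HP D *; have s0 : 0 < s := half_gt0 j.
have [y [Oy yx gy]] := HK f N x (half j.+1) mg N0 gN Ox (introT andP (conj (half_gt0 j.+1) (half_le1 j.+1))).
set w := _ `^ (- p^-1) in gy.
have w0 : 0 < w by rewrite powR_gt0// exprn_gt0// half_gt0.
have D1 : D <= C1 * s ^+ k * N * h.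
  apply: le_trans (HC1 f N j P P' x x (h * N) mf N0 HP HP' Ox Ox _ _ _) _.
  - by apply: sup_ball_center; exact/ltW/half_gt0.
  - by rewrite mulr_gt0.
  - by rewrite -{1}(fineK gfin) -EFinD lee_fin /h mulrDl mul1r divfK ?gt_eqF// addrC.
  - by rewrite -!mulrA [h * N]mulrC.
have D2 : D <= C1 * s ^+ k * N * (K * w).
  apply: le_trans (HC1 f N j P P' x y (K * w * N) mf N0 HP HP' Ox Oy yx _ gy) _.
  - by rewrite !mulr_gt0.
  - by rewrite -!mulrA [w * N]mulrC [K * (_ * _)]mulrCA.
have a0 : 0 < C1 * s ^+ k * N by rewrite !mulr_gt0// exprn_gt0.
have Kw0 : 0 < K * w by rewrite mulr_gt0.
(* Geometric mean of the two bounds, with weights 1 - theta and theta. *)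
have {D1 D2} D3 : D <= C1 * s ^+ k * N * (h `^ (1 - theta) * (K * w) `^ theta).
  rewrite -ler_pdivrMl//; set d := _ * D.
  have d1 : d <= h by rewrite ler_pdivrMl.
  have d2 : d <= K * w by rewrite ler_pdivrMl.
  have d0 : 0 <= d by rewrite mulr_ge0 ?normr_ge0// invr_ge0 ltW.
  have -> : d = d `^ (1 - theta) * d `^ theta.
    rewrite -powRD ?subrK ?powRr1//.
    by rewrite oner_eq0.
  by apply: ler_pM; rewrite ?powR_ge0// ge0_ler_powR ?nnegrE ?(ltW h0) ?(ltW Kw0)// subr_ge0.
apply: le_trans D3 _.
have wth : w `^ theta * s ^+ k = b `^ (- (theta * n%:R / p)) * rho ^+ j.
  have bX m : b ^+ m = b `^ m%:R := esym (powR_mulrn m (ltW b0)).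
  rewrite /w /rho /s -/b -!exprM !bX -(powR_mulrn j (powR_ge0 _ _)) -!powRrM.
  rewrite -!powRD ?(gt_eqF b0) ?implybT//; congr (_ `^ _).
  rewrite !natrM -natr1; lra.
have -> : C1 * s ^+ k * N * (h `^ (1 - theta) * (K * w) `^ theta) =
    C1 * N * K `^ theta * h `^ (1 - theta) * (w `^ theta * s ^+ k).
  by rewrite powRM ?(ltW K0) ?(ltW w0)//; lra.
rewrite wth.
have -> : C1 * K * b `^ (- (theta * n%:R / p)) * N * rho ^+ j * h `^ (1 - theta) =
  C1 * N * K * h `^ (1 - theta) * (b `^ (- (theta * n%:R / p)) * rho ^+ j) by lra.
rewrite ler_wpM2r ?mulr_ge0 ?powR_ge0 ?exprn_ge0 ?powR_ge0//.
rewrite ler_wpM2r ?powR_ge0// ler_wpM2l ?mulr_ge0 ?(ltW C10) ?(ltW N0)//.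
by rewrite ler1_powR.
Qed.

End calderon_approximation.

(** * Covers with bounded overlap, and the finitely many cells that meet a bounded set *)

Section finite_overlap.
Context d {T : measurableType d} {R : realType} (mu : {measure set T -> \bar R}).
Local Open Scope ereal_scope.

Lemma integral_le_sum_cover (I : finType) (A : I -> set T) (E : set T) (F : T -> \bar R) :
  measurable E -> (forall i, measurable (A i)) -> E `<=` \bigcup_i A i ->
  measurable_fun E F -> (forall x, E x -> 0 <= F x) ->
  \int[mu]_(x in E) F x <= \sum_i \int[mu]_(x in E `&` A i) F x.
Proof.
move=> mE mA EA mF F0; under eq_bigr do rewrite integral_mkcondr.
rewrite -ge0_integral_sum//; first last.
- by move=> i x Ex; rewrite patchE; case: ifP => // _; exact: F0.
- by move=> i; apply/(measurable_restrict _ _ _).1 => //; apply: measurable_funS mF.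
apply: ge0_le_integral => //.
- apply: emeasurable_sum => i; apply/(measurable_restrict _ _ _).1 => //.
  exact: measurable_funS mF.
- move=> x Ex; have [i _ Aix] := EA _ Ex.
  rewrite (bigD1 i)//= patchE mem_set// leeDl// sume_ge0// => j _.
  by rewrite patchE; case: ifP => // _; exact: F0.
Qed.

Lemma sum_integral_le_overlap (I : finType) (A : I -> set T) (B : set T) (G : T -> \bar R) m :
  measurable B -> (forall i, measurable (A i)) ->
  measurable_fun B G -> (forall x, B x -> 0 <= G x) ->
  (forall x, B x -> (#|[pred i | x \in A i]| <= m)%N) ->
  \sum_i \int[mu]_(x in B `&` A i) G x <= m%:R%:E * \int[mu]_(x in B) G x.
Proof.
move=> mB mA mG G0 Am; under eq_bigr do rewrite integral_mkcondr.
rewrite -ge0_integral_sum//; first last.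
- by move=> i x Ex; rewrite patchE; case: ifP => // _; exact: G0.
- by move=> i; apply/(measurable_restrict _ _ _).1 => //; apply: measurable_funS mG.
rewrite -ge0_integralZl//.
apply: ge0_le_integral => //.
- by move=> x Bx; rewrite sume_ge0// => i _; rewrite patchE; case: ifP => // _; exact: G0.
- apply: emeasurable_sum => i; apply/(measurable_restrict _ _ _).1 => //.
  exact: measurable_funS mG.
- exact: measurable_funeM.
- move=> x Bx; rewrite (bigID (fun i => x \in A i))/= [X in _ + X]big1 ?adde0; last first.
    by move=> i /negPf xA; rewrite patchE xA.
  rewrite (eq_bigr (fun=> G x)); last by move=> i xA; rewrite patchE xA.
  rewrite (eq_bigl (mem [pred i | x \in A i]))// sumr_const.
  have -> i : (G x *+ i)%R = i%:R%:E * G x.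
    elim: i => [|i IH]; first by rewrite mulr0n mul0e.
    by rewrite mulrS IH -nat1r EFinD ge0_muleDl ?mul1e// lee_fin.
  by rewrite lee_wpmul2r ?G0// lee_fin ler_nat Am.
Qed.

End finite_overlap.

Section cells_meeting_a_bounded_set.
Context {R : realType} {n : nat}.
Implicit Types (x y : 'rV[R]_n) (s : R).

(** The integers from -m to m in each coordinate, as a finite type. With m = B 2^j they index all
    cells of level j that meet the cube [-B, B]^n. *)
Definition shifted_index m (e : {ffun 'I_n -> 'I_(m.*2.+1)}) : {ffun 'I_n -> int} :=
  [ffun i => (e i : nat)%:Z - m%:Z].

Lemma cell_of_shifted_index (B : nat) j x : (forall i, `|x ord0 i| <= B%:R) ->
  exists e : {ffun 'I_n -> 'I_((B * 2 ^ j)%N.*2.+1)},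
    shifted_index e = cell_of (2^-1 ^+ j) x.
Proof.
move=> xB; set m := (B * 2 ^ j)%N.
have fl i : (- m%:Z <= cell_of (2^-1 ^+ j) x i <= m%:Z)%R.
  rewrite ffunE exprVn invrK floor_ge_int.
  have xm : `|x ord0 i * 2 ^+ j| <= m%:R.
    have -> : m%:R = B%:R * 2 ^+ j :> R by rewrite natrM natrX.
    by rewrite normrM (ger0_norm (exprn_ge0 _ _))// ler_wpM2r// exprn_ge0.
  move: xm; rewrite ler_norml => /andP[xm1 xm2]; rewrite rmorphN/= xm1/=.
  by rewrite -(ler_int R) (le_trans (floor_le _)).
exists [ffun i => inord `|(cell_of (2^-1 ^+ j) x i + m%:Z)%R|%N].
apply/ffunP => i; have := fl i; move: (cell_of _ _) => w; clearbody m => wm.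
rewrite !ffunE inordK; last by rewrite ltnS -addnn; lia.
by rewrite gez0_abs ?addrK// -lerBlDr sub0r; case/andP: wm.
Qed.

(** In each coordinate the index of such a cell differs from that of y by -1, 0 or 1, so these cells
    inject into {0, 1, 2}^n. *)
Lemma near_cell_overlap s m y :
  (#|[pred e : {ffun 'I_n -> 'I_(m.*2.+1)} | y \in near_cell s (shifted_index e)]| <= 3 ^ n)%N.
Proof.
rewrite -[X in (_ <= X ^ _)%N](card_ord 3) -[n in (_ <= _ ^ n)%N](card_ord n) -card_ffun.
set A := [pred e | _].
pose h (e : {ffun 'I_n -> 'I_(m.*2.+1)}) : {ffun 'I_n -> 'I_3} :=
  [ffun i => inord `|(shifted_index e i - cell_of s y i + 1)%R|%N].
have hA : {in A &, injective h}.
  move=> e e'; rewrite !inE => H H' hh; apply/ffunP => i; apply/val_inj => /=.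
  have := congr1 (fun u : {ffun 'I_n -> 'I_3} => val (u i)) hh; rewrite /h !ffunE /=.
  have := H i; have := H' i; rewrite !ffunE /=.
  move: (Num.floor _) => w; move: (nat_of_ord (e i)) (nat_of_ord (e' i)) => a a' K K'.
  by rewrite !inordK; lia.
by rewrite -(card_in_imset hA) max_card.
Qed.

End cells_meeting_a_bounded_set.

Section calderon_approximation_converges.
Import -(notations) mpoly.
Context {R : realType} {n : nat}.
Hypothesis n0 : (0 < n)%N.
Implicit Types (x y : 'rV[R]_n) (r s : R).

Local Notation half j := (2^-1 ^+ j : R).

Variables (k : nat) (Omega : set 'rV[R]_n) (c C : R).
Hypotheses (k0 : (0 < k)%N) (mO : measurable Omega) (c0 : 0 < c) (C0 : 0 < C).
Hypothesis density : forall x r, Omega x -> 0 < r <= 1 ->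
  ((c * r ^+ n)%:E <= leb n (Omega `&` sup_ball x r))%E.
Variable p : R.
Hypothesis p1 : 1 < p.

Variables (E : set 'rV[R]_n) (B : nat).
Hypotheses (mE : measurable E) (EO : E `<=` Omega)
  (EB : forall x, E x -> forall i, `|x ord0 i| <= B%:R).

Lemma leb_sup_ball_lty x r : (leb n (sup_ball x r) < +oo)%E.
Proof.
apply: (@le_lt_trans _ _ (leb n (sup_ball x `|r|))).
  by apply: le_measure; rewrite ?inE; [exact: measurable_cube..|exact: sup_ball_sub (ler_norm r)].
by rewrite leb_sup_ball// ltry.
Qed.

Lemma leb_bounded_lty : (leb n E < +oo)%E.
Proof.
apply: le_lt_trans (leb_sup_ball_lty 0 B%:R); apply: le_measure; rewrite ?inE//.
  exact: measurable_cube.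
by move=> x Ex; apply/sup_ballE => i; rewrite mxE subr0; exact: EB.
Qed.

(** Convergence of T_j to f in L_1(E). The bound of [local_approx] is averaged over each near cell,
    whose part in Omega has measure at least c s^n, and the near cells overlap at most 3^n times. K
    may depend on f, since the lemma only serves to identify the limit. *)
Lemma integral_sub_piecewise_le f N : measurable_fun Omega f ->
  measurable_fun Omega (sharp k Omega f) -> 0 < N ->
  (\int[leb n]_(y in Omega) sharp k Omega f y `^ p <= (N `^ p)%:E)%E ->
  exists K : R, forall j P, local_approx k Omega C f N (half j) P ->
  (\int[leb n]_(x in E) `|(f x - piecewise (half j) P x)%:E| <= (K * half j ^+ k)%:E)%E.
Proof.
move=> mf mg N0 gN.
(* The margin 3 contains the near cells of all cells meeting E, as s <= 1. *)
pose O1 := Omega `&` sup_ball (0 : 'rV[R]_n) (B%:R + 3).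
have mO1 : measurable O1 by apply: measurableI => //; exact: measurable_cube.
pose G x := (sharp k Omega f x + N%:E)%E.
have G0 x : (0 <= G x)%E by rewrite adde_ge0 ?sharp_ge0// lee_fin ltW.
have mG : measurable_fun Omega G by apply: emeasurable_funD.
(* Integrability on a bounded set comes from the p-integral through t <= N + N^(1 - p) t^p. *)
have IGfin : (\int[leb n]_(x in O1) G x < +oo)%E.
  apply: (@le_lt_trans _ _ (\int[leb n]_(x in O1)
      ((N + N)%:E + (N `^ (1 - p))%:E * sharp k Omega f x `^ p)))%E.
    apply: ge0_le_integral => //.
    - by apply: measurable_funS mG => // x [].
    - apply: emeasurable_funD => //; apply: measurable_funeM.
      by apply: (measurableT_comp (measurable_poweR _)); apply: measurable_funS mg => // x [].
    - move=> x _; rewrite EFinD addeAC leeD2r//.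
      by apply: le_add_poweR; rewrite ?sharp_ge0// ltW.
  rewrite ge0_integralD//; last 3 first.
  - by move=> x _; rewrite lee_fin addr_ge0// ltW.
  - by move=> x _; rewrite mule_ge0 ?lee_fin ?powR_ge0// poweR_ge0.
  - apply: measurable_funeM.
    by apply: (measurableT_comp (measurable_poweR _)); apply: measurable_funS mg => // x [].
  rewrite integral_cst// ge0_integralZl//; last 3 first.
  - by apply: (measurableT_comp (measurable_poweR _)); apply: measurable_funS mg => // x [].
  - by move=> x _; exact: poweR_ge0.
  - by rewrite lee_fin powR_ge0.
  apply: lte_add_pinfty; apply: lte_mul_pinfty; rewrite ?lee_fin ?addr_ge0 ?powR_ge0 ?(ltW N0)//.
    apply: le_lt_trans (leb_sup_ball_lty 0 (B%:R + 3)); apply: le_measure; rewrite ?inE//.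
      exact: measurable_cube.
    by move=> x [].
  apply: (@le_lt_trans _ _ (N `^ p)%:E)%E; last exact: ltry.
  apply: le_trans gN; apply: ge0_subset_integral => //.
  - exact: (measurableT_comp (measurable_poweR _)).
  - by move=> x _; exact: poweR_ge0.
  - by move=> x [].
set IG := (\int[leb n]_(x in O1) G x)%E in IGfin.
have IG0 : (0 <= IG)%E by apply: integral_ge0.
exists (C / c * (3 ^ n)%:R * fine IG) => j P HP.
set s := half j in HP *; have s0 : 0 < s := half_gt0 j.
pose m := (B * 2 ^ j)%N.
have mF A : measurable A -> A `<=` Omega -> forall u : mpoly n R,
    measurable_fun A (fun x => `|(f x - poly_eval u x)%:E|%E).
  move=> mA AO u; apply: measurableT_comp => //; apply/measurable_EFinP; apply: measurable_funB => //.
    exact: measurable_funS mf.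
  by apply: measurable_funTS; exact: measurable_poly_eval.
pose Q (e : {ffun 'I_n -> 'I_(m.*2.+1)}) := cell s (shifted_index e).
pose D (e : {ffun 'I_n -> 'I_(m.*2.+1)}) := near_cell s (shifted_index e).
have mQ e : measurable (Q e) by exact: measurable_cell.
have mD e : measurable (D e) by exact: measurable_near_cell.
apply: le_trans (integral_le_sum_cover (leb n) (A := Q) mE mQ _ _ _) _.
- move=> x Ex; have [e eE] := cell_of_shifted_index j (EB Ex).
  by exists e => //; rewrite /Q /cell /= eE.
- apply: measurableT_comp => //; apply/measurable_EFinP; apply: measurable_funB.
    exact: measurable_funS mf.
  by apply: measurable_funTS; exact: measurable_piecewise.
- by move=> x _; exact: abse_ge0.
apply: (@le_trans _ _ (\sum_e (C / c * s ^+ k)%:E * \int[leb n]_(x in O1 `&` D e) G x)%E).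
  apply: lee_sum => e _.
  have [[x [Ex xe]]|/forallNP E0] := pselect (exists x, (E `&` Q e) x); last first.
    have -> : E `&` Q e = set0 by apply/seteqP; split=> // x /E0.
    rewrite integral_set0 mule_ge0//; last exact: integral_ge0.
    by rewrite lee_fin mulr_ge0 ?divr_ge0 ?exprn_ge0// ltW.
  set z := shifted_index e in xe *.
  have [zk Hz] := HP z.
  pose A := near_cell s z `&` Omega.
  have mA : measurable A by apply: measurableI => //; exact: measurable_near_cell.
  have AO1 : O1 `&` D e = A.
    apply/seteqP; split=> [y [[Oy _] yD]|y [yD Oy]] //.
    split=> //; split=> //; apply/sup_ballE => i; rewrite mxE subr0.
    have := EB Ex i; move/cellE : xe => /(_ s0 i); move/near_cellE : yD => /(_ s0 i).
    have : s <= 1 := half_le1 j.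
    rewrite !rmorphD/= rmorphN/= !mulrDl !mul1r !ler_norml; lra.
  rewrite AO1.
  have cA : ((c * s ^+ n)%:E <= leb n A)%E.
    apply: le_trans (density (EO Ex) (_ : 0 < s <= 1)) _; first by rewrite s0 half_le1.
    apply: le_measure; rewrite ?inE//; first by apply: measurableI => //; exact: measurable_cube.
    by move=> y [Oy yx]; split=> //; rewrite -(xe : cell_of s x = z); exact: sup_ball_sub_near_cell.
  apply: (@le_trans _ _ (\int[leb n]_(y in A) `|(f y - poly_eval (P z) y)%:E|)%E).
    apply: (@le_trans _ _ (\int[leb n]_(y in E `&` Q e) `|(f y - poly_eval (P z) y)%:E|)%E).
      rewrite le_eqVlt; apply/orP; left; apply/eqP; apply: eq_integral => y; rewrite inE => -[_ ye].
      by rewrite /piecewise (ye : cell_of s y = z).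
    apply: ge0_subset_integral => //; first exact: measurableI.
      by apply: mF => // y [].
    move=> y [Ey ye]; split; last exact: EO.
    rewrite -/z -(ye : cell_of s y = z); apply: sup_ball_sub_near_cell => //.
    by apply: sup_ball_center; exact: ltW.
  set J := (\int[leb n]_(y in A) _)%E in Hz *.
  have J0 : (0 <= J)%E by apply: integral_ge0.
  have [cs0 Csk0] : 0 < c * s ^+ n /\ 0 < C * s ^+ (n + k) by rewrite !mulr_gt0// exprn_gt0.
  (* The number J is bounded through G(x) for every x in A; integrating over A replaces the value of
     G by its integral. *)
  have H1 : (J * (c * s ^+ n)%:E <= (C * s ^+ (n + k))%:E * \int[leb n]_(x in A) G x)%E.
    apply: (@le_trans _ _ (J * leb n A)%E); first exact: lee_wpmul2l.
    rewrite -ge0_integralZl//; last 2 first.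
    - by apply: measurable_funS mG => // y [].
    - by rewrite lee_fin ltW.
    rewrite -integral_cst//; apply: ge0_le_integral => //.
    - by apply: measurable_funeM; apply: measurable_funS mG => // y [].
    - by move=> y [yD Oy]; exact: Hz.
  rewrite muleC -lee_pdivlMl// in H1.
  apply: le_trans H1 _; rewrite muleA -EFinM lee_wpmul2r ?integral_ge0// lee_fin.
  by rewrite exprD invfM mulrACA mulKf ?gt_eqF ?exprn_gt0// [C / c]mulrC.
rewrite -ge0_sume_distrr; last by move=> e _; exact: integral_ge0.
apply: (@le_trans _ _ ((C / c * s ^+ k)%:E * ((3 ^ n)%:R%:E * IG))%E).
  apply: lee_wpmul2l; first by rewrite lee_fin mulr_ge0 ?divr_ge0 ?exprn_ge0// ltW.
  apply: sum_integral_le_overlap => //.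
  - by apply: measurable_funS mG => // x [].
  - by move=> x _; exact: near_cell_overlap.
rewrite -(fineK (_ : IG \is a fin_num)) ?ge0_fin_numE// -!EFinM lee_fin; lra.
Qed.

End calderon_approximation_converges.

(** * Uniform rates in L_q, and rounding to finitely many colours *)

Lemma inord_absz_inj (L : nat) (a b : int) : (- L%:Z <= a <= L%:Z)%R ->
  (- L%:Z <= b <= L%:Z)%R ->
  inord `|(a + L%:Z)%R|%N = inord `|(b + L%:Z)%R|%N :> 'I_(L.*2.+1) -> a = b.
Proof.
move=> aL bL /(congr1 val); rewrite /= !inordK; first by lia.
all: by rewrite ltnS -addnn; lia.
Qed.

Section calderon_compactness.
Import -(notations) mpoly.
Context {R : realType} {n : nat}.
Hypothesis n0 : (0 < n)%N.
Implicit Types (x y : 'rV[R]_n) (r s : R).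

Local Notation half j := (2^-1 ^+ j : R).

Variables (k : nat) (Omega : set 'rV[R]_n) (c C : R).
Hypotheses (k0 : (0 < k)%N) (mO : measurable Omega) (c0 : 0 < c) (C0 : 0 < C).
Hypothesis density : forall x r, Omega x -> 0 < r <= 1 ->
  ((c * r ^+ n)%:E <= leb n (Omega `&` sup_ball x r))%E.
Variable p : R.
Hypothesis p1 : 1 < p.

Variables (E : set 'rV[R]_n) (B : nat).
Hypotheses (mE : measurable E) (EO : E `<=` Omega)
  (EB : forall x, E x -> forall i, `|x ord0 i| <= B%:R).

(** [theta_n] makes the steps decay; [theta_q] makes g^(1 - theta) integrable to the power q on
    bounded sets; for q = +oo the power of g must disappear altogether. *)
Variables (theta : R) (q : \bar R).
Hypotheses (theta01 : 0 <= theta <= 1) (q1 : (1 <= q)%E)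
  (theta_n : theta * n%:R / p < k%:R)
  (theta_y : q = +oo%E -> theta = 1)
  (theta_q : forall r, q = r%:E -> (1 - theta) * r <= p).

Let rho : R := 2^-1 `^ (k%:R - theta * n%:R / p).

Let rho01 : 0 < rho < 1.
Proof.
rewrite /rho powR_gt0/= ?invr_gt0//.
apply: (@lt_le_trans _ _ (1 `^ (k%:R - theta * n%:R / p))); last by rewrite powR1.
apply: gt0_ltr_powR; rewrite ?subr_gt0 ?nnegrE ?invr_ge0//.
by rewrite invf_lt1// ltr1n.
Qed.

Let EE : leb n E = (fine (leb n E))%:E.
Proof. by rewrite fineK// ge0_fin_numE//; exact: (leb_bounded_lty mE EB). Qed.

Let Efin : (leb n E < +oo)%E.
Proof. exact: (leb_bounded_lty mE EB). Qed.

Let E0 : 0 <= fine (leb n E).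
Proof. by rewrite fine_ge0. Qed.

Lemma sharp_ae_fin f N : measurable_fun Omega (sharp k Omega f) ->
  (\int[leb n]_(y in Omega) sharp k Omega f y `^ p <= (N `^ p)%:E)%E ->
  {ae leb n, forall x, Omega x -> sharp k Omega f x \is a fin_num}.
Proof.
move=> mg gN; have p0 : 0 < p by rewrite (lt_trans _ p1).
have iS : (leb n).-integrable Omega (fun x => sharp k Omega f x `^ p)%E.
  apply/integrableP; split; first exact: (measurableT_comp (measurable_poweR _)).
  under eq_integral do rewrite gee0_abs ?poweR_ge0//.
  by rewrite (le_lt_trans gN)// ltry.
have := integrable_ae mO iS; apply: filterS => x H /H.
rewrite !ge0_fin_numE ?sharp_ge0 ?poweR_ge0// => /lty_poweRy; apply.
by rewrite gt_eqF.
Qed.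

(* The telescoping sum S of the steps bounds |T_j - T_J| for all j > J; as T_j
   tends to f in L_1, the positive part of |f - T_J| - S has integral 0. *)
Lemma ae_sub_piecewise_le : exists2 C3 : R, 0 < C3 &
  forall f N (P : nat -> {ffun 'I_n -> int} -> mpoly n R),
    measurable_fun Omega f -> measurable_fun Omega (sharp k Omega f) -> 0 < N ->
    (\int[leb n]_(y in Omega) sharp k Omega f y `^ p <= (N `^ p)%:E)%E ->
    (forall j, local_approx k Omega C f N (half j) (P j)) -> forall J,
    {ae leb n, forall x, E x -> `|f x - piecewise (half J) (P J) x| <=
      C3 * N * rho ^+ J * density_ratio k Omega f N x `^ (1 - theta)}.
Proof.
have /andP[r0 r1] := rho01; have r1' : 0 < 1 - rho by rewrite subr_gt0.
have [C2 C20 HC2] := piecewise_step_geometric k mO c0 C0 density p1 theta01.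
exists (C2 / (1 - rho)); first by rewrite divr_gt0.
move=> f N P mf mg N0 gN HP J.
pose T j := piecewise (half j) (P j).
pose h x := density_ratio k Omega f N x `^ (1 - theta).
have h0 x : 0 <= h x by exact: powR_ge0.
(* The factor 1 - rho^i is the exact partial geometric sum, which lets the induction on i close. *)
have Tdiff i x : Omega x -> sharp k Omega f x \is a fin_num ->
    `|T (J + i)%N x - T J x| <= C2 / (1 - rho) * N * rho ^+ J * h x * (1 - rho ^+ i).
  move=> Ox gx; elim: i => [|i IH]; first by rewrite addn0 subrr normr0 expr0 subrr mulr0.
  have := HC2 f N (J + i)%N _ _ x mf mg N0 gN (HP _) (HP _) Ox gx.
  rewrite -/rho -/(h x) -addnS => H.
  rewrite -(subrK (T (J + i)%N x) (T (J + i.+1)%N x)) -addrA.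
  apply: le_trans (ler_normD _ _) _; apply: le_trans (lerD H IH) _.
  rewrite exprD exprS.
  have -> : C2 * N * (rho ^+ J * rho ^+ i) * h x =
    C2 / (1 - rho) * N * rho ^+ J * h x * ((1 - rho) * rho ^+ i).
    have C2E : C2 = C2 / (1 - rho) * (1 - rho) by rewrite divfK// gt_eqF.
    by rewrite {1}C2E; lra.
  by rewrite -mulrDr le_eqVlt; apply/orP; left; apply/eqP; congr (_ * _); lra.
pose S x := C2 / (1 - rho) * N * rho ^+ J * h x.
have mET j : measurable_fun E (T j).
  by apply: measurable_funTS; apply: measurable_piecewise; exact: half_gt0.
have mEf : measurable_fun E f by exact: measurable_funS mf.
have mS : measurable_fun E S.
  apply: measurable_funM; first exact: measurable_cst.
  apply: (@measurableT_comp _ _ _ _ _ _ (fun t : R => t `^ (1 - theta)) _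
    (density_ratio k Omega f N)); first exact: measurable_powR.
  rewrite /density_ratio.
  apply: measurable_funD; first exact: measurable_cst.
  apply: measurable_funM; last exact: measurable_cst.
  by apply: measurableT_comp => //; exact: measurable_funS mg.
pose phi x := Num.max 0 (`|f x - T J x| - S x).
have mphi : measurable_fun E phi.
  apply: measurable_maxr; first exact: measurable_cst.
  apply: measurable_funB => //; apply: measurableT_comp => //.
  exact: measurable_funB.
have [K HK] := integral_sub_piecewise_le mO c0 C0 density p1 mE EO EB mf mg N0 gN.
have sfin := sharp_ae_fin mg gN.
(* Almost everywhere |T_(J+i) - T_J| <= S, so phi is at most |f - T_(J+i)| for every i. *)
have phile i : (\int[leb n]_(x in E) `|(phi x)%:E| <= (`|K| * half i)%:E)%E.
  apply: (@le_trans _ _ (K * half (J + i)%N ^+ k)%:E); last first.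
    rewrite lee_fin; apply: (@le_trans _ _ (`|K| * half (J + i)%N ^+ k)).
      by rewrite ler_wpM2r ?ler_norm// exprn_ge0// ltW// half_gt0.
    rewrite ler_wpM2l// -exprM ler_wiXn2l ?invr_ge0 ?invf_le1 ?ler1n//.
    by rewrite (leq_trans (leq_addl J i))// leq_pmulr.
  apply: le_trans (HK _ _ (HP (J + i)%N)).
  apply: ae_ge0_le_integral => //.
  - by apply: measurableT_comp => //; exact/measurable_EFinP.
  - apply: measurableT_comp => //; apply/measurable_EFinP; apply: measurable_funB => //.
    exact: mET.
  - move: sfin; apply: filterS => x H Ex; have Ox := EO Ex.
    have {H} Td := Tdiff i x Ox (H Ox); rewrite lee_fin /phi.
    rewrite ger0_norm ?le_max ?lexx// ge_max normr_ge0 lerBlDl.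
    have -> : f x - T J x = (f x - T (J + i)%N x) + (T (J + i)%N x - T J x) by lra.
    apply: le_trans (ler_normD _ _) _; rewrite addrC lerD2r.
    apply: le_trans Td _; rewrite -/(S x) ler_piMr//.
      by rewrite /S !mulr_ge0 ?exprn_ge0 ?invr_ge0 ?(ltW C20) ?(ltW N0) ?(ltW r0) ?(ltW r1').
    by rewrite lerBlDl lerDr exprn_ge0// ltW.
have phi0 : (\int[leb n]_(x in E) `|(phi x)%:E| = 0)%E.
  apply/eqP; rewrite eq_le integral_ge0// andbT; apply/lee_addgt0Pr => e e0.
  rewrite add0e.
  have /cvgrPdist_lt/(_ _ e0) : (fun i => `|K| * half i) @ \oo --> 0.
    rewrite -[X in _ --> X](mulr0 `|K|); apply: cvgM; first exact: cvg_cst.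
    by apply: cvg_expr; rewrite ger0_norm// invf_lt1// ltr1n.
  move=> [i _ /(_ i (leqnn i))]; rewrite /= sub0r normrN => ie.
  by rewrite (le_trans (phile i))// lee_fin (le_trans (ler_norm _))// ltW.
have /(ae_eq_integral_abs (leb n) mE)[/(_ phi0) + _] : measurable_fun E (EFin \o phi) by exact/measurable_EFinP.
apply: filterS => x H /H /= [] /eqP.
rewrite /phi => /eqP phix; rewrite -subr_le0 -[X in _ <= X]phix.
by rewrite le_max lexx orbT.
Qed.

(** For finite q = r and u = g / N one has (1 + u)^((1 - theta) r) <= (1 + u)^p <= 2^p (1 + u^p),
    and the integral of u^p is at most 1. For q = +oo the exponent 1 - theta is 0. *)
Lemma Lp_norm_le_density_ratio f N (F : 'rV[R]_n -> R) b :
  measurable_fun Omega (sharp k Omega f) -> 0 < N ->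
  (\int[leb n]_(y in Omega) sharp k Omega f y `^ p <= (N `^ p)%:E)%E ->
  measurable_fun E F -> 0 <= b ->
  {ae leb n, forall x, E x -> `|F x| <= b * density_ratio k Omega f N x `^ (1 - theta)} ->
  (Lp_norm E q (EFin \o F) <= (2 `^ p * (fine (leb n E) + 1) * b)%:E)%E.
Proof.
move=> mg N0 gN mF b0 Fb.
have p0 : 0 < p by rewrite (lt_trans _ p1).
have two1 : 1 <= 2 `^ p :> R.
  by rewrite (le_trans (ler1n R 2))//  le1r_powR// ?ler1n// ltW.
have K1 : 1 <= 2 `^ p * (fine (leb n E) + 1).
  by rewrite -[leLHS]mulr1 ler_pM// lerDr.
have K0 : 0 <= 2 `^ p * (fine (leb n E) + 1) by rewrite (le_trans _ K1).
move: theta_y theta_q q1; case: q => [r _ /(_ r erefl) thr|thy _ _|_ _]; last by rewrite leNgt ltNyr.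
- rewrite lee_fin => r1; have r0 : 0 < r by rewrite (lt_le_trans _ r1).
  apply/Lp_norm_leP => //; first by rewrite mulr_ge0.
  apply: (@le_trans _ _ (\int[leb n]_(x in E) ((b `^ r * 2 `^ p)%:E *
      (1 + (N `^ (- p))%:E * sharp k Omega f x `^ p)))%E).
    apply: ae_ge0_le_integral => //.
    + by move=> x _; exact: poweR_ge0.
    + apply: (measurableT_comp (measurable_poweR _)); apply: measurableT_comp => //.
      exact/measurable_EFinP.
    + move=> x _; rewrite mule_ge0 ?lee_fin ?mulr_ge0 ?powR_ge0// adde_ge0//.
      by rewrite mule_ge0 ?lee_fin ?powR_ge0 ?poweR_ge0.
    + apply: measurable_funeM; apply: emeasurable_funD => //; apply: measurable_funeM.
      by apply: (measurableT_comp (measurable_poweR _)); exact: measurable_funS mg.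
    + move: (sharp_ae_fin mg gN) Fb; apply: filterS2 => x gx Fx Ex.
      have {}gx := gx (EO Ex); have {Fx} := Fx Ex; rewrite /density_ratio /=.
      have : (0 <= sharp k Omega f x)%E by exact: sharp_ge0.
      rewrite -{1 3}(fineK gx) lee_fin; set g := fine _ => g0 Fx.
      rewrite !poweR_EFin -[1%E]/(1%R%:E) -(EFinM (N `^ (- p))) -EFinD -EFinM lee_fin.
      pose u := g / N; have u0 : 0 <= u by rewrite divr_ge0// ltW.
      have -> : N `^ (- p) * g `^ p = u `^ p.
        rewrite /u powRM ?invr_ge0 ?(ltW N0)// mulrC; congr (_ * _).
        by rewrite -powR_inv1 ?(ltW N0)// -powRrM mulN1r.
      rewrite -mulrA.
      apply: le_trans (ge0_ler_powR (ltW r0) _ _ Fx) _.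
      * by rewrite nnegrE.
      * by rewrite nnegrE mulr_ge0// powR_ge0.
      rewrite powRM ?powR_ge0// ler_wpM2l ?powR_ge0// -powRrM.
      have h1 : 1 <= 1 + u by rewrite lerDl.
      apply: le_trans (ler_powR h1 thr) _.
      have [u1|u1] := leP u 1.
        apply: (@le_trans _ _ (2 `^ p)).
          by apply: ge0_ler_powR; rewrite ?nnegrE ?(ltW p0)//; lra.
        by rewrite ler_peMr ?powR_ge0// lerDl powR_ge0.
      apply: (@le_trans _ _ ((2 * u) `^ p)).
        by apply: ge0_ler_powR; rewrite ?nnegrE ?(ltW p0)//; lra.
      by rewrite powRM// ler_wpM2l ?powR_ge0// lerDr.
  have mgp : measurable_fun E (fun x => sharp k Omega f x `^ p)%E.
    by apply: (measurableT_comp (measurable_poweR _)); exact: measurable_funS mg.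
  rewrite ge0_integralZl//; last 3 first.
  + by apply: emeasurable_funD => //; exact: measurable_funeM.
  + by move=> x _; rewrite adde_ge0// mule_ge0 ?lee_fin ?powR_ge0 ?poweR_ge0.
  + by rewrite lee_fin mulr_ge0 ?powR_ge0.
  rewrite ge0_integralD//; last 2 first.
  + by move=> x _; rewrite mule_ge0 ?lee_fin ?powR_ge0 ?poweR_ge0.
  + exact: measurable_funeM.
  rewrite ge0_integralZl//; last 2 first.
  + by move=> x _; exact: poweR_ge0.
  + by rewrite lee_fin powR_ge0.
  rewrite integral_cst// mul1e.
  have gE : (\int[leb n]_(x in E) (sharp k Omega f x `^ p) <= (N `^ p)%:E)%E.
    apply: le_trans gN; apply: ge0_subset_integral => //.
    - exact: (measurableT_comp (measurable_poweR _)).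
    - by move=> x _; exact: poweR_ge0.
  apply: (@le_trans _ _ ((b `^ r * 2 `^ p)%:E * (leb n E + 1))%E).
    apply: lee_wpmul2l; first by rewrite lee_fin mulr_ge0 ?powR_ge0.
    apply: leeD2l; apply: le_trans (lee_wpmul2l _ gE) _; first by rewrite lee_fin powR_ge0.
    by rewrite -EFinM lee_fin -powRD ?(gt_eqF N0) ?implybT// addNr powRr0.
  rewrite [in leLHS]EE -EFinD -EFinM lee_fin (powRM _ K0 b0) [leRHS]mulrC.
  by rewrite -[leLHS]mulrA ler_wpM2l ?powR_ge0//; exact: le1r_powR.
- have th1 := thy erefl.
  apply/Lp_norm_leyP; first by rewrite mulr_ge0.
  move: Fb; apply: filterS => x Fb Ex; have := Fb Ex; rewrite th1 subrr powRr0 mulr1 => Fx.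
  by rewrite lee_fin (le_trans Fx)// ler_peMl.
Qed.

(** Remez for the polynomial itself: near x its L_1 norm is at most that of f plus the approximation
    error. As M depends on j but not on f, the rounded values stay in a finite range. *)
Lemma local_approx_bounded j : exists2 M : R, 0 < M &
  forall f N P x y, measurable_fun Omega f -> measurable_fun Omega (sharp k Omega f) -> 0 < N ->
    (Lp_norm Omega p%:E (EFin \o f) <= N%:E)%E ->
    (\int[leb n]_(y in Omega) sharp k Omega f y `^ p <= (N `^ p)%:E)%E ->
    local_approx k Omega C f N (half j) P -> Omega x ->
    cell (half j) (cell_of (half j) x) y ->
    `|poly_eval (P (cell_of (half j) x)) y| <= M * N.
Proof.
have [K K1 HK] := exists_small_sharp k mO c0 density p1.
have c20 : 0 < c / 2 ^+ n by rewrite divr_gt0// exprn_gt0.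
have [D D0 HD] := @sep_poly_le_of_integral R n k _ c20.
set s := half j; have s0 : 0 < s := half_gt0 j.
have s01 : 0 < s <= 1 by rewrite s0 half_le1.
pose w := (s ^+ n) `^ (- p^-1); have w0 : 0 < w by rewrite powR_gt0// exprn_gt0.
have s20 : 0 < 2 * s by rewrite mulr_gt0.
pose M1 := (2 * s) ^+ n + 1 + C * s ^+ (n + k) * (K * w).
have M10 : 0 < M1.
  rewrite addr_gt0// ?addr_gt0 ?exprn_gt0 ?mulr_gt0 ?exprn_gt0//.
  by rewrite (lt_le_trans _ K1).
exists ((D + 1) * (M1 / (2 * s) ^+ n)).
  by rewrite mulr_gt0 ?divr_gt0 ?exprn_gt0// ltr_wpDl.
move=> f N P x y mf mg N0 fN gN HP Ox yx.
have [y0 [Oy0 y0x gy0]] := HK f N x s mg N0 gN Ox s01.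
have [Pk HPz] := HP (cell_of s x); set u := P _ in Pk HPz *.
pose A := Omega `&` sup_ball x s.
have mA : measurable A by apply: measurableI => //; exact: measurable_cube.
have AO : A `<=` Omega by move=> z [].
have AD : A `<=` near_cell s (cell_of s x) `&` Omega.
  by move=> z [Oz zx]; split=> //; exact: sup_ball_sub_near_cell.
have Afin : (leb n A < +oo)%E.
  apply: le_lt_trans (leb_sup_ball_lty x s); apply: le_measure; rewrite ?inE//.
    exact: measurable_cube.
  by move=> z [].
have Ale : fine (leb n A) <= (2 * s) ^+ n.
  rewrite -lee_fin fineK ?ge0_fin_numE// -(leb_sup_ball x (ltW s0)).
  apply: le_measure; rewrite ?inE//; first exact: measurable_cube.
  by move=> z [].
have mfu B' : measurable B' -> B' `<=` Omega ->
    measurable_fun B' (fun z => `|(f z - poly_eval u z)%:E|%E).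
  move=> mB' BO; apply: measurableT_comp => //; apply/measurable_EFinP; apply: measurable_funB => //.
    exact: measurable_funS mf.
  by apply: measurable_funTS; exact: measurable_poly_eval.
have mEf : measurable_fun A (EFin \o f).
  by apply/measurable_EFinP; exact: measurable_funS mf.
have If : (\int[leb n]_(z in A) `|(f z)%:E| <= (((2 * s) ^+ n + 1) * N)%:E)%E.
  apply: (@le_trans _ _ ((fine (leb n A) + 1) * N)%:E); last first.
    by rewrite lee_fin ler_wpM2r ?(ltW N0)// lerD2r.
  apply: (@integral_abs_le_Lp_norm _ _ _ mA Afin p%:E) => //.
  - by rewrite lee_fin ltW.
  - exact: measurable_funS mf.
  - apply/(Lp_norm_leP _ _ (ltW p1) (ltW N0)).
    move/(Lp_norm_leP _ _ (ltW p1) (ltW N0)) : fN; apply: le_trans.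
    apply: ge0_subset_integral => //.
    + apply: (measurableT_comp (measurable_poweR _)); apply: measurableT_comp => //.
      exact/measurable_EFinP.
    + by move=> z _; exact: poweR_ge0.
have Ifu : (\int[leb n]_(z in A) `|(f z - poly_eval u z)%:E| <= (C * s ^+ (n + k) * (K * w) * N)%:E)%E.
  apply: (@le_trans _ _ (\int[leb n]_(z in near_cell s (cell_of s x) `&` Omega) `|(f z - poly_eval u z)%:E|)%E).
    apply: ge0_subset_integral => //.
    - by apply: measurableI => //; exact: measurable_near_cell.
    - apply: mfu; last by move=> z [].
      by apply: measurableI => //; exact: measurable_near_cell.
  apply: le_trans (HPz y0 (AD y0 (conj Oy0 y0x)).1 Oy0) _.
  apply: le_trans (lee_wpmul2l _ gy0) _; first by rewrite lee_fin mulr_ge0 ?exprn_ge0 ?(ltW C0) ?(ltW s0).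
  by rewrite -EFinM lee_fin !mulrA.
have Iu : (\int[leb n]_(z in A) `|(poly_eval u z)%:E| <= (M1 * N)%:E)%E.
  apply: (@le_trans _ _ (\int[leb n]_(z in A) (`|(f z)%:E| + `|(f z - poly_eval u z)%:E|))%E).
    apply: ge0_le_integral => //.
    - apply: measurableT_comp => //; apply/measurable_EFinP; apply: measurable_funTS.
      exact: measurable_poly_eval.
    - apply: emeasurable_funD; first exact: measurableT_comp.
      exact: mfu.
    - move=> z _; rewrite -EFinD lee_fin.
      rewrite -[X in `|X| <= _](subKr (f z)); exact: ler_normB.
  rewrite ge0_integralD//; last 2 first.
  - exact: measurableT_comp.
  - exact: mfu.
  by apply: le_trans (leeD If Ifu) _; rewrite -EFinD lee_fin /M1; lra.
have := HD (x - const_mx s) (2 * s) (poly_eval u) A (M1 * N) s20.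
move=> H; apply: le_trans (H _ _ _ mA _ _ Iu y _) _.
- by rewrite mulr_gt0.
- exact: sep_poly_poly_eval.
- exact: measurable_poly_eval.
- by move=> z [].
- apply: le_trans (density Ox s01); rewrite lee_fin exprMn mulrA divfK// gt_eqF// exprn_gt0//.
- exact: cell_sub_sup_ball.
- rewrite -[leRHS]mulrA [M1 / _ * N]mulrAC ler_wpM2r ?lerDl//.
  by rewrite divr_ge0 ?exprn_ge0 ?mulr_ge0 ?(ltW M10) ?(ltW N0) ?(ltW s0)//.
Qed.

(* The values of the polynomials at the grid points of the cells, rounded to
   multiples of d. *)
Definition grid_colour m L (s d : R) (P : {ffun 'I_n -> int} -> mpoly n R) :
    {ffun {ffun 'I_n -> 'I_(m.*2.+1)} * {ffun 'I_n -> 'I_k} -> 'I_(L.*2.+1)} :=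
  [ffun t => inord `|(Num.floor (poly_eval (P (shifted_index t.1))
    (grid_point (\row_i ((shifted_index t.1 i)%:~R * s)) s t.2) / d) + L%:Z)%R|%N].

(** Equal colours mean equal floors at the grid points, so the polynomials differ there by at most
    d, and on the whole cell by a fixed multiple of d. *)
Lemma piecewise_close_of_colour : exists2 D : R, 0 < D &
  forall j L (d b : R) (P P' : {ffun 'I_n -> int} -> mpoly n R),
    0 < d -> b / d + 1 <= L%:R ->
    (forall z, (msize (P z) <= k)%N) -> (forall z, (msize (P' z) <= k)%N) ->
    (forall x y, E x -> cell (half j) (cell_of (half j) x) y ->
      `|poly_eval (P (cell_of (half j) x)) y| <= b) ->
    (forall x y, E x -> cell (half j) (cell_of (half j) x) y ->
      `|poly_eval (P' (cell_of (half j) x)) y| <= b) ->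
    grid_colour (B * 2 ^ j) L (half j) d P = grid_colour (B * 2 ^ j) L (half j) d P' ->
    forall x, E x -> `|piecewise (half j) P x - piecewise (half j) P' x| <= D * d.
Proof.
have [D D0 HD] := @sep_poly_le_of_grid R n k k0.
exists (D + 1); first by rewrite ltr_wpDl.
move=> j L d b P P' d0 bL Pk P'k Pb P'b cPP x Ex.
set s := half j in Pb P'b cPP *; have s0 : 0 < s := half_gt0 j.
have [e eE] := cell_of_shifted_index j (EB Ex).
rewrite /piecewise -/s -eE; set z := shifted_index e.
pose a : 'rV[R]_n := \row_i ((z i)%:~R * s).
have gridz (g : {ffun 'I_n -> 'I_k}) : cell s z (grid_point a s g).
  apply/cellE => // i; rewrite !mxE rmorphD/= mulrDl mul1r lerDl ltrD2l.
  rewrite mulr_ge0 ?divr_ge0 ?(ltW s0)//= gtr_pMr//.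
  by rewrite ltr_pdivrMr ?ltr0n// mul1r ltr_nat.
(* The choice of L keeps the floors in [-L, L]; beyond that range [inord] takes a default value and
   the colour would not determine them. *)
have floorL (u : R) : `|u| <= b -> (- L%:Z <= Num.floor (u / d) <= L%:Z)%R.
  move=> ub; have : `|u / d| <= b / d.
    by rewrite normrM normfV (gtr0_norm d0) ler_wpM2r// invr_ge0 ltW.
  rewrite ler_norml => /andP[u1 u2]; rewrite floor_ge_int -(ler_int R) rmorphN/=.
  have := floor_le (u / d); lra.
have close (g : {ffun 'I_n -> 'I_k}) :
    `|(poly_eval (P z) \- poly_eval (P' z)) (grid_point a s g)| <= d.
  have /ffunP/(_ (e, g)) := cPP; rewrite !ffunE/= -/z -/a.
  set u := poly_eval (P z) _; set v := poly_eval (P' z) _.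
  have ub : `|u| <= b by have := Pb x (grid_point a s g) Ex; rewrite -eE; apply; exact: gridz.
  have vb : `|v| <= b by have := P'b x (grid_point a s g) Ex; rewrite -eE; apply; exact: gridz.
  have := floor_itv (u / d); have := floor_itv (v / d).
  have := floorL _ ub; have := floorL _ vb.
  move: (Num.floor (u / d)) (Num.floor (v / d)) => fu fv vL uL hv hu.
  move/(inord_absz_inj uL vL) => fuv; move: hv hu; rewrite -fuv rmorphD/= !ler_pdivlMr// !ltr_pdivrMr// mulrDl mul1r.
  by rewrite ler_norml; lra.
apply: le_trans (_ : D * d <= _); last by rewrite ler_wpM2r ?(ltW d0)// lerDl.
apply: (HD a s (poly_eval (P z) \- poly_eval (P' z)) d s0 _ close).
  by apply: sep_polyB; exact: sep_poly_poly_eval.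
move=> i; rewrite !mxE; have /cellE-/(_ s0 i) : cell s z x by rewrite /cell/= /z eE.
by rewrite rmorphD/= mulrDl mul1r => /andP[-> /ltW ->].
Qed.

End calderon_compactness.

(** * Calderon spaces are compactly embedded in L_q *)

Section calderon_embedding.
Import -(notations) mpoly.
Context {R : realType} {n : nat}.
Implicit Types (x y : 'rV[R]_n) (r s : R).

Local Notation half j := (2^-1 ^+ j : R).

(* theta = max(0, 1 - p/q). *)
Lemma admissible_theta k (p : R) q : (0 < n)%N -> (0 < k)%N -> 1 < p ->
  admissible_exponent n k p q ->
  exists theta : R, [/\ 0 <= theta <= 1, theta * n%:R / p < k%:R,
    q = +oo%E -> theta = 1 & forall r, q = r%:E -> (1 - theta) * r <= p].
Proof.
move=> n0 k0 p1 [q1 qe ql]; have p0 : 0 < p by rewrite (lt_trans _ p1).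
have n0' : 0 < n%:R :> R by rewrite ltr0n.
case: q q1 qe ql => [r| |]; last by rewrite leNgt ltNyr.
- rewrite lee_fin => r1 qe ql; have r0 : 0 < r by rewrite (lt_le_trans _ r1).
  have [rp|pr] := leP r p.
    exists 0; split=> //; first by rewrite lexx ler01.
      by rewrite !mul0r ltr0n.
    by move=> _ [<-]; rewrite subr0 mul1r.
  exists (1 - p / r); split=> //.
  - rewrite subr_ge0 ler_pdivrMr// mul1r (ltW pr)/= lerBlDr lerDl.
    by rewrite divr_ge0// ltW.
  (* The loss theta n / p equals n/p - n/r. For k p < n, its being below k is the condition r < p n
     / (n - k p); otherwise n/p <= k already. *)
  - have -> : (1 - p / r) * n%:R / p = n%:R / p - n%:R / r.
      rewrite !mulrBl mul1r; congr (_ - _).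
      by rewrite [p / r]mulrC -!mulrA [p * _]mulrC divfK ?gt_eqF// mulrC.
    have [lt|le] := ltP (k%:R * p) n%:R.
      have := ql lt; rewrite lte_fin ltr_pdivlMr ?subr_gt0// => H.
      rewrite ltrBlDr -ltrBlDl -(ltr_pM2r (mulr_gt0 p0 r0)).
      have -> : (n%:R / p - k%:R) * (p * r) = r * (n%:R - k%:R * p).
        by rewrite mulrBl mulrA divfK ?gt_eqF//; lra.
      by rewrite [p * r]mulrC mulrA divfK ?gt_eqF// [n%:R * p]mulrC.
    apply: (@lt_le_trans _ _ (n%:R / p)); first by rewrite ltrBlDr ltrDl divr_gt0.
    by rewrite ler_pdivrMr.
  - by move=> _ [<-]; rewrite opprB addrCA subrr addr0 divfK// gt_eqF.
(* For q = +oo admissibility rules out both k p = n and k p < n, leaving n / p < k. *)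
- move=> _ qe ql; exists 1; split=> //; first by rewrite ler01 lexx.
  rewrite mul1r ltr_pdivrMr//; rewrite ltNge; apply/negP.
  rewrite le_eqVlt => /orP[/eqP/qe|/ql]; first by rewrite ltxx.
  by rewrite ltNge leey.
Qed.

Lemma exists_local_approx k (Omega : set 'rV[R]_n) : (0 < n)%N -> measurable Omega ->
  exists2 C : R, 0 < C & forall f N, measurable_fun Omega f -> 0 < N ->
    exists P : nat -> {ffun 'I_n -> int} -> mpoly n R,
      forall j, local_approx k Omega C f N (half j) (P j).
Proof.
move=> n0 mO; have [C C0 HC] := @exists_near_best_poly R n k n0.
exists C => // f N mf N0.
have /choice[P HP] j : exists P, local_approx k Omega C f N (half j) P.
  have /choice[P HP] z : exists P : mpoly n R, (msize P <= k)%N /\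
      forall x, near_cell (half j) z x -> Omega x ->
      (\int[leb n]_(y in near_cell (half j) z `&` Omega) `|(f y - poly_eval P y)%:E| <=
       (C * half j ^+ (n + k))%:E * (sharp k Omega f x + N%:E))%E.
    have [P Pk HP] := HC Omega f N (half j) z mO mf N0 (half_gt0 j).
    by exists P.
  by exists P.
by exists P.
Qed.

Variables (k : nat) (Omega : set 'rV[R]_n) (p : R) (q : \bar R).
Hypotheses (n0 : (0 < n)%N) (k0 : (0 < k)%N) (p1 : 1 < p)
  (Omega_open : open Omega) (Omega_nset : is_nset Omega)
  (hq : admissible_exponent n k p q).
Variable E : set 'rV[R]_n.
Hypotheses (mE : measurable E) (EO : E `<=` Omega) (bE : bounded_set E).

Let mO : measurable Omega.
Proof. exact: open_measurable_row. Qed.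

Lemma bounded_set_coord : exists B : nat, forall x, E x -> forall i, `|x ord0 i| <= B%:R.
Proof.
have [M [Mr HM]] := bE.
pose B := (Num.trunc `|M|).+1.
have MB : M < B%:R by rewrite (le_lt_trans (ler_norm M))// truncnS_gt.
exists B => x Ex i; apply: le_trans (HM _ MB x Ex).
rewrite [leRHS]mx_normrE; exact: (le_bigmax _ (fun ij : 'I_1 * 'I_n => `|x ij.1 ij.2|) (ord0, i)).
Qed.

Lemma calderon_class f N : calderon k Omega p%:E f ->
  (calderon_norm k Omega p%:E f <= N%:E)%E -> 0 < N ->
  [/\ measurable_fun Omega f, measurable_fun Omega (sharp k Omega f),
    (Lp_norm Omega p%:E (EFin \o f) <= N%:E)%E &
    (\int[leb n]_(y in Omega) sharp k Omega f y `^ p <= (N `^ p)%:E)%E].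
Proof.
move=> [[mf fp] [mg gp]] fN N0; split=> //.
- exact/measurable_EFinP.
- by apply: le_trans fN; rewrite /calderon_norm leeDl// Lp_norm_ge0.
- have : (Lp_norm Omega p%:E (sharp k Omega f) <= N%:E)%E.
    by apply: le_trans fN; rewrite /calderon_norm leeDr// Lp_norm_ge0.
  move=> /(Lp_norm_leP _ _ (ltW p1) (ltW N0)); congr (_ <= _)%E.
  by apply: eq_integral => x _; rewrite gee0_abs// sharp_ge0.
Qed.

(** Level 0 is enough here: f - T_0 is controlled by the almost everywhere estimate, T_0 by the
    bound on its polynomials. *)
Lemma calderon_embedding_bounded_pos : exists2 D : R, 0 < D & forall f N,
  calderon k Omega p%:E f -> (calderon_norm k Omega p%:E f <= N%:E)%E -> 0 < N ->
  (Lp_norm E q (EFin \o f) <= (D * N)%:E)%E.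
Proof.
have [B EB] := bounded_set_coord.
have [c c0 density] := nset_density n0 Omega_open Omega_nset.
have [C C0 HC] := exists_local_approx k n0 mO.
have [theta [theta01 thn thy thr]] := admissible_theta n0 k0 p1 hq.
have q1 : (1 <= q)%E by case: hq.
have Efin := leb_bounded_lty mE EB.
have [C3 C30 HC3] := ae_sub_piecewise_le k0 mO c0 C0 density p1 mE EO EB theta01 thn.
have [M M0 HM] := local_approx_bounded k mO c0 C0 density p1 0.
have E0 : 0 <= fine (leb n E) by rewrite fine_ge0.
pose K := fine (leb n E) + 1; have K0 : 0 < K by rewrite ltr_wpDl.
exists (2 `^ p * K * C3 + K * M).
  by rewrite addr_gt0// !mulr_gt0// powR_gt0.
move=> f N Cf fN N0; have [mf mg fp gp] := calderon_class Cf fN N0.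
have [P HP] := HC f N mf N0.
pose T := piecewise (half 0) (P 0%N).
have mT : measurable_fun E T.
  by apply: measurable_funTS; apply: measurable_piecewise; exact: half_gt0.
have mEf : measurable_fun E f by exact: measurable_funS mf.
have -> : f = (f \- T) \+ T by apply/funext => x /=; rewrite subrK.
apply: le_trans (Lp_normD mE q1 _ mT) _; first exact: measurable_funB.
rewrite mulrDl EFinD; apply: leeD.
- rewrite -mulrA; apply: (Lp_norm_le_density_ratio mO p1 mE EO EB q1 thy thr mg N0 gp).
  + exact: measurable_funB.
  + by rewrite mulr_ge0// ltW.
  + by have := HC3 f N P mf mg N0 gp HP 0%N; rewrite expr0 mulr1.
- rewrite -mulrA; apply: Lp_norm_le_of_bound => //; first by rewrite mulr_ge0// ltW.
  move=> x Ex; apply: (HM f N (P 0%N) x x mf mg N0 fp gp (HP 0%N)) => //.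
  exact: EO.
Qed.

(** The norm of f may be 0, so the preceding bound is applied with N slightly above it, and the
    excess tends to 0. *)
Lemma calderon_embedding_bounded : exists D : R, forall f,
  calderon k Omega p%:E f ->
  (Lp_norm E q (EFin \o f) <= D%:E * calderon_norm k Omega p%:E f)%E.
Proof.
have [D D0 HD] := calderon_embedding_bounded_pos; exists D => f Cf.
have N0 : (0 <= calderon_norm k Omega p%:E f)%E by rewrite adde_ge0// Lp_norm_ge0.
have Nfin : calderon_norm k Omega p%:E f \is a fin_num.
  by rewrite ge0_fin_numE//; case: Cf => -[_ ?] [_ ?]; exact: lte_add_pinfty.
rewrite -(fineK Nfin) in N0 *; set N := fine _ in N0 *.
rewrite lee_fin in N0; rewrite -EFinM; apply/lee_addgt0Pr => e e0.
have De : 0 < e / D by rewrite divr_gt0.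
apply: le_trans (HD f (N + e / D) Cf _ _) _.
- by rewrite -(fineK Nfin) lee_fin lerDl ltW.
- by rewrite ltr_wpDl.
- by rewrite -EFinD lee_fin mulrDr mulrC [D * (e / D)]mulrC divfK// gt_eqF.
Qed.

(** The level J brings f - T_J and f' - T'_J below e / 4 each; then d = e / (2 K D) is fine enough
    for equal colours to cost at most e / 2. *)
Lemma calderon_embedding_totally_bounded N e : 0 < N -> 0 < e ->
  exists (I : finType) (col : ('rV[R]_n -> R) -> I), forall f f',
  calderon k Omega p%:E f -> (calderon_norm k Omega p%:E f <= N%:E)%E ->
  calderon k Omega p%:E f' -> (calderon_norm k Omega p%:E f' <= N%:E)%E ->
  col f = col f' -> (Lp_norm E q (EFin \o (f \- f')%R) <= e%:E)%E.
Proof.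
move=> N0 e0.
have [B EB] := bounded_set_coord.
have [c c0 density] := nset_density n0 Omega_open Omega_nset.
have [C C0 HC] := exists_local_approx k n0 mO.
have [theta [theta01 thn thy thr]] := admissible_theta n0 k0 p1 hq.
have q1 : (1 <= q)%E by case: hq.
have Efin := leb_bounded_lty mE EB.
have [C3 C30 HC3] := ae_sub_piecewise_le k0 mO c0 C0 density p1 mE EO EB theta01 thn.
have E0 : 0 <= fine (leb n E) by rewrite fine_ge0.
pose K := fine (leb n E) + 1; have K0 : 0 < K by rewrite ltr_wpDl.
set rho := 2^-1 `^ _ in HC3.
have rho1 : `|rho| < 1.
  rewrite ger0_norm ?powR_ge0//.
  apply: (@lt_le_trans _ _ (1 `^ (k%:R - theta * n%:R / p))); last by rewrite powR1.
  apply: gt0_ltr_powR; rewrite ?subr_gt0 ?nnegrE ?invr_ge0//.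
  by rewrite invf_lt1// ltr1n.
have rho0 : 0 <= rho by exact: powR_ge0.
pose A := 2 `^ p * K * (C3 * N); have A0 : 0 < A by rewrite !mulr_gt0// powR_gt0.
have [J HJ] : exists J, A * rho ^+ J <= e / 4.
  have eA : 0 < e / 4 / A by rewrite !divr_gt0.
  have /cvgrPdist_lt/(_ _ eA) := cvg_expr rho1.
  move=> [J _ /(_ J (leqnn J))]; rewrite /= sub0r normrN => /ltW H; exists J.
  by rewrite mulrC -ler_pdivlMr// (le_trans (ler_norm _)).
have [M M0 HM] := local_approx_bounded k mO c0 C0 density p1 J.
have [D D0 HD] := @piecewise_close_of_colour R n k k0 E B EB.
pose d := e / 2 / (K * D); have d0 : 0 < d by rewrite !divr_gt0// mulr_gt0.
pose L := (Num.trunc (M * N / d + 1)).+1.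
have HL : M * N / d + 1 <= L%:R by rewrite ltW// truncnS_gt.
(* The colour is defined on all functions, so a non-measurable one receives dummy polynomials. *)
have /choice[P HP] f : exists P : nat -> {ffun 'I_n -> int} -> mpoly n R,
    measurable_fun Omega f -> forall j, local_approx k Omega C f N (half j) (P j).
  have [mf|nmf] := pselect (measurable_fun Omega f).
    by have [P HP] := HC f N mf N0; exists P.
  by exists (fun _ _ => 0).
exists _, (fun f => grid_colour k (B * 2 ^ J) L (half J) d (P f J)) => f f' Cf fN Cf' f'N.
have [mf mg fp gp] := calderon_class Cf fN N0.
have [mf' mg' f'p g'p] := calderon_class Cf' f'N N0.
have {}HPf := HP f mf; have {}HPf' := HP f' mf'.
pose T := piecewise (half J) (P f J); pose T' := piecewise (half J) (P f' J).
move=> colE.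
have TT' : forall x, E x -> `|T x - T' x| <= D * d.
  apply: (HD J L d (M * N) _ _ d0 HL _ _ _ _ colE).
  - by move=> z; exact: (HPf J z).1.
  - by move=> z; exact: (HPf' J z).1.
  - move=> x y Ex xy; apply: (HM f N (P f J) x y mf mg N0 fp gp (HPf J)) => //.
    exact: EO.
  - move=> x y Ex xy; apply: (HM f' N (P f' J) x y mf' mg' N0 f'p g'p (HPf' J)) => //.
    exact: EO.
have mT Q : measurable_fun E (piecewise (half J) Q).
  by apply: measurable_funTS; apply: measurable_piecewise; exact: half_gt0.
have mEf : measurable_fun E f by exact: measurable_funS mf.
have mEf' : measurable_fun E f' by exact: measurable_funS mf'.
have near g (mg0 : measurable_fun Omega g) (Hg : measurable_fun Omega (sharp k Omega g))
    (gpg : (\int[leb n]_(y in Omega) sharp k Omega g y `^ p <= (N `^ p)%:E)%E) :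
    (Lp_norm E q (EFin \o (g \- piecewise (half J) (P g J))%R) <= (e / 4)%:E)%E.
  apply: (@le_trans _ _ (2 `^ p * K * (C3 * N * rho ^+ J))%:E).
    apply: (Lp_norm_le_density_ratio mO p1 mE EO EB q1 thy thr Hg N0 gpg).
    + by apply: measurable_funB => //; exact: measurable_funS mg0.
    + by rewrite !mulr_ge0 ?exprn_ge0// ltW.
    + exact: (HC3 g N (P g) mg0 Hg N0 gpg (HP g mg0) J).
  by rewrite lee_fin mulrA.
have -> : f \- f' = (f \- T) \+ ((T \- T') \+ (\- (f' \- T'))).
  by apply/funext => x /=; lra.
apply: le_trans (Lp_normD mE q1 _ _) _.
- by apply: measurable_funB => //; exact: mT.
- apply: measurable_funD; first by apply: measurable_funB; exact: mT.
  by apply: measurableT_comp => //; apply: measurable_funB => //; exact: mT.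
have -> : e = e / 4 + (K * (D * d) + e / 4).
  by rewrite /d mulrA mulrCA mulfV ?mulr1 ?gt_eqF ?mulr_gt0//; lra.
rewrite EFinD; apply: leeD; first exact: near.
apply: le_trans (Lp_normD mE q1 _ _) _.
- by apply: measurable_funB; exact: mT.
- by apply: measurableT_comp => //; apply: measurable_funB => //; exact: mT.
rewrite EFinD; apply: leeD.
- apply: Lp_norm_le_of_bound => //; first by rewrite mulr_ge0 ?(ltW D0) ?(ltW d0).
  by apply: measurable_funB; exact: mT.
- by rewrite Lp_normN; exact: near.
Qed.

End calderon_embedding.

(** * Cauchy subsequences from finite colourings *)

Section diagonal_subsequence.

(* Infinite pigeonhole principle applied successively to countably many
   finite colourings. *)
Lemma diagonal_monochromatic (I : nat -> finType) (col : forall i, nat -> I i) :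
  exists sigma : nat -> nat, {homo sigma : i j / (i < j)%N} /\
    forall i a b, (i <= a)%N -> (i <= b)%N -> col i (sigma a) = col i (sigma b).
Proof.
pose inf (S : set nat) := forall N, exists2 m, (N <= m)%N & S m.
have step i (S : {S : set nat | inf S}) :
    exists S' : {S : set nat | inf S}, sval S' `<=` sval S /\
      forall a b, sval S' a -> sval S' b -> col i a = col i b.
  (* If each colour occurred only below some bound in S, an element of S beyond all these bounds
     would have no colour. *)
  case: S => S infS /=; apply: contrapT => /forallNP H.
  have {}H (c : I i) : exists N, forall m, (N <= m)%N -> S m -> col i m <> c.
    apply: contrapT => /forallNP H1.
    have infc : inf (S `&` [set m | col i m = c]).
      move=> N; have /existsNP[m /not_implyP[Nm /not_implyP[Sm /contrapT cm]]] := H1 N.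
      by exists m.
    apply: (H (exist _ _ infc)); split=> /= [m []//|a b [_ ->] [_ ->]//].
  have [N HN] := choice H.
  have [m mN Sm] := infS (\max_c N c)%N.
  by apply: (HN (col i m) m) => //; apply: leq_trans mN; exact: leq_bigmax.
have infT : inf setT by move=> N; exists N.
have [next Hnext] := choice (fun iS : nat * {S : set nat | inf S} => step iS.1 iS.2).
pose fix S (i : nat) : {S : set nat | inf S} :=
  if i is j.+1 then next (j, S j) else exist _ _ infT.
have Sdec i j : (i <= j)%N -> sval (S j) `<=` sval (S i).
  move=> /subnK <-; elim: (j - i)%N => // m IH.
  by apply: subset_trans IH; exact: (Hnext (m + i, S (m + i))%N).1.
have pick_next (iN : nat * nat) : exists m, (iN.2 < m)%N /\ sval (S iN.1.+1) m.
  by have [m mN Sm] := proj2_sig (S iN.1.+1) iN.2.+1; exists m.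
have [pick Hpick] := choice pick_next.
(* The i-th term is taken in set number i + 1 and beyond its predecessor, so it also belongs to all
   earlier sets. *)
pose fix sigma (i : nat) : nat :=
  if i is j.+1 then pick (i, sigma j) else pick (0%N, 0%N).
have sS i : sval (S i.+1) (sigma i) by case: i => [|i]; exact: (Hpick (_, _)).2.
exists sigma; split.
  apply: homo_ltn => // [|i]; first exact: ltn_trans.
  exact: (Hpick (i.+1, sigma i)).1.
move=> i a b ia ib; apply: (Hnext (i, S i)).2.
  by apply: (Sdec i.+1 a.+1) => //; exact: sS.
by apply: (Sdec i.+1 b.+1) => //; exact: sS.
Qed.

Context {R : realType} {n : nat}.

(** Several distances are treated together, since in a Sobolev space all derivatives have to
    converge along one subsequence. The colouring for scale 2^-i is made constant from index i
    on. *)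
Lemma totally_bounded_cauchy_subsequence (J : finType)
    (dist : J -> nat -> nat -> \bar R) :
  (forall (al : J) (e : R), 0 < e -> exists (I : finType) (col : nat -> I),
    forall m m', col m = col m' -> (dist al m m' <= e%:E)%E) ->
  exists sigma : nat -> nat, {homo sigma : i j / (i < j)%N} /\
    forall al i a b, (i <= a)%N -> (i <= b)%N ->
      (dist al (sigma a) (sigma b) <= (2^-1 ^+ i)%:E)%E.
Proof.
move=> tb.
have tb1 (i : nat) (al : J) : exists Ic : {I : finType & nat -> I},
    forall m m', projT2 Ic m = projT2 Ic m' -> (dist al m m' <= (2^-1 ^+ i)%:E)%E.
  have [I [col H]] := tb al (2^-1 ^+ i) (half_gt0 i).
  by exists (existT _ I col).
have tb2 (i : nat) : exists Ic : {I : finType & nat -> I}, forall al,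
    forall m m', projT2 Ic m = projT2 Ic m' -> (dist al m m' <= (2^-1 ^+ i)%:E)%E.
  have [Ic HIc] := choice (tb1 i).
  (* The colour types vary with [al]; ranks embed them in one ordinal, so that their product is a
     finite type. *)
  pose N := (\max_al #|projT1 (Ic al)|)%N.
  pose col (m : nat) : {ffun J -> 'I_N.+1} :=
    [ffun al => inord (enum_rank (projT2 (Ic al) m))].
  exists (existT (fun I : finType => nat -> I) _ col) => al m m' /= /ffunP/(_ al).
  rewrite !ffunE => E; apply: HIc; apply: enum_rank_inj; apply: val_inj => /=.
  have bnd t : (enum_rank (projT2 (Ic al) t) < N.+1)%N.
    by rewrite ltnS (leq_trans (ltnW (ltn_ord _)))// leq_bigmax.
  by have := congr1 val E; rewrite /= !inordK.
have [Ic HIc] := choice tb2.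
have [sigma [smono Hs]] := diagonal_monochromatic (fun i => projT2 (Ic i)).
by exists sigma; split=> // al i a b ia ib; apply: HIc; exact: Hs.
Qed.

End diagonal_subsequence.

(** * Smooth bump functions and weak derivatives *)

Section flat_functions.
Context {R : realType}.
Implicit Types (P : {poly R}) (x : R).

(** The m-th power of t / (m + 1) <= exp (t / (m + 1)), whose right-hand side is at least 1, is
    bounded by its (m + 1)-st power exp t. *)
Lemma exprn_expRN_le m (t : R) : 0 < t -> t ^+ m * expR (- t) <= m.+1%:R ^+ m.
Proof.
move=> t0; rewrite expRN -ler_pdivlMr ?invr_gt0 ?expR_gt0// invrK.
have m0 : 0 < m.+1%:R :> R by [].
have -> : expR t = expR (m.+1%:R * (t / m.+1%:R)) by rewrite mulrC divfK ?gt_eqF.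
rewrite expRM_natl.
have lt1 : t / m.+1%:R <= expR (t / m.+1%:R).
  by rewrite (le_trans _ (expR_ge1Dx _))// lerDr.
have ge1 : 1 <= expR (t / m.+1%:R).
  by rewrite -expR0 ler_expR divr_ge0// ltW.
have -> : t ^+ m = m.+1%:R ^+ m * (t / m.+1%:R) ^+ m.
  by rewrite -exprMn mulrC divfK ?gt_eqF.
rewrite ler_wpM2l ?exprn_ge0 ?(ltW m0)//.
apply: le_trans (_ : expR (t / m.+1%:R) ^+ m <= _).
  by rewrite lerXn2r ?nnegrE ?expR_ge0// divr_ge0// ltW.
by rewrite ler_weXn2l.
Qed.

(** The classical exp(-1/x), with a polynomial in 1/x as a factor so that the family is closed under
    differentiation: P becomes X^2 (P - P'). *)
Definition flat P x : R := if 0 < x then P.[x^-1] * expR (- x^-1) else 0.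

(** Quadratic decay at 0 yields the derivative 0 there. The induction on P carries a power t^j,
    which each multiplication by X raises. *)
Lemma flat_bound P : exists2 C, 0 <= C & forall x, `|flat P x| <= C * x ^+ 2.
Proof.
have H j : exists2 C, 0 <= C & forall t, 0 < t -> `|P.[t]| * (t ^+ j * expR (- t)) <= C.
  elim/poly_ind: P j => [|P c IH] j.
    by exists 0 => // t _; rewrite horner0 normr0 mul0r.
  have [C C0 HC] := IH j.+1.
  exists (C + `|c| * j.+1%:R ^+ j).
    by rewrite addr_ge0// mulr_ge0// exprn_ge0.
  move=> t t0; rewrite hornerD hornerMX hornerC.
  have w0 : 0 <= t ^+ j * expR (- t) by rewrite mulr_ge0 ?expR_ge0 ?exprn_ge0 ?ltW.
  apply: le_trans (ler_wpM2r w0 (ler_normD _ _)) _; rewrite mulrDl lerD//.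
    by have := HC t t0; rewrite exprS normrM (gtr0_norm t0) !mulrA.
  by rewrite ler_wpM2l// exprn_expRN_le.
have [C C0 HC] := H 2%N; exists C => // x; rewrite /flat; case: ifPn => [x0|_]; last first.
  by rewrite normr0 mulr_ge0// sqr_ge0.
have := HC x^-1; rewrite invr_gt0 => /(_ x0).
rewrite exprVn mulrCA [_ * (_ * _)]mulrC -ler_pdivlMr ?invr_gt0 ?exprn_gt0// invrK.
by rewrite normrM (ger0_norm (expR_ge0 _)).
Qed.

Lemma is_derive_flat P x :
  is_derive x 1 (flat P) (flat ('X ^+ 2 * (P - P^`())) x).
Proof.
have [x0|x0|x0] := ltrgtP 0 x.
- apply: (@near_eq_is_derive _ _ _ (fun y : R => P.[y^-1] * expR (- y^-1))).
    by near=> y; rewrite /flat ifT//; near: y; exact: lt_nbhsr.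
  have xV : is_derive x 1 (fun y : R => y^-1) (- x ^- 2).
    have := @is_deriveV R id x 1 1; rewrite /= /GRing.scale/= mulr1; apply.
    by rewrite gt_eqF.
  have dP : is_derive x^-1 1 (horner P) P^`().[x^-1].
    by apply: DeriveDef; [exact: derivable_horner|rewrite derivE derive1E].
  have d1 := is_derive1_comp dP xV.
  have dN : is_derive x 1 (fun y : R => - y^-1) (x ^- 2).
    by apply: is_derive_eq (is_deriveN xV) _; rewrite opprK.
  have d2 := @is_derive1_comp R expR (fun y => - y^-1) x _ _ (is_derive_expR (- x^-1)) dN.
  apply: is_derive_eq (is_deriveM d1 d2) _.
  rewrite /flat x0 /GRing.scale/= hornerM hornerD hornerN hornerXn exprVn.
  move: (x ^- 2) (expR _) P.[_] P^`().[_] => u v a b; lra.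
- apply: (@near_eq_is_derive _ _ _ (cst 0)); last first.
    apply: is_derive_eq; rewrite /flat ltNge (ltW x0)//.
  near=> y; rewrite /flat ltNge ifF//; apply/negbTE; rewrite negbK ltW//; near: y.
  exact: lt_nbhsl.
- rewrite -x0 [X in is_derive _ _ _ X]/flat ltxx.
  have [C C0 HC] := flat_bound P.
  suff H : (fun h : R => h^-1 *: ((flat P \o shift 0) (h *: 1) - flat P 0)) @ 0^' --> (0 : R).
    by apply: DeriveDef; [apply/cvg_ex; exists 0|exact/cvg_lim].
  apply/cvgr0Pnorm_le => e e0; near=> h.
  have h0 : h != 0 by near: h; exact: nbhs_dnbhs_neq.
  rewrite /= /GRing.scale/= mulr1 addr0 {2}/flat ltxx subr0 normrM normfV.
  rewrite ler_pdivrMl ?normr_gt0//.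
  apply: le_trans (HC _) _; rewrite -real_normK ?num_real// expr2 mulrCA.
  rewrite ler_wpM2l//.
  have : `|h| <= e / (C + 1).
    by near: h; apply: dnbhs0_le; rewrite divr_gt0// ltr_wpDl.
  rewrite ler_pdivlMr ?ltr_wpDl//; apply: le_trans.
  by rewrite mulrDr mulr1 [C * _]mulrC lerDl.
Unshelve. all: by end_near.
Qed.

End flat_functions.

Section differentiability_classes.
Context {R : realType} {n : nat}.
Implicit Types (f g : 'rV[R]_n -> R) (i : 'I_n).

(** A recursive form of C^m: unlike the sequences of partials in [smooth], it lets the product rule
    be iterated by induction on m. *)
Fixpoint cdiff m f : Prop := continuous f /\
  if m is m'.+1 then
    forall i, (forall x, derivable f x (delta_mx ord0 i)) /\ cdiff m' (partial i f)
  else True.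

Lemma cdiff_continuous m f : cdiff m f -> continuous f.
Proof. by case: m => [|m] []. Qed.

Lemma cdiffW m f : cdiff m.+1 f -> cdiff m f.
Proof.
elim: m f => [|m IH] f [cf H]; first by split.
by split=> // i; have [df /IH] := H i.
Qed.

Lemma cdiff_cst m (c : R) : cdiff m (cst c : 'rV[R]_n -> R).
Proof.
elim: m c => [|m IH] c; split=> //; try exact: cst_continuous.
move=> i; split=> [x|]; first exact: derivable_cst.
rewrite (_ : partial i _ = cst 0)//.
by apply/funext => x; rewrite /partial derive_cst.
Qed.

Lemma cdiffD m f g : cdiff m f -> cdiff m g -> cdiff m (fun x => f x + g x).
Proof.
elim: m f g => [|m IH] f g [cf Hf] [cg Hg].
  by split=> // x; apply: continuousD; [exact: cf|exact: cg].
split=> [x|i]; first by apply: continuousD; [exact: cf|exact: cg].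
have [[df Cf] [dg Cg]] := (Hf i, Hg i).
split=> [x|]; first exact: derivableD.
rewrite (_ : partial i _ = fun x => partial i f x + partial i g x); first exact: IH.
by apply/funext => x; rewrite /partial deriveD.
Qed.

Lemma cdiffM m f g : cdiff m f -> cdiff m g -> cdiff m (fun x => f x * g x).
Proof.
elim: m f g => [|m IH] f g.
  by move=> [cf Hf] [cg Hg]; split=> // x; apply: continuousM; [exact: cf|exact: cg].
move=> Cf1 Cg1; have [[cf Hf] [cg Hg]] := (Cf1, Cg1).
split=> [x|i]; first by apply: continuousM; [exact: cf|exact: cg].
have [[df Cf] [dg Cg]] := (Hf i, Hg i).
split=> [x|]; first exact: derivableM.
rewrite (_ : partial i _ = fun x => f x * partial i g x + g x * partial i f x).
  by apply: cdiffD; apply: IH => //; exact: cdiffW.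
by apply/funext => x; rewrite /partial deriveM.
Qed.

Lemma cdiff_prod m (I : Type) (s : seq I) (F : I -> 'rV[R]_n -> R) :
  (forall j, cdiff m (F j)) -> cdiff m (fun x => \prod_(j <- s) F j x).
Proof.
move=> CF; elim: s => [|j s IH].
  rewrite (_ : (fun _ => _) = cst 1); first exact: cdiff_cst.
  by apply/funext => x; rewrite big_nil.
rewrite (_ : (fun _ => _) = (fun x => F j x * \prod_(j <- s) F j x)); first exact: cdiffM.
by apply/funext => x; rewrite big_cons.
Qed.

Lemma smooth_cdiff f : (forall m, cdiff m f) -> smooth f.
Proof.
move=> Cf s; have {Cf} Cs m : cdiff m (partials s f).
  by elim: s m => [|i s IH] m; [exact: Cf|have [_ /(_ i)[]] := IH m.+1].
by split=> [|i x]; [exact: cdiff_continuous (Cs 0%N)|have [_ /(_ i)[]] := Cs 1%N].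
Qed.

Lemma is_derive_coord (h : R -> R) (j i : 'I_n) (x : 'rV[R]_n) (d : R) :
  is_derive (x ord0 j) 1 h d ->
  is_derive x (delta_mx ord0 i) (fun y => h (y ord0 j)) (d *+ (j == i)).
Proof.
move=> [dh eh].
have E : (fun t : R => t^-1 *: (((fun y : 'rV[R]_n => h (y ord0 j)) \o shift x)
      (t *: delta_mx ord0 i) - h (x ord0 j))) =
    if j == i then (fun t : R => t^-1 *: ((h \o shift (x ord0 j)) (t *: (1 : R)) - h (x ord0 j)))
    else cst 0.
  case: ifPn => [ji|/negbTE ji]; apply/funext => t; rewrite /= !mxE /= ji.
    by rewrite /GRing.scale.
  by rewrite mulr0 add0r subrr scaler0.
case: (j == i) E => E.
  by split; rewrite /derivable /derive E.
have H : (cst 0 : R -> R) @ 0^' --> (0 : R) by exact: cvg_cst.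
by split; rewrite /derivable /derive E; [apply/cvg_ex; exists 0|exact/cvg_lim].
Qed.

Lemma is_derive_affine (h : R -> R) (a b t d : R) : is_derive (a * t + b) 1 h d ->
  is_derive t 1 (fun s => h (a * s + b)) (d * a).
Proof.
move=> dh; have daff : is_derive t 1 (fun s : R => a * s + b) a.
  apply: is_derive_eq (is_deriveD (is_deriveZ a (is_derive_id t 1)) (is_derive_cst b t 1)) _.
  by rewrite addr0 /GRing.scale/= mulr1.
exact: (@is_derive1_comp R h (fun s => a * s + b) t _ _ dh daff).
Qed.

Lemma cdiff_flat m (P : {poly R}) (a b : R) (j : 'I_n) :
  cdiff m (fun x => flat P (a * x ord0 j + b)).
Proof.
have dcoord Q i x : is_derive x (delta_mx ord0 i)
    (fun y : 'rV[R]_n => flat Q (a * y ord0 j + b))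
    ((flat ('X ^+ 2 * (Q - Q^`())) (a * x ord0 j + b) * a) *+ (j == i)).
  apply: (is_derive_coord (h := fun t => flat Q (a * t + b))).
  by apply: is_derive_affine; exact: is_derive_flat.
have cfl Q : continuous (flat Q).
  by move=> t; apply/differentiable_continuous/derivable1_diffP; have [] := is_derive_flat Q t.
have cQ Q : continuous (fun x : 'rV[R]_n => flat Q (a * x ord0 j + b)).
  move=> x; apply: (@continuous_comp _ _ _ (fun y : 'rV[R]_n => a * y ord0 j + b) (flat Q));
    last exact: cfl.
  apply: continuousD; last exact: cst_continuous.
  by apply: continuousM; [exact: cst_continuous|exact: coord_continuous].
elim: m P => [|m IH] P; split=> // i; split=> [x|]; first by have [] := dcoord P i x.
rewrite (_ : partial i _ = fun x => flat ('X ^+ 2 * (P - P^`())) (a * x ord0 j + b) * (a *+ (j == i))).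
  by apply: cdiffM; [exact: IH|exact: cdiff_cst].
by apply/funext => x; rewrite /partial; have [_ ->] := dcoord P i x; rewrite mulrnAr.
Qed.

End differentiability_classes.

Section fundamental_lemma.
Context {R : realType} {n : nat}.
Implicit Types (a b x : 'rV[R]_n) (Omega U : set 'rV[R]_n) (g : 'rV[R]_n -> R).

Definition open_box a b := [set x : 'rV[R]_n | forall i, a ord0 i < x ord0 i < b ord0 i].

Definition closed_box a b := [set x : 'rV[R]_n | forall i, a ord0 i <= x ord0 i <= b ord0 i].

Lemma open_box_sub_closed_box a b : open_box a b `<=` closed_box a b.
Proof. by move=> x H i; have /andP[/ltW -> /ltW ->] := H i. Qed.

Lemma compact_closed_box a b : compact (closed_box a b).
Proof.
rewrite (_ : closed_box a b = [set x : 'rV[R]_n | forall i,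
    `[a ord0 i, b ord0 i]%classic (x ord0 i)]).
  by apply: (rV_compact (A := fun i => `[a ord0 i, b ord0 i]%classic)) => i; exact: segment_compact.
by apply/seteqP; split=> x H i; have := H i; rewrite /= in_itv.
Qed.

Lemma measurable_open_box a b : measurable (open_box a b).
Proof.
rewrite (_ : open_box a b = [set x : 'rV[R]_n | forall i,
    `]a ord0 i, b ord0 i[%classic (x ord0 i)]).
  by apply: (measurable_row_forall (P := fun i => `]a ord0 i, b ord0 i[%classic)) => i; exact: measurable_itv.
by apply/seteqP; split=> x H i; have := H i; rewrite /= in_itv.
Qed.

Lemma open_boxI a b a' b' : open_box a b `&` open_box a' b' =
  open_box (\row_i Num.max (a ord0 i) (a' ord0 i)) (\row_i Num.min (b ord0 i) (b' ord0 i)).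
Proof.
apply/seteqP; split=> [x [H H'] i|x H].
  by rewrite !mxE gt_max lt_min; have /andP[-> ->] := H i; have /andP[-> ->] := H' i.
by split=> i; have := H i; rewrite !mxE gt_max lt_min => /andP[/andP[h1 h2] /andP[h3 h4]]; apply/andP.
Qed.

Lemma exists_rat_box U x : open U -> U x -> exists t : 'rV[rat]_n * 'rV[rat]_n,
  open_box (map_mx ratr t.1) (map_mx ratr t.2) x /\
  closed_box (map_mx ratr t.1) (map_mx ratr t.2) `<=` U.
Proof.
move=> oU Ux; have : nbhs x U by exact: open_nbhs_nbhs.
rewrite -nbhs_ballE => -[e /= e0 eU].
have lo (i : 'I_n) : exists q : rat, x ord0 i - e < ratr q < x ord0 i.
  have /rat_in_itvoo[q] : x ord0 i - e < x ord0 i by rewrite gtrBl.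
  by rewrite in_itv/=; exists q.
have hi (i : 'I_n) : exists q : rat, x ord0 i < ratr q < x ord0 i + e.
  have /rat_in_itvoo[q] : x ord0 i < x ord0 i + e by rewrite ltrDl.
  by rewrite in_itv/=; exists q.
have [lo_ Hlo] := choice lo; have [hi_ Hhi] := choice hi.
exists (\row_i lo_ i, \row_i hi_ i); split=> [i|y H]; rewrite /=.
  by rewrite !mxE; have /andP[_ ->] := Hlo i; have /andP[-> _] := Hhi i.
apply: eU; split=> // k i; rewrite (ord1 k) /ball/=.
have := H i; rewrite !mxE /= => /andP[h1 h2].
have /andP[h3 _] := Hlo i; have /andP[_ h4] := Hhi i.
by rewrite ltr_norml; apply/andP; split; lra.
Qed.

(** Smooth approximations of the indicator of the open box from inside: a factor exp(-1/((m + 1) t))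
    tends to 1 for t > 0. The scale is m + 1 because scale 0 would make all factors vanish. *)
Definition bump (m : nat) a b x : R :=
  \prod_i (flat 1 (m.+1%:R * x ord0 i + - (m.+1%:R * a ord0 i)) *
           flat 1 (- m.+1%:R * x ord0 i + m.+1%:R * b ord0 i)).

Lemma flat1_le1 (t : R) : 0 <= flat 1 t <= 1.
Proof.
rewrite /flat; case: ifPn => [t0|_]; last by rewrite lexx ler01.
by rewrite hornerC mul1r expR_ge0 -expR0 ler_expR oppr_le0 invr_ge0 ltW.
Qed.

Lemma flat1_cvg1 (t : R) : 0 < t -> flat 1 (m.+1%:R * t) @[m --> \oo] --> (1 : R).
Proof.
move=> t0; rewrite (_ : (fun m => _) = (fun m => expR (- t^-1 * m.+1%:R^-1))); last first.
  by apply/funext => m; rewrite /flat mulr_gt0// hornerC mul1r invfM mulrC mulNr.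
rewrite -[X in _ --> X]expR0 -(mulr0 (- t^-1)); apply: continuous_cvg.
  exact: continuous_expR.
by apply: cvgMr; exact: cvg_harmonic.
Qed.

Lemma bump_eq0 m a b x : ~ open_box a b x -> bump m a b x = 0.
Proof.
move=> /existsNP[i /negP]; rewrite negb_and -!leNgt => H.
rewrite /bump (bigD1 i)//= {1 2}/flat.
have m0 : 0 < m.+1%:R :> R by [].
by case/orP: H => H; [rewrite ifF ?mul0r//|rewrite [X in _ * X * _]ifF ?mulr0 ?mul0r//];
  apply/negbTE; rewrite -leNgt ?mulNr -?mulrBr ?[- _ + _]addrC -?mulrBr pmulr_rle0 ?subr_le0.
Qed.

Lemma bump_norm_le1 m a b x : `|bump m a b x| <= 1.
Proof.
have H i : 0 <= flat 1 (m.+1%:R * x ord0 i + - (m.+1%:R * a ord0 i)) *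
           flat 1 (- m.+1%:R * x ord0 i + m.+1%:R * b ord0 i) <= 1.
  have /andP[h1 h2] := flat1_le1 (m.+1%:R * x ord0 i + - (m.+1%:R * a ord0 i)).
  have /andP[h3 h4] := flat1_le1 (- m.+1%:R * x ord0 i + m.+1%:R * b ord0 i).
  by rewrite mulr_ge0//= mulr_ile1.
rewrite ger0_norm ?prodr_ge0// => [|i _]; last by have /andP[] := H i.
by apply: prodr_ile1 => i _.
Qed.

Lemma bump_cvg1 a b x : open_box a b x -> bump m a b x @[m --> \oo] --> (1 : R).
Proof.
move=> H; have -> : 1 = \prod_(i < n) (1 * 1 : R) by rewrite big1// => i _; rewrite mulr1.
apply: (@cvg_big _ _ _ _ xpredT) => [|i _]; first exact: mul_continuous.
have /andP[h1 h2] := H i; apply: cvgM.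
  rewrite (_ : (fun m => _) = (fun m => flat 1 (m.+1%:R * (x ord0 i - a ord0 i)))).
    by apply: flat1_cvg1; rewrite subr_gt0.
  by apply/funext => m; rewrite mulrBr.
rewrite (_ : (fun m => _) = (fun m => flat 1 (m.+1%:R * (b ord0 i - x ord0 i)))).
  by apply: flat1_cvg1; rewrite subr_gt0.
by apply/funext => m; rewrite mulrBr mulNr addrC.
Qed.

Lemma smooth_bump m a b : smooth (bump m a b).
Proof.
by apply: smooth_cdiff => k; apply: cdiff_prod => i; apply: cdiffM; exact: cdiff_flat.
Qed.

Lemma test_function_bump m a b Omega : closed_box a b `<=` Omega ->
  test_function Omega (bump m a b).
Proof.
move=> abO; have cl : closed (closed_box a b).
  by apply: compact_closed; [exact: norm_hausdorff|exact: compact_closed_box].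
have sub : closure [set x | bump m a b x != 0] `<=` closed_box a b.
  apply: subset_trans (_ : closure (closed_box a b) `<=` _); last by rewrite -(closure_id _).1.
  apply: closure_subset => x /= /eqP; apply: contra_notP => nx; apply: bump_eq0.
  by apply: contra_not nx; exact: open_box_sub_closed_box.
split; first exact: smooth_bump.
  by apply: subclosed_compact sub; [exact: closed_closure|exact: compact_closed_box].
exact: subset_trans sub abO.
Qed.

Lemma compact_measurable_row (K : set 'rV[R]_n) : compact K -> measurable K.
Proof.
move=> cK; rewrite -[K]setCK; apply: measurableC; apply: open_measurable_row.
by apply: closed_openC; apply: compact_closed cK; exact: norm_hausdorff.
Qed.

Lemma loc_integrable_sub_compact Omega K A g : open Omega -> loc_integrable Omega g ->
  compact K -> K `<=` Omega -> measurable A -> A `<=` K -> (leb n).-integrable A (EFin \o g).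
Proof.
move=> oO [mg gK] cK KO mA AK; have mO := open_measurable_row oO.
apply/integrableP; split.
  by apply/measurable_EFinP; apply: measurable_funS mg => //; exact: subset_trans KO.
apply: le_lt_trans (gK _ cK KO); apply: ge0_subset_integral => //.
  exact: compact_measurable_row.
apply/measurable_EFinP; apply: measurableT_comp => //.
exact: measurable_funS mg.
Qed.

(** Dominated convergence along the bumps; the dominating |g| is integrable on the compact closed
    box. *)
Lemma integral_open_box_eq0 Omega g a b : open Omega -> loc_integrable Omega g ->
  (forall phi, test_function Omega phi -> (\int[leb n]_(x in Omega) (g x * phi x)%:E = 0)%E) ->
  closed_box a b `<=` Omega -> (\int[leb n]_(x in open_box a b) (g x)%:E = 0)%E.
Proof.
move=> oO lg H abO; have [mg _] := lg; have mO := open_measurable_row oO; have mB := measurable_open_box a b.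
have BO : open_box a b `<=` Omega by apply: subset_trans abO; exact: open_box_sub_closed_box.
have mgB : measurable_fun (open_box a b) g by apply: measurable_funS mg.
have mbump m : measurable_fun (open_box a b) (bump m a b).
  apply: measurable_funTS; apply: measurable_continuous_row.
  by have [] := smooth_bump m a b [::].
have ig : (leb n).-integrable (open_box a b) (EFin \o g).
  by apply: (loc_integrable_sub_compact oO lg (@compact_closed_box a b)) => //;
    exact: open_box_sub_closed_box.
have E m : (\int[leb n]_(x in open_box a b) (g x * bump m a b x)%:E = 0)%E.
  rewrite -(H _ (test_function_bump m abO)) -[X in integral _ X _](setIidr BO) integral_mkcondr.
  apply: eq_integral => x xO; rewrite patchE; case: ifPn => // /negP.
  by rewrite inE => nB; rewrite bump_eq0// mulr0.
have [|||||_ _] := @dominated_convergence _ _ _ (leb n) _ mB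
  (fun m x => (g x * bump m a b x)%:E) (EFin \o g) (abse \o (EFin \o g)).
- by move=> m; apply/measurable_EFinP; exact: measurable_funM.
- exact/measurable_EFinP.
- apply: aeW => x /= Bx; apply/cvg_EFin; first exact: nearW.
  by rewrite -[X in _ --> X]mulr1; apply: cvgMr; exact: bump_cvg1.
- exact: integrable_abse.
- apply: aeW => x /= m Bx; rewrite lee_fin normrM.
  by rewrite ler_piMr// bump_norm_le1.
- rewrite (_ : [sequence _]_m = cst 0%E); last by apply/funext => m; exact: E.
  by move/cvg_lim => <- //; rewrite lim_cst.
Qed.

(** Every open set is a countable union of open boxes with rational corners. *)
Lemma boxes_generate : @measurable _ 'rV[R]_n `<=`
  <<s [set A | exists a b, A = open_box a b] >>.
Proof.
apply: smallest_sub => [|U oU]; first exact: smallest_sigma_algebra.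
pose C (t : 'rV[rat]_n * 'rV[rat]_n) := [set x : 'rV[R]_n |
  open_box (map_mx ratr t.1) (map_mx ratr t.2) x /\
  open_box (map_mx ratr t.1 : 'rV[R]_n) (map_mx ratr t.2) `<=` U].
have -> : U = \bigcup_t C t.
  apply/seteqP; split=> [x Ux|x [t _ [Bx /(_ _ Bx)]]//].
  have [t [tx tU]] := exists_rat_box oU Ux.
  by exists t => //; split=> //; apply: subset_trans tU; exact: open_box_sub_closed_box.
apply: (@countable_bigcupT_measurable _
  (g_sigma_algebraType [set A : set 'rV[R]_n | exists a b, A = open_box a b])).
  by [].
move=> t; have [BU|BU] := pselect (open_box (map_mx ratr t.1 : 'rV[R]_n) (map_mx ratr t.2) `<=` U).
  have -> : C t = open_box (map_mx ratr t.1) (map_mx ratr t.2) by apply/seteqP; split=> [z []|z].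
  by apply: sub_sigma_algebra; exists (map_mx ratr t.1), (map_mx ratr t.2).
by have -> : C t = set0 by apply/seteqP; split=> [z []|z].
Qed.

(* On a box, the sets over which g has integral 0 form a Dynkin system that
   contains the boxes; these generate the Borel sets. *)
Lemma ae_eq0_of_test_functions Omega g : open Omega -> loc_integrable Omega g ->
  (forall phi, test_function Omega phi -> (\int[leb n]_(x in Omega) (g x * phi x)%:E = 0)%E) ->
  {ae leb n, forall x, Omega x -> g x = 0}.
Proof.
move=> oO lg H; have mO := open_measurable_row oO.
pose B (t : 'rV[rat]_n * 'rV[rat]_n) : set 'rV[R]_n :=
  open_box (map_mx ratr t.1) (map_mx ratr t.2).
pose good (t : 'rV[rat]_n * 'rV[rat]_n) :=
  closed_box (map_mx ratr t.1 : 'rV[R]_n) (map_mx ratr t.2) `<=` Omega.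
have aeB t : good t -> {ae leb n, forall x, B t x -> g x = 0}.
  move=> gt; have mB : measurable (B t) by exact: measurable_open_box.
  have ig : (leb n).-integrable (B t) (EFin \o g).
    apply: (loc_integrable_sub_compact oO lg (@compact_closed_box _ _) gt) => //.
    exact: open_box_sub_closed_box.
  have igS C : measurable C -> C `<=` B t -> (leb n).-integrable C (EFin \o g).
    by move=> mC CB; apply: integrableS ig.
  pose S := [set A : set 'rV[R]_n | measurable A /\
    (\int[leb n]_(x in A `&` B t) (g x)%:E = 0)%E].
  have box0 a b : (\int[leb n]_(x in open_box a b `&` B t) (g x)%:E = 0)%E.
    rewrite open_boxI; apply: integral_open_box_eq0 oO lg H _.
    apply: subset_trans gt => x Hx i; have := Hx i; rewrite !mxE.
    by rewrite ge_max le_min => /andP[/andP[_ h1] /andP[_ h2]]; apply/andP.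
  have dynS : dynkin S.
    split.
    - split=> //; rewrite setTI; have := box0 (map_mx ratr t.1) (map_mx ratr t.2).
      by rewrite setIid.
    - move=> A [mA A0]; split; first exact: measurableC.
      have : (\int[leb n]_(x in (A `&` B t) `|` (~` A `&` B t)) (g x)%:E = 0)%E.
        rewrite -setIUl setUv setTI; have := box0 (map_mx ratr t.1) (map_mx ratr t.2).
        by rewrite setIid.
      rewrite integral_setU ?A0 ?add0e//.
      + exact: measurableI.
      + by apply: measurableI => //; exact: measurableC.
      + apply: (measurable_int (leb n)); apply: igS.
          by apply: measurableU; apply: measurableI => //; exact: measurableC.
        by rewrite -setIUl setUv setTI.
      + by apply/disj_setPS => x [[Ax _] [nAx _]].
    - move=> F tF HF; have mF k : measurable (F k) by have [] := HF k.
      split; first exact: bigcup_measurable.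
      rewrite setI_bigcupl integral_bigcup.
      + by rewrite eseries0// => k _ _; have [_ ->] := HF k.
      + by apply: trivIset_setIr.
      + by move=> k; apply: measurableI.
      + apply: igS; first by apply: bigcup_measurable => k _; apply: measurableI.
        by move=> x [k _ []].
  have all0 A : measurable A -> (\int[leb n]_(x in A `&` B t) (g x)%:E = 0)%E.
    move=> /boxes_generate; rewrite -setI_closed_g_dynkin_g_sigma_algebra.
      move=> HA; have [] : S A by apply: HA; split => // _ [a [b ->]]; split;
        [exact: measurable_open_box|exact: box0].
      by [].
    by move=> _ _ [a [b ->]] [a' [b' ->]]; rewrite open_boxI; do 2 eexists.
  have := @integral_ae_eq _ _ _ (leb n) _ mB (cst 0%E) (EFin \o g) ig _ _.
  move=> /(_ _ _)[]//.
    move=> C CB mC; rewrite integral_cst// mul0e -[RHS](all0 _ mC).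
    by rewrite (setIidl CB).
  by move=> N [mN N0 sN]; exists N; split=> // x Hx; apply: sN => /= K; apply: Hx => /K [].
(* Only countably many null sets are merged: the boxes with rational corners whose closures lie in
   Omega already cover it. *)
have : {ae leb n, forall x k, forall t, unpickle k = Some t -> good t -> B t x -> g x = 0}.
  apply: ae_foralln => k; case: (unpickle k) => [t|]; last by apply: aeW.
  have [gt|ngt] := pselect (good t).
    by apply: filterS (aeB _ gt) => x Hx _ [<-] _; exact: Hx.
  by apply: aeW => x _ [<-] /ngt.
apply: filterS => x Hx Ox; have [t [tx tO]] := exists_rat_box oO Ox.
by apply: (Hx (pickle t) t) => //; rewrite pickleK.
Qed.

End fundamental_lemma.

(** * Symmetry of mixed partial derivatives *)

Section partial_derivatives.
Import -(notations) mpoly.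
Context {R : realType} {n : nat}.
Implicit Types (f g phi : 'rV[R]_n -> R) (alpha beta : multinom n) (i j : 'I_n) (x : 'rV[R]_n).

Lemma is_derive_line f (z v : 'rV[R]_n) (s : R) : derivable f (z + s *: v) v ->
  is_derive s 1 (fun t : R => f (z + t *: v)) ('D_v f (z + s *: v)).
Proof.
move=> df.
have E : (fun h : R => h^-1 *: (((fun t : R => f (z + t *: v)) \o shift s) (h *: 1) - f (z + s *: v))) =
    (fun h : R => h^-1 *: ((f \o shift (z + s *: v)) (h *: v) - f (z + s *: v))).
  apply/funext => h /=; congr (_ *: (f _ - _)).
  by rewrite (_ : h%:A = h) ?scalerDl 1?addrCA// /GRing.scale/= mulr1.
by split; rewrite /derivable /derive E.
Qed.

(** The mean value theorem in direction i, then in direction j. The second difference is symmetric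
    in i and j, so letting h tend to 0 will identify the two mixed partials. *)
Lemma second_difference_mean_value f i j x (h : R) : smooth f -> 0 < h ->
  exists y, ball x (3 * h) y /\
    f (x + h *: delta_mx ord0 i + h *: delta_mx ord0 j) - f (x + h *: delta_mx ord0 i)
    - f (x + h *: delta_mx ord0 j) + f x = h ^+ 2 * partial j (partial i f) y.
Proof.
move=> sf h0.
set ei : 'rV[R]_n := delta_mx ord0 i; set ej : 'rV[R]_n := delta_mx ord0 j.
have mvt (F dF : R -> R) : (forall t : R, is_derive t 1 F (dF t)) ->
    exists2 c, c \in `]0, h[ & F h - F 0 = dF c * h.
  move=> dFt; have cF : continuous F.
    by move=> t; apply/differentiable_continuous/derivable1_diffP; have [] := dFt t.
  have [c ch Ec] := @MVT R F dF 0 h h0 (fun t _ => dFt t) (continuous_subspaceT cF).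
  by exists c => //; rewrite Ec subr0.
have dfi z v : derivable f z (delta_mx ord0 v) by have [_] := sf [::].
have dfij z v : derivable (partial i f) z (delta_mx ord0 v) by have [_] := sf [:: i].
have [s] := mvt (fun s : R => f (x + h *: ej + s *: ei) - f (x + s *: ei))
  (fun s : R => partial i f (x + h *: ej + s *: ei) - partial i f (x + s *: ei))
  (fun s => is_deriveB (is_derive_line (dfi (x + h *: ej + s *: ei) i)) (is_derive_line (dfi (x + s *: ei) i))).
rewrite in_itv/= => /andP[s0 sh] Es.
have [t] := mvt (fun t : R => partial i f (x + s *: ei + t *: ej))
  (fun t : R => partial j (partial i f) (x + s *: ei + t *: ej))
  (fun t => is_derive_line (dfij (x + s *: ei + t *: ej) j)).
rewrite in_itv/= => /andP[t0 th] Et.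
exists (x + s *: ei + t *: ej); split.
  split; first by rewrite mulr_gt0.
  move=> k l; rewrite (ord1 k) /ball/= !mxE /= -addrA opprD addrA subrr add0r normrN.
  apply: le_lt_trans (ler_normD _ _) _.
  rewrite !normrM !ger0_norm ?ler0n ?(ltW s0) ?(ltW t0)//.
  apply: (@le_lt_trans _ _ (h + h)); last by lra.
  have b1 (b : bool) (w : R) : 0 < w -> w < h -> w * b%:R <= h.
    by move=> w0 wh; case: b; rewrite ?mulr1 ?mulr0 ltW.
  by rewrite lerD// b1.
move: Es Et; rewrite !scale0r !addr0 -[x + h *: ej + s *: ei]addrAC => Es Et.
rewrite -[x + h *: ej + h *: ei]addrAC in Es.
rewrite expr2 -mulrA [h * partial _ _ _]mulrC -Et [h * _]mulrC -Es; lra.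
Qed.

Lemma partialC f i j : smooth f -> partial i (partial j f) = partial j (partial i f).
Proof.
move=> sf; apply/funext => x; apply/eqP; rewrite -subr_eq0 -normr_le0.
apply/ler_addgt0Pl => e e0; rewrite addr0.
have e2 : 0 < e / 2 by rewrite divr_gt0.
have cont u v : continuous (partial u (partial v f)) by have [] := sf [:: u; v].
have near_ u v : \forall y \near x, `|partial u (partial v f) x - partial u (partial v f) y| < e / 2.
  by have /cvgrPdist_lt/(_ _ e2) := cont u v x.
have : nbhs x [set y | `|partial i (partial j f) x - partial i (partial j f) y| < e / 2 /\
                `|partial j (partial i f) x - partial j (partial i f) y| < e / 2].
  exact: filterI (near_ i j) (near_ j i).
rewrite -nbhs_ballE => -[d /= d0 dP].
have h0 : 0 < d / 3 by rewrite divr_gt0.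
have hd : 3 * (d / 3) = d by lra.
have [y [xy Ey]] := second_difference_mean_value i j x sf h0.
have [z [xz Ez]] := second_difference_mean_value j i x sf h0.
rewrite hd in xy xz.
have yz : partial i (partial j f) z = partial j (partial i f) y.
  have h2 : (d / 3) ^+ 2 != 0 by rewrite gt_eqF// exprn_gt0.
  apply: (mulfI h2); rewrite -Ey -Ez [X in f X - _](addrAC x); lra.
have [_ H1] := dP _ xy; have [H2 _] := dP _ xz; rewrite yz in H2.
move: H1 H2; move: (partial i _ x) (partial j _ x) (partial j _ y) => u v w.
rewrite !ltr_norml ler_norml => /andP[h1 h2] /andP[h3 h4].
clear -h1 h2 h3 h4; by apply/andP; split; lra.
Qed.

Lemma partials_cat s t f : partials (s ++ t) f = partials s (partials t f).
Proof. by rewrite /partials foldr_cat. Qed.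

Lemma smooth_partials s f : smooth f -> smooth (partials s f).
Proof. by move=> sf t; rewrite -partials_cat; exact: sf. Qed.

Lemma perm_partials s t f : smooth f -> perm_eq s t -> partials s f = partials t f.
Proof.
move=> sf; have move_front i r1 r2 : partials (r1 ++ i :: r2) f = partials (i :: r1 ++ r2) f.
  elim: r1 => //= j r1 ->; rewrite partialC//; exact: smooth_partials.
apply: (catCA_perm_subst (F := fun r => partials r f)) => r1 r2 r3.
elim: r1 => //= i r1 ->; exact: esym (move_front _ _ _).
Qed.

Definition mseq alpha : seq 'I_n :=
  flatten [seq nseq (alpha i) i | i <- enum 'I_n].

Lemma mderivE alpha f : Defs.mderiv alpha f = partials (mseq alpha) f.
Proof.
rewrite /Defs.mderiv /mseq /partials; elim: (enum 'I_n) => //= i s ->.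
by rewrite foldr_cat; elim: (alpha i) => //= m ->.
Qed.

Lemma count_mseq alpha i : count_mem i (mseq alpha) = alpha i.
Proof.
rewrite /mseq count_flatten -map_comp sumnE big_map big_enum/= (bigD1 i)//= count_nseq/= eqxx mul1n.
by rewrite big1 ?addn0// => j ji; rewrite count_nseq/= (negbTE ji).
Qed.

(** Both sides apply each partial equally often but in different orders, as [mderiv] fixes an order;
    symmetry reconciles them. *)
Lemma mderivD alpha beta f : smooth f ->
  Defs.mderiv (mnm_add alpha beta) f = Defs.mderiv alpha (Defs.mderiv beta f).
Proof.
move=> sf; rewrite !mderivE -partials_cat; apply: perm_partials => //.
by apply/allP => i _; rewrite /= count_cat !count_mseq mnmDE.
Qed.

End partial_derivatives.

(** * Test functions and weak derivatives *)

Section test_functions.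
Context {R : realType} {n : nat}.
Implicit Types (Omega E : set 'rV[R]_n) (f g h phi : 'rV[R]_n -> R)
  (alpha beta : mpoly.multinom n).

Lemma test_functionS Omega Omega' phi : Omega' `<=` Omega ->
  test_function Omega' phi -> test_function Omega phi.
Proof. by move=> OO [sphi cphi phiO]; split=> //; exact: subset_trans OO. Qed.

Lemma test_function_eq0 Omega phi x : test_function Omega phi -> ~ Omega x -> phi x = 0.
Proof.
move=> [_ _ phiO] nO; apply: contra_notP nO => /eqP phix; apply: phiO.
exact: subset_closure.
Qed.

(** Off its support phi vanishes in a neighbourhood, hence so do its partials. *)
Lemma test_function_partial Omega phi i : test_function Omega phi ->
  test_function Omega (partial i phi).
Proof.
move=> [sphi cphi phiO].
have sub : closure [set x | partial i phi x != 0] `<=` closure [set x | phi x != 0].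
  rewrite [X in _ `<=` X](closure_id _).1; last exact: closed_closure.
  apply: closure_subset => x /= /eqP; apply: contra_notP => nx.
  have near0 : \near x, cst 0 x = phi x.
    have oC : open (~` closure [set x | phi x != 0]) by rewrite openC; exact: closed_closure.
    have /filterS : nbhs x (~` closure [set x | phi x != 0]) by exact: open_nbhs_nbhs.
    apply=> y /= ny; apply/esym/eqP; apply: contra_notT ny => phiy; exact: subset_closure.
  have [_ E] := near_eq_is_derive near0 (is_derive_cst (0 : R) x (delta_mx ord0 i : 'rV[R]_n)).
  by rewrite /partial E.
split; first exact: (smooth_partials [:: i] sphi).
  by apply: subclosed_compact sub => //; exact: closed_closure.
exact: subset_trans sub phiO.
Qed.

Lemma test_function_mderiv Omega alpha phi : test_function Omega phi ->
  test_function Omega (mderiv alpha phi).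
Proof.
rewrite mderivE => tphi; elim: (mseq alpha) => //= i s; exact: test_function_partial.
Qed.

Lemma test_function_bounded Omega phi : test_function Omega phi ->
  exists2 M : R, 0 < M & forall x, `|phi x| <= M.
Proof.
move=> [sphi cphi _]; have [cont _] := sphi [::].
have /compact_bounded[M [_ HM]] : compact (phi @` closure [set x | phi x != 0]).
  by apply: continuous_compact => //; exact: continuous_subspaceT.
have M0 : 0 < `|M| + 1 by rewrite ltr_wpDl.
exists (`|M| + 1) => // x; have [->|phix] := eqVneq (phi x) 0; first by rewrite normr0 ltW.
apply: (HM (`|M| + 1)).
  by rewrite (le_lt_trans (ler_norm M))// ltrDl.
by exists x => //; exact: subset_closure.
Qed.

Lemma measurable_test_function Omega phi D : test_function Omega phi -> measurable_fun D phi.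
Proof.
by move=> [sphi _ _]; apply: measurable_funTS; apply: measurable_continuous_row; have [] := sphi [::].
Qed.

Lemma integral_mul_test_sub Omega Omega' g phi : Omega' `<=` Omega -> test_function Omega' phi ->
  (\int[leb n]_(x in Omega) (g x * phi x)%:E = \int[leb n]_(x in Omega') (g x * phi x)%:E)%E.
Proof.
move=> OO tphi; rewrite -[in RHS](setIidr OO) integral_mkcondr.
apply: eq_integral => x _; rewrite patchE; case: ifPn => // /negP.
by rewrite inE => nx; rewrite (test_function_eq0 tphi nx) mulr0.
Qed.

(** phi is bounded and g is integrable on the compact support. The finiteness so obtained allows
    subtraction of integrals in the extended reals. *)
Lemma integrable_mul_test Omega g phi : open Omega -> loc_integrable Omega g ->
  test_function Omega phi -> (leb n).-integrable Omega (EFin \o (fun x => g x * phi x)).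
Proof.
move=> oO lg tphi; have [sphi cphi phiO] := tphi; have [mg _] := lg.
have mO := open_measurable_row oO.
have [M M0 HM] := test_function_bounded tphi.
set K := closure _ in cphi phiO; have mK : measurable K by exact: compact_measurable_row.
have mgphi : measurable_fun Omega (fun x => g x * phi x).
  by apply: measurable_funM => //; exact: measurable_test_function tphi.
have igK := loc_integrable_sub_compact oO lg cphi phiO mK (@subset_refl _ K).
have : (leb n).-integrable K (EFin \o (fun x => g x * phi x)).
  apply: (le_integrable mK _ _ (integrableZl mK M (integrable_abse igK))).
    by apply/measurable_EFinP; apply: measurable_funS mgphi.
  move=> x _; rewrite /= lee_fin !normrM (gtr0_norm M0) normr_id mulrC.
  by rewrite ler_wpM2r.
move=> /(integrable_mkcond _ mK).1 iK.
apply: (eq_integrable mO ((EFin \o (fun x => g x * phi x)) \_ K)).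
  move=> x _; rewrite patchE; case: ifPn => // /negP; rewrite inE => nK /=.
  have -> : phi x = 0 by apply: contra_notP nK => /eqP phix; exact: subset_closure.
  by rewrite mulr0.
exact: integrableS iK.
Qed.

Lemma loc_integrableS Omega Omega' f : open Omega -> Omega' `<=` Omega -> open Omega' ->
  loc_integrable Omega f -> loc_integrable Omega' f.
Proof.
move=> oO OO oO' [mf fK]; split=> [|K cK KO].
  by apply: measurable_funS mf => //; exact: open_measurable_row.
by apply: fK => //; exact: subset_trans OO.
Qed.

Lemma loc_integrableB Omega f g : open Omega -> loc_integrable Omega f ->
  loc_integrable Omega g -> loc_integrable Omega (f \- g).
Proof.
move=> oO lf lg; have [[mf _] [mg _]] := (lf, lg).
split=> [|K cK KO]; first exact: measurable_funB.
have mK := compact_measurable_row cK.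
have iB := integrableB mK (loc_integrable_sub_compact oO lf cK KO mK (@subset_refl _ K))
  (loc_integrable_sub_compact oO lg cK KO mK (@subset_refl _ K)).
by have /integrableP[_] := iB.
Qed.

Lemma integral_mul_testB Omega f g phi : open Omega -> loc_integrable Omega f ->
  loc_integrable Omega g -> test_function Omega phi ->
  (\int[leb n]_(x in Omega) ((f \- g) x * phi x)%:E =
   \int[leb n]_(x in Omega) (f x * phi x)%:E - \int[leb n]_(x in Omega) (g x * phi x)%:E)%E.
Proof.
move=> oO lf lg tphi; have mO := open_measurable_row oO.
rewrite -integralB//; [|exact: integrable_mul_test..].
by apply: eq_integral => x _; rewrite /= mulrBl EFinB.
Qed.

(** The fundamental lemma for g - h. It makes norms of the chosen [weak_deriv] independent of the
    choice. *)
Lemma is_weak_deriv_ae_unique Omega alpha f g h : open Omega ->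
  is_weak_deriv Omega alpha f g -> is_weak_deriv Omega alpha f h ->
  {ae leb n, forall x, Omega x -> g x = h x}.
Proof.
move=> oO [lf lg Hg] [_ lh Hh].
have : {ae leb n, forall x, Omega x -> (g \- h) x = 0}.
  apply: ae_eq0_of_test_functions => // [|phi tphi]; first exact: loc_integrableB.
  have mO := open_measurable_row oO.
  have := Hg _ tphi; rewrite (Hh _ tphi) integral_mul_testB//.
  have := integrable_fin_num mO (integrable_mul_test oO lg tphi).
  have := integrable_fin_num mO (integrable_mul_test oO lh tphi).
  rewrite /comp.
  case: (integral _ _ _) => // a _; case: (integral _ _ _) => // b _.
  rewrite -!EFinM => -[] /(mulfI (negbT (signr_eq0 _ _))) ->.
  by rewrite subee.
by apply: filterS => x H /H /eqP; rewrite subr_eq0 => /eqP.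
Qed.

Lemma is_weak_derivS Omega Omega' alpha f g : open Omega -> open Omega' -> Omega' `<=` Omega ->
  is_weak_deriv Omega alpha f g -> is_weak_deriv Omega' alpha f g.
Proof.
move=> oO oO' OO [lf lg H].
split; [exact: loc_integrableS lf|exact: loc_integrableS lg|move=> phi tphi].
have := H _ (test_functionS OO tphi); rewrite !(integral_mul_test_sub _ OO)//.
exact: test_function_mderiv.
Qed.

Lemma is_weak_derivB Omega alpha f g f' g' : open Omega ->
  is_weak_deriv Omega alpha f g -> is_weak_deriv Omega alpha f' g' ->
  is_weak_deriv Omega alpha (f \- f') (g \- g').
Proof.
move=> oO [lf lg H] [lf' lg' H']; split=> [||phi tphi]; try exact: loc_integrableB.
have mO := open_measurable_row oO.
have tmphi := test_function_mderiv alpha tphi.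
rewrite !integral_mul_testB// H// H'// [RHS]muleBr; first by [].
  by [].
by apply: fin_num_adde_defr; have := integrable_fin_num mO (integrable_mul_test oO lg tphi).
Qed.

(** The alpha-derivative of f is tested against the beta-derivative of phi, and the sign
    (-1)^|alpha| cancels. *)
Lemma is_weak_deriv_comp Omega alpha beta f g h : open Omega ->
  is_weak_deriv Omega alpha f g -> is_weak_deriv Omega (mpoly.mnm_add alpha beta) f h ->
  is_weak_deriv Omega beta g h.
Proof.
move=> oO [lf lg Hg] [_ lh Hh]; split=> // phi tphi.
have := Hh _ tphi; rewrite mderivD; last by have [] := tphi.
rewrite Hg; last exact: test_function_mderiv.
rewrite mpoly.mdegD exprD EFinM.
have s2 : ((-1) ^+ mpoly.mdeg alpha * (-1) ^+ mpoly.mdeg alpha = 1 :> R).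
  by rewrite -expr2 sqrr_sign.
move/(congr1 (mule ((-1) ^+ mpoly.mdeg alpha)%:E)).
by rewrite !muleA -!EFinM s2 mul1e mul1r.
Qed.

Lemma is_weak_deriv_weak_deriv Omega alpha f g : is_weak_deriv Omega alpha f g ->
  is_weak_deriv Omega alpha f (weak_deriv Omega alpha f).
Proof. by move=> H; apply: (@xgetPex _ _ [set g | is_weak_deriv Omega alpha f g]); exists g. Qed.

End test_functions.

Section weak_derivative_limits.
Context {R : realType} {n : nat}.
Variables (E : set 'rV[R]_n) (q : \bar R).
Hypotheses (oE : open E) (finE : (leb n E < +oo)%E) (q1 : (1 <= q)%E).
Implicit Types (f g phi : 'rV[R]_n -> R) (alpha : mpoly.multinom n).

Let mE : measurable E := open_measurable_row oE.

Lemma Lp_loc_integrable f : Lp_space E q f -> loc_integrable E f.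
Proof.
move=> [/measurable_EFinP mf fq]; split=> // K cK KE.
have mK := compact_measurable_row cK.
have ff : Lp_norm E q (EFin \o f) = (fine (Lp_norm E q (EFin \o f)))%:E.
  by rewrite fineK// ge0_fin_numE// Lp_norm_ge0.
pose a := fine (Lp_norm E q (EFin \o f)) + 1.
have a0 : 0 < a by rewrite ltr_wpDl// fine_ge0// Lp_norm_ge0.
apply: (@le_lt_trans _ _ (\int[leb n]_(x in E) `|(f x)%:E|)%E).
  apply: ge0_subset_integral => //.
  by apply: measurableT_comp => //; apply/measurable_EFinP.
apply: (@le_lt_trans _ _ ((fine (leb n E) + 1) * a)%:E); last exact: ltry.
by apply: (integral_abs_le_Lp_norm mE finE q1) => //; rewrite ff lee_fin lerDl.
Qed.

Lemma integral_mul_test_close f g phi (M a : R) : loc_integrable E f -> loc_integrable E g ->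
  test_function E phi -> 0 < M -> (forall x, `|phi x| <= M) -> 0 < a ->
  (Lp_norm E q (EFin \o (f \- g)%R) <= a%:E)%E ->
  `|fine (\int[leb n]_(x in E) (f x * phi x)%:E)
    - fine (\int[leb n]_(x in E) (g x * phi x)%:E)| <= M * ((fine (leb n E) + 1) * a).
Proof.
move=> lf lg tphi M0 HM a0 fga; have [[mf _] [mg _]] := (lf, lg).
have mfg : measurable_fun E (f \- g) by exact: measurable_funB.
have ff := integrable_fin_num mE (integrable_mul_test oE lf tphi).
have fg := integrable_fin_num mE (integrable_mul_test oE lg tphi).
rewrite -lee_fin; set A := fine _; set B := fine _.
have -> : `|A - B|%:E = `|A%:E - B%:E|%E by [].
rewrite {}/A {}/B !fineK//.
have <- := integral_mul_testB oE lf lg tphi.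
have mphi := @measurable_test_function _ _ _ _ E tphi.
have mp : measurable_fun E (fun x => ((f \- g) x * phi x)%:E).
  by apply/measurable_EFinP; exact: measurable_funM.
apply: le_trans (le_abse_integral _ mE mp) _.
apply: (@le_trans _ _ (\int[leb n]_(x in E) (M%:E * `|((f \- g) x)%:E|))%E).
  apply: ge0_le_integral => //.
  - exact: measurableT_comp.
  - apply: measurable_funeM; apply: measurableT_comp => //; exact/measurable_EFinP.
  - by move=> x _; rewrite /= lee_fin normrM mulrC ler_wpM2r.
rewrite ge0_integralZl_EFin//; last 2 first.
- by apply: measurableT_comp => //; exact/measurable_EFinP.
- exact: ltW.
rewrite [in leRHS]EFinM lee_wpmul2l ?lee_fin ?(ltW M0)//.
exact: (integral_abs_le_Lp_norm mE finE q1 a0 mfg fga).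
Qed.

Lemma eq_of_half_pow_close (x y C : R) :
  (forall m, `|x - y| <= C * 2^-1 ^+ m) -> x = y.
Proof.
move=> H; apply/eqP; rewrite -subr_eq0 -normr_le0.
have c0 : (fun m => C * 2^-1 ^+ m : R) @ \oo --> 0.
  by rewrite -(mulr0 C); apply: cvgMr; apply: cvg_expr; rewrite ger0_norm//; lra.
by apply: (ler_cvg_to (cvg_cst _) c0); apply: nearW.
Qed.

(** Weak differentiation is a closed operator: for a fixed test function both pairings are
    continuous in L_q, since E has finite measure and the test function and its derivatives are
    bounded. *)
Lemma is_weak_deriv_lim alpha (u w : nat -> 'rV[R]_n -> R) f g :
  Lp_space E q f -> Lp_space E q g ->
  (forall m, is_weak_deriv E alpha (u m) (w m)) ->
  (forall m, Lp_norm E q (EFin \o (u m \- f)%R) <= (2^-1 ^+ m)%:E)%E ->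
  (forall m, Lp_norm E q (EFin \o (w m \- g)%R) <= (2^-1 ^+ m)%:E)%E ->
  is_weak_deriv E alpha f g.
Proof.
move=> /Lp_loc_integrable lf /Lp_loc_integrable lg uw uf wg; split=> // phi tphi.
have tmphi := test_function_mderiv alpha tphi.
have [M M0 HM] := test_function_bounded tphi.
have [M' M'0 HM'] := test_function_bounded tmphi.
have ff := integrable_fin_num mE (integrable_mul_test oE lf tmphi).
have fg := integrable_fin_num mE (integrable_mul_test oE lg tphi).
have ff' := fineK ff; have fg' := fineK fg; rewrite /comp in ff' fg'.
rewrite -ff' -fg' -EFinM; congr (_%:E).
set c := (-1) ^+ _; have c1 : `|c| = 1 by rewrite normrX normrN1 expr1n.
apply: (@eq_of_half_pow_close _ _ ((M + M') * (fine (leb n E) + 1))) => m.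
have [lu lw Hm] := uw m; have {Hm} := congr1 fine (Hm _ tphi).
have fw := integrable_fin_num mE (integrable_mul_test oE lw tphi).
rewrite fineM//= -/c => Hm.
have h0 : 0 < 2^-1 ^+ m :> R by exact: half_gt0.
have := integral_mul_test_close lu lf tmphi M'0 HM' h0 (uf m).
have := integral_mul_test_close lw lg tphi M0 HM h0 (wg m).
rewrite Hm; rewrite /comp.
set A := fine _; set B := fine _; set C := fine (integral _ _ _) => h1 h2.
have -> : C - c * B = (c * (A - B)) - (c * A - C) by lra.
apply: le_trans (ler_normB _ _) _; rewrite normrM c1 mul1r.
apply: le_trans (lerD h1 h2) _.
by rewrite -!mulrA -mulrDl.
Qed.

End weak_derivative_limits.

Section sobolev_spaces.
Import -(notations) mpoly.
Context {R : realType} {n : nat}.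
Implicit Types (Omega E : set 'rV[R]_n) (f g u : 'rV[R]_n -> R) (alpha beta : multinom n).

Lemma eq_Lp_norm_weak_deriv Omega (q : \bar R) alpha f g : open Omega -> (1 <= q)%E ->
  is_weak_deriv Omega alpha f g ->
  Lp_norm Omega q (EFin \o weak_deriv Omega alpha f) = Lp_norm Omega q (EFin \o g).
Proof.
move=> oO q1 H; have H' := is_weak_deriv_weak_deriv H.
have [_ [mg _] _] := H; have [_ [mw _] _] := H'.
apply: eq_ae_Lp_norm => //; first exact: open_measurable_row.
- exact/measurable_EFinP.
- exact/measurable_EFinP.
by apply: filterS (is_weak_deriv_ae_unique oO H' H) => x Hx Ox /=; rewrite Hx.
Qed.

Lemma sobolev_weak_deriv k Omega (q : \bar R) f alpha : open Omega -> (1 <= q)%E ->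
  sobolev k Omega q f -> (mdeg alpha <= k)%N ->
  Lp_space Omega q (weak_deriv Omega alpha f) /\
  is_weak_deriv Omega alpha f (weak_deriv Omega alpha f).
Proof.
move=> oO q1 [_ H] ak; have [g [_ gq] Hg] := H _ ak.
have Hw := is_weak_deriv_weak_deriv Hg; split=> //; split.
  by have [_ [mw _] _] := Hw; exact/measurable_EFinP.
by rewrite (eq_Lp_norm_weak_deriv oO q1 Hg).
Qed.

Lemma sobolev_norm_ge0 k Omega (q : \bar R) f : (0 <= sobolev_norm k Omega q f)%E.
Proof. by apply: sume_ge0 => alpha _; exact: Lp_norm_ge0. Qed.

Lemma sobolev_norm_lty k Omega (q : \bar R) f : open Omega -> (1 <= q)%E ->
  sobolev k Omega q f -> (sobolev_norm k Omega q f < +oo)%E.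
Proof.
move=> oO q1 H; apply: lte_sum_pinfty => alpha _.
have ak : (mdeg (bmnm alpha) <= k)%N by rewrite -ltnS; exact: bmdeg.
by have [[]] := sobolev_weak_deriv oO q1 H ak.
Qed.

Lemma Lp_norm_le_sobolev_norm k Omega (q : \bar R) f alpha : (mdeg alpha <= k)%N ->
  (Lp_norm Omega q (EFin \o weak_deriv Omega alpha f) <= sobolev_norm k Omega q f)%E.
Proof.
rewrite -ltnS => ak; rewrite /sobolev_norm (bigD1 (BMultinom ak))//=.
by rewrite leeDl// sume_ge0// => i _; exact: Lp_norm_ge0.
Qed.

Lemma sobolevW k m Omega (q : \bar R) f : (k <= m)%N -> sobolev m Omega q f ->
  sobolev k Omega q f.
Proof. by move=> km [fq H]; split=> // alpha ak; apply: H; exact: leq_trans km. Qed.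

(** The beta-derivative of the alpha-derivative is the (alpha + beta)-derivative, whose norm is one
    summand on the right; the factor counts the beta. *)
Lemma sobolev_weak_deriv_sobolev k l Omega (q : \bar R) f alpha : open Omega -> (1 <= q)%E ->
  sobolev (k + l) Omega q f -> (mdeg alpha <= l)%N ->
  sobolev k Omega q (weak_deriv Omega alpha f) /\
  (sobolev_norm k Omega q (weak_deriv Omega alpha f) <=
   #|{: bmultinom n k.+1}|%:R%:E * sobolev_norm (k + l) Omega q f)%E.
Proof.
move=> oO q1 H al; have akl : (mdeg alpha <= k + l)%N by rewrite (leq_trans al)// leq_addl.
have [wq Hw] := sobolev_weak_deriv oO q1 H akl.
have bkl beta : (mdeg beta <= k)%N -> (mdeg (mnm_add alpha beta) <= k + l)%N.
  by move=> bk; rewrite mdegD addnC leq_add.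
split.
  split=> // beta bk; have [hq Hh] := sobolev_weak_deriv oO q1 H (bkl _ bk).
  by exists (weak_deriv Omega (mnm_add alpha beta) f) => //; exact: is_weak_deriv_comp Hh.
rewrite /sobolev_norm; set S := (X in (_ <= _ * X)%E).
have S0 : (0 <= S)%E by apply: sobolev_norm_ge0.
apply: (@le_trans _ _ (\sum_(beta : bmultinom n k.+1) S)%E).
  apply: lee_sum => beta _.
  have bk : (mdeg (bmnm beta) <= k)%N by rewrite -ltnS; exact: bmdeg.
  have [hq Hh] := sobolev_weak_deriv oO q1 H (bkl _ bk).
  rewrite (eq_Lp_norm_weak_deriv oO q1 (is_weak_deriv_comp oO Hw Hh)).
  exact: Lp_norm_le_sobolev_norm (bkl _ bk).
by rewrite sumr_const mule_natl.
Qed.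

End sobolev_spaces.

(** * Compact embeddings of Sobolev spaces *)

Section compact_embeddings.
Import -(notations) mpoly.
Context {R : realType} {n : nat}.
Variables (k : nat) (Omega : set 'rV[R]_n) (p : R) (q : \bar R).
Hypotheses (n0 : (0 < n)%N) (k0 : (0 < k)%N) (p1 : 1 < p) (Omega_open : open Omega)
  (Omega_nset : is_nset Omega) (WC : sobolev_eq_calderon k Omega p%:E)
  (hq : admissible_exponent n k p q).
Variable E : set 'rV[R]_n.
Hypotheses (mE : measurable E) (EO : E `<=` Omega) (bE : bounded_set E).

Local Notation X := (sobolev k Omega p%:E).
Local Notation NX := (sobolev_norm k Omega p%:E).

Let q1 : (1 <= q)%E. Proof. by have [] := hq. Qed.

Let p1e : (1 <= p%:E)%E. Proof. by rewrite lee_fin ltW. Qed.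

Let finE : (leb n E < +oo)%E.
Proof. by have [B HB] := bounded_set_coord bE; exact: leb_bounded_lty mE HB. Qed.

Lemma sobolev_embedding_bounded : exists2 D : R, 0 <= D &
  forall f, X f -> (Lp_norm E q (EFin \o f) <= D%:E * NX f)%E.
Proof.
have [XC [c1 [c2 [_ c20 Hc]]]] := WC.
have [D HD] := calderon_embedding_bounded n0 k0 p1 Omega_open Omega_nset hq mE EO bE.
exists (`|D| * c2); first by rewrite mulr_ge0// ltW.
move=> f Xf; have /andP[_ h2] := Hc _ Xf; rewrite XC in Xf.
apply: le_trans (HD _ Xf) _; rewrite EFinM -muleA.
have N0 : (0 <= calderon_norm k Omega p%:E f)%E by rewrite adde_ge0// Lp_norm_ge0.
apply: (@le_trans _ _ (`|D|%:E * calderon_norm k Omega p%:E f)%E).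
  by rewrite lee_wpmul2r// lee_fin ler_norm.
by rewrite lee_wpmul2l// lee_fin.
Qed.

Lemma sobolev_embedding_totally_bounded (M e : R) : 0 < e ->
  exists (I : finType) (col : ('rV[R]_n -> R) -> I), forall f f',
    X f -> (NX f <= M%:E)%E -> X f' -> (NX f' <= M%:E)%E -> col f = col f' ->
    (Lp_norm E q (EFin \o (f \- f')%R) <= e%:E)%E.
Proof.
move=> e0; have [XC [c1 [c2 [_ c20 Hc]]]] := WC.
have N0 : 0 < c2 * (`|M| + 1) by rewrite mulr_gt0// ltr_wpDl.
have [I [col Hcol]] := calderon_embedding_totally_bounded n0 k0 p1 Omega_open Omega_nset
  hq mE EO bE N0 e0.
have bound f : X f -> (NX f <= M%:E)%E ->
    (calderon_norm k Omega p%:E f <= (c2 * (`|M| + 1))%:E)%E.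
  move=> Xf fM; have /andP[_ /le_trans] := Hc _ Xf; apply.
  rewrite EFinM lee_wpmul2l ?lee_fin ?(ltW c20)//; apply: le_trans fM _.
  by rewrite lee_fin (le_trans (ler_norm M))// lerDl.
exists I, col => f f' Xf fM Xf' fM' ff'; have fN := bound _ Xf fM; have fN' := bound _ Xf' fM'.
by rewrite XC in Xf Xf'; exact: Hcol.
Qed.

Lemma sobolev_sub_Lp : X `<=` Lp_space E q.
Proof.
move=> f Xf; have [[/measurable_EFinP mf _] _] := Xf; split.
  apply/measurable_EFinP; apply: measurable_funS mf => //; exact: open_measurable_row.
have [D D0 /(_ _ Xf) HD] := sobolev_embedding_bounded.
apply: le_lt_trans HD _; apply: lte_mul_pinfty; rewrite ?lee_fin//.
exact: sobolev_norm_lty.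
Qed.

Lemma Lp_limit_of_cauchy (u : nat -> 'rV[R]_n -> R) : (forall m, Lp_space E q (u m)) ->
  (forall i m m', (i <= m)%N -> (i <= m')%N ->
    (Lp_norm E q (EFin \o (u m \- u m')%R) <= (2^-1 ^+ i)%:E)%E) ->
  exists2 v, Lp_space E q v &
    forall i, (Lp_norm E q (EFin \o (u i \- v)%R) <= (2^-1 ^+ i)%:E)%E.
Proof.
move=> uL uC; have mu m : measurable_fun E (u m) by have [/measurable_EFinP] := uL m.
have [v mv Hv] := Lp_complete mE finE q1 mu uC.
exists v => //; split; first exact/measurable_EFinP.
(* The triangle inequality through the first term puts the limit in L_q. *)
have -> : v = (u 0%N \+ (\- (u 0%N \- v)))%R by apply/funext => x /=; lra.
have mB : measurable_fun E (u 0%N \- v)%R by exact: measurable_funB.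
apply: le_lt_trans (Lp_normD mE q1 (mu 0%N) _) _; first exact: measurableT_comp.
rewrite Lp_normN lte_add_pinfty//; first by have [_] := uL 0%N.
by apply: le_lt_trans (Hv 0%N) _; exact: ltry.
Qed.

Lemma cvg_0_of_half_pow (x : nat -> \bar R) (C : R) : (forall j, 0 <= x j)%E ->
  (forall j, x j <= (C * 2^-1 ^+ j)%:E)%E -> x j @[j --> \oo] --> 0%E.
Proof.
move=> x0 xC; have c0 : ((C * 2^-1 ^+ j)%:E : \bar R) @[j --> \oo] --> 0%E.
  apply/cvg_EFin; first exact: nearW.
  by rewrite -(mulr0 C); apply: cvgMr; apply: cvg_expr; rewrite ger0_norm//; lra.
apply: (squeeze_cvge _ (cvg_cst 0%E) c0).
by apply: nearW => j; rewrite x0 xC.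
Qed.

Lemma sobolev_in_Lp_bounded : sobolev_in_Lp k Omega p%:E E q.
Proof.
split; first exact: sobolev_sub_Lp.
  by have [D _ HD] := sobolev_embedding_bounded; exists D.
move=> u uX [M uM].
have [|sigma [smono Hs]] := @totally_bounded_cauchy_subsequence R unit
  (fun _ m m' => Lp_norm E q (EFin \o (u m \- u m')%R)).
  move=> _ e e0; have [I [col Hcol]] := sobolev_embedding_totally_bounded M e0.
  by exists I, (col \o u) => m m' mm'; exact: Hcol.
exists sigma; split=> //.
have [||v vL Hv] := @Lp_limit_of_cauchy (u \o sigma).
- by move=> m; apply: sobolev_sub_Lp; exact: uX.
- by move=> i m m'; exact: (Hs tt).
exists v => //; apply: (@cvg_0_of_half_pow _ 1) => j; first exact: Lp_norm_ge0.
by rewrite mul1r; exact: Hv.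
Qed.

Hypothesis oE : open E.
Variable l : nat.

Local Notation W u alpha := (weak_deriv Omega alpha u).

(** Every derivative of order at most l belongs to the Sobolev space of order k, so the L_q
    embedding applies to it. One subsequence makes all of them Cauchy, and their limits are the
    derivatives of one function because weak differentiation is closed. *)
Lemma sobolev_in_sobolev_bounded : sobolev_in_sobolev (k + l) Omega p%:E l E q.
Proof.
pose Nk : R := #|{: bmultinom n k.+1}|%:R.
pose Nl : R := #|{: bmultinom n l.+1}|%:R.
have [D D0 HD] := sobolev_embedding_bounded.
have akl (alpha : multinom n) : (mdeg alpha <= l)%N -> (mdeg alpha <= k + l)%N.
  by move=> al; rewrite (leq_trans al)// leq_addl.
have WX u alpha : sobolev (k + l) Omega p%:E u -> (mdeg alpha <= l)%N -> X (W u alpha).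
  by move=> Xu al; have [] := sobolev_weak_deriv_sobolev Omega_open p1e Xu al.
have WN u alpha : sobolev (k + l) Omega p%:E u -> (mdeg alpha <= l)%N ->
    (NX (W u alpha) <= Nk%:E * sobolev_norm (k + l) Omega p%:E u)%E.
  by move=> Xu al; have [] := sobolev_weak_deriv_sobolev Omega_open p1e Xu al.
have WD u alpha : sobolev (k + l) Omega p%:E u -> (mdeg alpha <= l)%N ->
    is_weak_deriv E alpha u (W u alpha).
  move=> Xu al; apply: (is_weak_derivS Omega_open oE EO).
  by have [] := sobolev_weak_deriv Omega_open p1e Xu (akl _ al).
have bml (alpha : bmultinom n l.+1) : (mdeg (bmnm alpha) <= l)%N.
  by rewrite -ltnS; exact: bmdeg.
split.
- move=> u Xu; split.
    by apply: sobolev_sub_Lp; apply: sobolevW Xu; exact: leq_addr.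
  move=> alpha al; exists (W u alpha); last exact: WD.
  by apply: sobolev_sub_Lp; exact: WX.
- exists (Nl * (D * Nk)) => u Xu.
  have N0 : (0 <= sobolev_norm (k + l) Omega p%:E u)%E by exact: sobolev_norm_ge0.
  apply: (@le_trans _ _ (\sum_(alpha : bmultinom n l.+1)
      ((D * Nk)%:E * sobolev_norm (k + l) Omega p%:E u))%E).
    apply: lee_sum => alpha _.
    rewrite (eq_Lp_norm_weak_deriv oE q1 (WD _ _ Xu (bml alpha))).
    apply: le_trans (HD _ (WX _ _ Xu (bml alpha))) _.
    by rewrite EFinM -muleA lee_wpmul2l ?lee_fin//; exact: WN.
  by rewrite sumr_const [in leRHS]EFinM -muleA mule_natl.
move=> u uX [M uM].
have NM m alpha : (mdeg alpha <= l)%N -> (NX (W (u m) alpha) <= (Nk * M)%:E)%E.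
  move=> al; apply: le_trans (WN _ _ (uX m) al) _.
  by rewrite EFinM lee_wpmul2l// lee_fin ler0n.
have [|sigma [smono Hs]] := @totally_bounded_cauchy_subsequence R (bmultinom n l.+1)
  (fun alpha m m' => Lp_norm E q (EFin \o (W (u m) (bmnm alpha) \- W (u m') (bmnm alpha))%R)).
  move=> alpha e e0; have [I [col Hcol]] := sobolev_embedding_totally_bounded (Nk * M) e0.
  exists I, (fun m => col (W (u m) (bmnm alpha))) => m m' mm'.
  by apply: Hcol => //; try exact: WX; exact: NM.
have lim (alpha : bmultinom n l.+1) : exists v, Lp_space E q v /\
    forall i, (Lp_norm E q (EFin \o (W (u (sigma i)) (bmnm alpha) \- v)%R) <= (2^-1 ^+ i)%:E)%E.
  have [||v vL Hv] := @Lp_limit_of_cauchy (fun m => W (u (sigma m)) (bmnm alpha)).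
  - by move=> m; apply: sobolev_sub_Lp; exact: WX.
  - exact: Hs.
  by exists v.
have [v Hv] := choice lim.
(* The limit is read off from the derivatives of order 0, that is, from the representatives of u
   that [weak_deriv] selects. *)
have l0 : (mdeg (@mnm0 n) < l.+1)%N by rewrite mdeg0.
pose o : bmultinom n l.+1 := BMultinom l0.
have vD alpha : is_weak_deriv E (bmnm alpha) (v o) (v alpha).
  apply: (is_weak_deriv_lim oE finE q1 (Hv o).1 (Hv alpha).1 _ (Hv o).2 (Hv alpha).2) => m.
  apply: (is_weak_deriv_comp oE (WD _ _ (uX (sigma m)) (bml o))).
  by rewrite /= add0m; exact: WD.
exists sigma; split=> //; exists (v o).
  split; first exact: (Hv o).1.
  move=> alpha al; exists (v (BMultinom (al : mdeg alpha < l.+1)%N)); first exact: (Hv _).1.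
  exact: (vD (BMultinom (al : mdeg alpha < l.+1)%N)).
apply: (@cvg_0_of_half_pow _ Nl) => j; first exact: sobolev_norm_ge0.
apply: (@le_trans _ _ (\sum_(alpha : bmultinom n l.+1) (2^-1 ^+ j)%:E)%E).
  apply: lee_sum => alpha _.
  rewrite (eq_Lp_norm_weak_deriv oE q1 (is_weak_derivB oE (WD _ _ (uX (sigma j)) (bml alpha)) (vD alpha))).
  exact: (Hv alpha).2.
by rewrite sumr_const EFinM mule_natl.
Qed.

End compact_embeddings.

(** On an unbounded set such as R^n the translates of a bump have no convergent subsequence. Both
    embeddings are therefore stated in the same two forms: locally, on relatively compact open
    subsets or on compact sets, and on all of Omega when it is bounded. *)
Theorem theorem4 (R : realType) (n k l : nat) (p : R) (Omega : set 'rV[R]_n)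
    (hn : (0 < n)%N) (hk : (0 < k)%N) (hl : (0 < l)%N) (hp : 1 < p)
    (Omega_open : open Omega) (Omega_nset : is_nset Omega)
    (WC : sobolev_eq_calderon k Omega p%:E)
    (q : \bar R) (hq : admissible_exponent n k p q) :
  [/\
    (forall Omega' : set 'rV[R]_n, open Omega' -> compact (closure Omega') ->
       closure Omega' `<=` Omega ->
       sobolev_in_sobolev (k + l) Omega p%:E l Omega' q),
    (bounded_set Omega -> sobolev_in_sobolev (k + l) Omega p%:E l Omega q),
    (forall K : set 'rV[R]_n, measurable K -> compact K -> K `<=` Omega ->
       sobolev_in_Lp k Omega p%:E K q) &
    (bounded_set Omega -> sobolev_in_Lp k Omega p%:E Omega q)].
Proof.
have mO := open_measurable_row Omega_open.
split.
- move=> Omega' oO' cO' O'O; apply: sobolev_in_sobolev_bounded => //.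
  + exact: open_measurable_row.
  + by apply: subset_trans O'O; exact: subset_closure.
  + have [B [Br HB]] := compact_bounded cO'.
    by exists B; split=> // b Bb x Ox; apply: (HB b Bb); exact: subset_closure.
- by move=> bO; exact: sobolev_in_sobolev_bounded.
- by move=> K mK cK KO; apply: sobolev_in_Lp_bounded => //; exact: compact_bounded.
- by move=> bO; exact: sobolev_in_Lp_bounded.
Qed.
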